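(* Let $1=S_0>S_1>S_2>\dots>0$ be the times of changes of slope of $(\Gamma(s):0<s\le 1)$ taken in reversed (decreasing) time. Then $\ell_n$ has slope $\Gamma'(s)$ for $S_n\ge s>S_{n+1}$. Writing $Y_n=\Gamma(S_n)-S_n\Gamma'(S_n)$ for the intercept of $\ell_n$ on the $y$-axis, for all $n\ge0$ $$ \frac{1}{S_{n+1}}=\frac1{S_n}+\frac{4}{Y_n^2}E_{n+1},\qquad \Gamma'(S_{n+1})=\Gamma'(S_n)+\frac{Y_n}{S_{n+1}}\sqrt{U_{n+1}}, $$ where the random variables $E_1,E_2,\dots$ have standard (unit mean) Exponential distributions, $U_1,U_2,\dots$ have Uniform$[0,1]$ distributions, and all of these are independent of each other and of the pair $(\Gamma(1),\Gamma'(1))=(\Gamma(S_0),\Gamma'(S_0))$, whose joint distribution is given by $\mathbb{P}[\Gamma(1)>\gamma]=\exp(-\gamma^2/4)$ for $\gamma>0$ together with $\Gamma'(1)$ being, conditionally on $\Gamma(1)$, Uniform$[0,\Gamma(1)]$.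
   Context: Let $\Pi_\infty$ be the improper anisotropic Poisson line process in $\mathbb{R}^2$: the Poisson process on the space of non-vertical lines whose intensity measure, when a line is parametrized by the heights $y_-,y_+\in\mathbb{R}$ of its intercepts with $x=-1$ and $x=+1$, is $d\nu=\tfrac14\,dy_-\,dy_+$. Let $\Pi_{\infty,+}$ be the set of lines of $\Pi_\infty$ with positive slope which meet the negative $x$-axis. The seminal curve $\Gamma=\Gamma_+$ is defined for $s\in(0,1]$ by $\Gamma(s)=\inf\{\text{height of the intercept of }\ell\text{ on }x=s:\ell\in\Pi_{\infty,+}\}$. It is continuous, concave, strictly increasing and piecewise linear. The slope $\Gamma'$ is taken to be continuous from the left with right limits on $(0,1]$ (so at a change of slope $\Gamma'(s)$ is the left derivative). The lines $\ell_0,\ell_1,\ell_2,\dots$ are the lines of $\Pi_{\infty,+}$ that are components of $(\Gamma(s):0<s\le1)$ (i.e. coincide with $\Gamma$ along a non-degenerate linear piece), enumerated by increasing height of their intercepts on $x=1$. *)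

(* Defs.v *)
From HB Require Import structures.
From mathcomp Require Import all_boot all_order all_algebra finmap.
From mathcomp Require Import all_classical all_reals all_analysis.
From mathcomp Require Import measurable_realfun.

Set Implicit Arguments.
Unset Strict Implicit.
Unset Printing Implicit Defensive.

Import Order.TTheory GRing.Theory Num.Theory.
Import numFieldNormedType.Exports.

Local Open Scope classical_set_scope.
Local Open Scope ring_scope.

Definition generated_by d d' (Omega : measurableType d) (T : measurableType d')
    (X : Omega -> T) : set (set Omega) :=
  preimage_set_system setT X measurable.

Definition mutually_independent d (Omega : measurableType d) (R : realType)
    (P : probability Omega R) (I : choiceType) (F : I -> set (set Omega)) : Prop :=
  forall (J : {fset I}) (A : I -> set Omega),
    (forall i, i \in J -> F i (A i)) ->
    (P (\bigcap_(i in [set` J]) A i) = \prod_(i <- J) P (A i))%E.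

Definition number_in (R : realType) (Omega : Type) (T : choiceType)
    (Pi : Omega -> set T) (A : set T) (w : Omega) : \bar R :=
  counting (Pi w `&` A).

(* A Poisson process as a random set of points.  A set carries no
   multiplicities, so this is the general notion only for an atomless [nu].
   In the law of the counts, [poisson_pmf] is not used directly because it is
   constantly 1 at rate 0, where [poisson_prob] is the Dirac mass at 0; the
   second argument of [poisson_prob] is a dummy. *)
Definition is_poisson_process d d' (Omega : measurableType d) (R : realType)
    (P : probability Omega R) (T : measurableType d')
    (nu : {measure set T -> \bar R}) (Pi : Omega -> set T) : Prop :=
  [/\ forall A, measurable A ->
        measurable_fun setT (number_in R Pi A),
      forall A, measurable A -> (nu A < +oo)%E -> forall k : nat,
        P [set w | number_in R Pi A w = k%:R%:E]
          = poisson_prob (fine (nu A)) k [set k],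
      forall A, measurable A -> nu A = +oo%E ->
        P [set w | number_in R Pi A w = +oo%E] = 1%E
    & forall A : nat -> set T, (forall i, measurable (A i)) ->
        trivIset setT A ->
        mutually_independent P
          (fun i => generated_by (number_in R Pi (A i)))].

(* The line with intercepts [l.1] on x = -1 and [l.2] on x = +1.
   [measurableTypeR R] is [R] with the Borel sigma-algebra on which
   [lebesgue_measure] is defined. *)
Definition line (R : realType) : Type :=
  (measurableTypeR R * measurableTypeR R)%type.

Definition slope (R : realType) (l : line R) : R :=
  ((l.2 : R) - (l.1 : R)) / 2.

Definition height (R : realType) (l : line R) (x : R) : R :=
  ((l.1 : R) + (l.2 : R)) / 2 + slope l * x.

Definition line_intensity (R : realType) :
    {measure set (measurableTypeR R * measurableTypeR R)%type -> \bar R} :=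
  mscale (4^-1)%:nng
    (@lebesgue_measure R \x @lebesgue_measure R)%E.

Definition positive_lines (R : realType) (L : set (line R)) : set (line R) :=
  [set l | [/\ L l, 0 < slope l & exists2 x, x < 0 & height l x = 0]].

Definition seminal_curve (R : realType) (L : set (line R)) (s : R) : R :=
  inf [set height l s | l in positive_lines L].

Definition left_slope (R : realType) (G : R -> R) (s : R) : R :=
  lim ((G t - G s) / (t - s) @[t --> s^'-]).

(* The slope is left-continuous with right limits, so it changes exactly where
   it fails to be right-continuous. *)
Definition slope_change (R : realType) (G : R -> R) (s : R) : Prop :=
  0 < s < 1 /\ ~ (left_slope G t @[t --> s^'+] --> left_slope G s).

(* [S 0 = 1] is the starting time; the changes of slope are [S 1 > S 2 > ...] *)
Definition slope_change_times (R : realType) (G : R -> R) (S : nat -> R) : Prop :=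
  [/\ S 0%N = 1, forall n, S n.+1 < S n
    & range (fun n => S n.+1) = slope_change G].

Definition is_component (R : realType) (L : set (line R)) (l : line R) : Prop :=
  positive_lines L l /\
  exists a b : R, [/\ 0 < a, a < b, b <= 1
    & forall s, a <= s <= b -> seminal_curve L s = height l s].

Definition component_lines (R : realType) (L : set (line R))
    (ell : nat -> line R) : Prop :=
  (forall n, height (ell n) 1 < height (ell n.+1) 1) /\
  range ell = is_component L.

(* The intercept on the y-axis of the tangent to [G] at time [s], taken with
   the left slope. *)
Definition y_intercept (R : realType) (G : R -> R) (s : R) : R :=
  G s - s * left_slope G s.

(* The index [None] stands for a random element [X], [Some (inl n)] for [E n]
   and [Some (inr n)] for [U n]. *)
Definition joint_family d d' (Omega : measurableType d) (T : measurableType d')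
    (R : realType) (X : Omega -> T) (E U : nat -> Omega -> R)
    (i : option (nat + nat)) : set (set Omega) :=
  match i with
  | None => generated_by X
  | Some (inl n) => generated_by (E n)
  | Some (inr n) => generated_by (U n)
  end.

(* Given [G], [D] is uniform on [0, G]: the regular conditional distribution. *)
Definition conditionally_uniform d (Omega : measurableType d) (R : realType)
    (P : probability Omega R) (G D : Omega -> R) : Prop :=
  forall B C : set R, measurable B -> measurable C ->
    (P (G @^-1` B `&` D @^-1` C) =
     \int[P]_(w in G @^-1` B)
        \int[lebesgue_measure]_(x in C) (uniform_pdf 0 (G w) x)%:E)%E.

(* Main.v *)
Require Import Defs.
From HB Require Import structures.
From mathcomp Require Import all_boot all_order all_algebra finmap.
From mathcomp Require Import all_classical all_reals all_analysis.
From mathcomp Require Import measurable_realfun.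
From mathcomp Require Import ring lra.

(** Sweep the lines from time 1 down to time 0. Just before a time [s] the curve
    follows a line, of intercept [c] on the y-axis and slope [m]; the lines that
    can take over later in the sweep are those of positive intercept below [c]
    that are above the current line at time [s] ([ahead]). Nothing is known of
    them yet. Such a line crosses the current one at a time [t] and cuts the
    y-axis at a height [c * (1 - sqrt u)]; put [1 / t = 1 / s + (4 / c ^ 2) * e].
    In the coordinates [(e, u)] the unexplored region is the strip
    [(0, +oo) x (0, 1)] and the intensity is Lebesgue measure
    ([ge0_integral_ahead]). The next component is the line with the smallest
    [e]: hence [e] is exponential, [u] is uniform, both are independent, and the
    region ahead of the new line is unexplored again. The start is similar: the
    lines of positive slope and intercept are parametrized by their height
    [2 * sqrt e] at time 1 and the fraction [u] of it that is due to the slope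
    ([ge0_integral_quadrant]).

    The proof makes this rigorous without stopping times or a strong Markov
    property. The curve seen from a state ([residual]) is a lower envelope, and
    its law is determined by the probabilities that no line passes below finitely
    many targets ([path_law_unique]), which are void probabilities
    [exp (- intensity)]. So it suffices to compare void probabilities. If [V] is
    the set of the points of the strip whose lines pass below a target, one needs
    that [exp (- |V|)] is the expectation, over an exponential [e] and a uniform
    [u], of [exp (- |V /\ {e' > e}|)] on the event that [(e, u)] is not in [V]
    ([first_point_identity]). This is the fact that a random variable with hazard
    rate [a e], the length of the section at [e] of the complement of [V], is
    finite ([hazard_rate_total]). The geometric input is [step_later]: when the
    line at [(e, u)] avoids the targets, a line that passes below one of them is
    ahead of the new state if and only if its first coordinate exceeds [e]. The
    outcome is [step_law], and [first_law] for the start: the curve is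
    distributed as the one obtained by drawing [(e, u)], moving to the new state,
    and completing with an independent copy of the lines.

    The state and the coordinates of every step are measurable functions of the
    curve ([next], [increment]), and on a curve composed as above they give back
    the pair that was drawn ([recover_step]). By induction on the number of steps
    the increments of the curve are independent pairs with the announced law
    ([increments_law], [start_law]). Finally, almost surely the lines are locally
    finite and have arbitrarily small intercepts ([good_event]); for such a set of
    lines the components form a sequence, whose successive states are the ones
    read on the curve, so that the recursion of the theorem just inverts the
    definition of the increments ([curve_structure]). *)

Set Implicit Arguments.
Unset Strict Implicit.
Unset Printing Implicit Defensive.

Import Order.TTheory GRing.Theory Num.Theory.
Import numFieldNormedType.Exports.

Local Open Scope classical_set_scope.
Local Open Scope ring_scope.

(** * Densities and substitutions *)

(** [pushforward] along a function whose measurability is a hypothesis, packed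
    as a measure. *)
Definition image_measure d d' (T1 : measurableType d) (T2 : measurableType d')
    (R : realType) (m : {measure set T1 -> \bar R}) (f : T1 -> T2)
    (mf : measurable_fun setT f) : {measure set T2 -> \bar R}.
Proof. by refine (pushforward m f : {measure set T2 -> \bar R}). Defined.

Lemma integral_indicT d (T : measurableType d) (R : realType)
    (m : {measure set T -> \bar R}) (A : set T) : measurable A ->
  (\int[m]_x (\1_A x)%:E = m A)%E.
Proof. by move=> mA; rewrite integral_indic// setIT. Qed.

Section density_integral.
Local Open Scope ereal_scope.
Context {d} {T : measurableType d} {R : realType}.
Variables (m1 m : {measure set T -> \bar R}) (w : T -> R).
Hypotheses (mw : measurable_fun setT w) (w0 : forall x, (0 <= w x)%R).
Hypothesis m1E : forall A, measurable A -> m1 A = \int[m]_(x in A) (w x)%:E.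

Import HBNNSimple.

Let density_nnsfun (g : {nnsfun T >-> R}) :
  \int[m1]_x (g x)%:E = \int[m]_x ((g x)%:E * (w x)%:E).
Proof.
under eq_integral do rewrite fimfunE -fsumEFin//.
rewrite ge0_integral_fsum//; last 2 first.
  - by move=> r; exact/measurable_EFinP/measurableT_comp.
  - by move=> n x _; rewrite EFinM nnfun_muleindic_ge0.
under [RHS]eq_integral.
  move=> x _; rewrite fimfunE -fsumEFin// ge0_mule_fsuml; last first.
    by move=> r; rewrite EFinM nnfun_muleindic_ge0.
  over.
rewrite [RHS]ge0_integral_fsum//; last 2 first.
  - move=> r; apply: emeasurable_funM => //.
    exact/measurable_EFinP/measurableT_comp.
    exact/measurable_EFinP.
  - move=> n x _; apply: mule_ge0; last by rewrite lee_fin.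
    by rewrite EFinM nnfun_muleindic_ge0.
apply: eq_fsbigr => r _.
have mr : measurable (g @^-1` [set r]) by [].
rewrite (eq_integral (fun x => r%:E * (\1_(g @^-1` [set r]) x)%:E)); last first.
  by move=> x _; rewrite EFinM.
rewrite integralZl_indic_nnsfun// integral_indic// setIT m1E//.
rewrite [X in _ * X]integral_mkcond.
have [r0|r0] := leP 0%R r; last first.
  rewrite preimage_nnfun0//.
  rewrite !integral0_eq ?mule0//.
    by move=> x _; rewrite indicE in_set0 mulr0 mul0e.
  by move=> x _; rewrite patchE in_set0.
rewrite -ge0_integralZl//.
- apply: eq_integral => x _; rewrite patchE indicE.
  by case: ifPn => _; rewrite ?mulr1// mulr0 mul0e mule0.
- by apply/(measurable_restrictT _ _).1 => //; exact/measurable_EFinP/measurable_funTS.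
- by move=> x _; rewrite patchE; case: ifP => //; rewrite lee_fin.
Qed.

(** Indicators satisfy the formula by hypothesis, simple functions by
    linearity, and nonnegative functions by monotone convergence. *)
Lemma density_integral (f : T -> \bar R) :
  measurable_fun setT f -> (forall x, 0 <= f x) ->
  \int[m1]_x f x = \int[m]_x (f x * (w x)%:E).
Proof.
move=> mf f0.
pose f_ := nnsfun_approx measurableT mf.
transitivity (lim (\int[m1]_x (f_ n x)%:E @[n --> \oo])).
  rewrite -monotone_convergence//=.
  - apply: eq_integral => ? /[!inE] xD; apply/esym/cvg_lim => //=.
    exact: cvg_nnsfun_approx.
  - by move=> n; exact/measurable_EFinP/measurable_funTS.
  - by move=> n ? _; rewrite lee_fin.
  - by move=> ? _ ? ? mn; rewrite lee_fin; exact/lefP/nd_nnsfun_approx.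
under eq_fun do rewrite density_nnsfun.
rewrite -monotone_convergence//=.
- apply: eq_integral => x _; apply/cvg_lim => //.
  under eq_fun do rewrite muleC.
  by rewrite muleC; apply: cvgeZl => //; exact: cvg_nnsfun_approx.
- move=> n; apply: emeasurable_funM => //.
  + exact/measurable_EFinP/measurable_funTS.
  + exact/measurable_EFinP.
- by move=> n x _; rewrite mule_ge0 ?lee_fin.
- move=> x _ a b ab; apply: lee_wpmul2r => //; first by rewrite lee_fin.
  by rewrite lee_fin; exact/lefP/nd_nnsfun_approx.
Qed.

End density_integral.

Section density_measure.
Local Open Scope ereal_scope.
Context {d} {T : measurableType d} {R : realType}.
Variables (m : {measure set T -> \bar R}) (w : T -> R).
Hypotheses (mw : measurable_fun setT w) (w0 : forall x, (0 <= w x)%R).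

(** The hypotheses are arguments, so that the structure of measure can be
    attached to this set function. *)
Definition density_measure of measurable_fun setT w
  & (forall x, (0 <= w x)%R) : set T -> \bar R :=
  fun A => \int[m]_(x in A) (w x)%:E.

Local Notation mu := (density_measure mw w0).

Let mu0 : mu set0 = 0.
Proof. by rewrite /mu integral_set0. Qed.

Let mu_ge0 A : 0 <= mu A.
Proof. by apply: integral_ge0 => x _; rewrite lee_fin. Qed.

Let mu_sigma_additive : semi_sigma_additive mu.
Proof.
move=> F mF tF mUF; rewrite /mu /density_measure; apply: cvg_toP.
  apply: ereal_nondecreasing_is_cvgn => k n kn.
  by apply: lee_sum_nneg_natr => // i _ _; apply: mu_ge0.
rewrite ge0_integral_bigcup//=.
- exact/measurable_EFinP/measurable_funTS.
- by move=> x _; rewrite lee_fin.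
Qed.

HB.instance Definition _ := isMeasure.Build _ _ _ mu mu0 mu_ge0
  mu_sigma_additive.

Lemma ge0_integral_density_measure (f : T -> \bar R) :
  measurable_fun setT f -> (forall x, 0 <= f x) ->
  \int[mu]_x f x = \int[m]_x (f x * (w x)%:E).
Proof. by move=> mf f0; exact: density_integral. Qed.

End density_measure.

Section substitutions.
Local Open Scope ereal_scope.
Context {R : realType}.
Notation leb := (@lebesgue_measure R).

(** Lebesgue measure is determined by the lengths of intervals, so this
    change of variables and [ge0_integral_sqr] amount to measuring the preimage
    of an interval, weighted by the Jacobian. *)
Lemma ge0_integral_affine (a b : R) (f : R -> \bar R) : (0 < a)%R ->
  measurable_fun setT f -> (forall x, 0 <= f x) ->
  \int[leb]_x f x = a%:E * \int[leb]_x f (a * x + b)%R.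
Proof.
move=> a0 mf f0.
pose phi : measurableTypeR R -> measurableTypeR R := fun x => (a * x + b)%R.
have mphi : measurable_fun setT phi.
  by apply: measurable_funD => //; exact: measurable_funM.
pose m' : {measure set (measurableTypeR R) -> \bar R} :=
  mscale (NngNum (ltW a0)) (image_measure leb mphi).
have lm' A : measurable A -> leb A = m' A.
  apply: lebesgue_measure_unique => _ [[p q] _ <-] /=.
  rewrite /mscale /image_measure /pushforward/=.
  have hp : leb (phi @^-1` [set` `]p, q]%R]) =
      leb [set` `](p - b) / a, (q - b) / a]%R].
    congr (leb _); apply/seteqP; split => x; rewrite /phi /= !in_itv/=;
      by rewrite ltr_pdivrMr// ler_pdivlMr// ltrBlDr lerBrDr (mulrC x).
  rewrite [X in _ = _ * X]hp.
  rewrite !lebesgue_measure_itv/= !lte_fin ltr_pM2r ?invr_gt0// ltrD2r.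
  case: ifP => pq; last by rewrite mule0.
  rewrite -!EFinB -EFinM; congr (_%:E); rewrite -mulrBl mulrCA divff ?gt_eqF//.
  ring.
rewrite (eq_measure_integral m'); last by move=> A mA _; exact: lm'.
rewrite ge0_integral_mscale//; congr (_ * _).
by rewrite ge0_integral_pushforward//.
Qed.

Let integral_2x (s t : R) : (0 <= s)%R -> (s <= t)%R ->
  \int[leb]_(x in [set` `]s, t]%R]) (2 * x)%:E = (t ^+ 2 - s ^+ 2)%:E.
Proof.
move=> s0; rewrite le_eqVlt => /predU1P[->|st].
  by rewrite set_itvoc0 integral_set0 subrr.
rewrite integral_itv_obnd_cbnd; last first.
  by apply/measurable_EFinP; exact: measurable_funM.
have cX : continuous (fun x : R => x ^+ 2)%R by exact: exprn_continuous.
rewrite (@continuous_FTC2 _ (fun x => 2 * x)%R (fun x => x ^+ 2)%R)//.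
- apply: continuous_subspaceT => x.
  by apply: (@cvgM _ _ _ _ (cst 2%R) idfun); [exact: cvg_cst|exact: cvg_id].
- split.
  + by move=> x _; exact: exprn_derivable.
  + by apply: cvg_at_right_filter; exact: cX.
  + by apply: cvg_at_left_filter; exact: cX.
- by move=> x _; rewrite derive1E exp_derive expr1 /GRing.scale/= mulr1 mulr_natl.
Qed.

Lemma ge0_integral_sqr (f : R -> \bar R) :
  measurable_fun setT f -> (forall x, 0 <= f x) ->
  \int[leb]_(x in `]0%R, +oo[) f x =
  \int[leb]_(x in `]0%R, +oo[) (f (x ^+ 2)%R * (2 * x)%:E).
Proof.
move=> mf f0.
(* The half-line of nonpositive reals is kept fixed, so as to compare two
   measures on the whole line. *)
pose w (x : measurableTypeR R) : R :=
  if (0 < (x : R))%R then (2 * (x : R))%R else 0%R.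
have mw : measurable_fun setT w.
  apply: measurable_fun_ifT => //.
    exact: measurable_fun_ltr.
have w0 x : (0 <= w x)%R.
  by rewrite /w; case: ifPn => // x0; rewrite mulr_ge0// ltW.
pose phi (x : measurableTypeR R) : measurableTypeR R := ((x : R) ^+ 2)%R.
have mphi : measurable_fun setT phi by exact: measurable_funX.
pose m2 : {measure set (measurableTypeR R) -> \bar R} :=
  image_measure (density_measure leb mw w0) mphi.
pose m' : {measure set (measurableTypeR R) -> \bar R} :=
  measure_add (mrestr leb (measurable_itv `]-oo, 0%R])) m2.
have m'E (X : set (measurableTypeR R)) :
    m' X = leb (X `&` [set` `]-oo, 0%R]%R]) + m2 X by exact: measure_addE.
have lm' A : measurable A -> leb A = m' A.
  apply: lebesgue_measure_unique => _ [[p q] _ <-].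
  rewrite [RHS]m'E /m2 /image_measure/= /pushforward/density_measure.
  set s := Num.sqrt p; set t := Num.sqrt q.
  have s0 : (0 <= s)%R by exact: sqrtr_ge0.
  have t0 : (0 <= t)%R by exact: sqrtr_ge0.
  have ssq x : (0 < x)%R -> (p < x ^+ 2)%R = (s < x)%R.
    by move=> x0; rewrite -{2}(ger0_norm (ltW x0)) -sqrtr_sqr ltr_sqrt// exprn_gt0.
  have tsq x : (0 < x)%R -> (x ^+ 2 <= q)%R = (x <= t)%R.
    move=> x0; rewrite -{2}(ger0_norm (ltW x0)) -sqrtr_sqr.
    have [q0|q0] := ltP 0%R q; first by rewrite /t ler_sqrt // ltW.
    have h : (0 < x ^+ 2)%R by rewrite exprn_gt0.
    have hs : (0 < Num.sqrt (x ^+ 2))%R by rewrite sqrtr_gt0.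
    by rewrite /t (ler0_sqrtr q0) !leNgt hs (le_lt_trans q0 h).
  have -> : \int[leb]_(x in phi @^-1` [set` `]p, q]%R]) (w x)%:E =
      \int[leb]_(x in [set` `]s, t]%R]) (2 * x)%:E.
    rewrite [LHS]integral_mkcond [RHS]integral_mkcond; apply: eq_integral => x _.
    rewrite !patchE /w; have [x0|x0] := ltP 0%R x.
      congr (if _ then _ else _); apply/idP/idP;
        by rewrite !inE/= !in_itv/= (ssq x x0) (tsq x x0).
    rewrite if_same; case: ifPn => //; rewrite inE/= in_itv/= => /andP[sx _].
    by have := le_lt_trans s0 sx; rewrite ltNge x0.
  have [qp|pq] := leP q p.
    rewrite (set_itv_ge (_ : ~~ (BRight p < BRight q)%O)) ?bnd_simp -?leNgt//.
    rewrite (set_itv_ge (_ : ~~ (BRight s < BRight t)%O)); last first.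
      by rewrite bnd_simp -leNgt ler_wsqrtr.
    by rewrite set0I measure0 integral_set0 adde0.
  have [q0|q0] := leP q 0%R.
    rewrite (_ : _ `&` _ = [set` `]p, q]%R]); last first.
      apply/setIidl => x /=; rewrite !in_itv/= => /andP[_ xq].
      exact: le_trans q0.
    rewrite (set_itv_ge (_ : ~~ (BRight s < BRight t)%O)); last first.
      by rewrite bnd_simp -leNgt /t ler0_sqrtr.
    by rewrite integral_set0 adde0.
  have [p0|p0] := leP 0%R p.
    rewrite (_ : _ `&` _ = set0); last first.
      apply/seteqP; split => // x [] /=; rewrite !in_itv/= => /andP[px _].
      by rewrite leNgt (le_lt_trans p0 px).
    rewrite measure0 add0e integral_2x ?ler_wsqrtr ?(ltW pq)//.
    by rewrite !sqr_sqrtr ?(ltW q0)// lebesgue_measure_itv/= lte_fin pq.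
  rewrite (_ : _ `&` _ = [set` `]p, 0%R]%R]); last first.
    apply/seteqP; split => x; rewrite /= !in_itv/=.
      by move=> [/andP[-> _] ->].
    by move=> /andP[-> x0]; rewrite x0 (le_trans x0)// ltW.
  rewrite integral_2x//; last by rewrite /s ler0_sqrtr// ltW.
  rewrite /s /t (ler0_sqrtr (ltW p0)) expr0n subr0 sqr_sqrtr ?ltW//.
  rewrite !lebesgue_measure_itv/= !lte_fin pq p0 -EFinB -!EFinD.
  by congr EFin; ring.
rewrite (eq_measure_integral m2); last first.
  move=> A mA A0; transitivity (m' A); first exact: lm'.
  rewrite m'E.
  rewrite (_ : _ `&` _ = set0) ?measure0 ?add0e//.
  apply/seteqP; split => // x [/A0/=]; rewrite !in_itv/= andbT => x0.
  by rewrite leNgt x0.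
rewrite ge0_integral_pushforward//; last exact: measurable_funTS.
rewrite integral_mkcond ge0_integral_density_measure//; last 2 first.
- apply/(measurable_restrictT _ _).1 => //.
    by rewrite -(setTI (_ @^-1` _)); by have := mphi; apply.
  by apply: measurable_funTS; exact: measurableT_comp.
- by move=> x; rewrite patchE/=; case: ifP => // _; exact: f0.
rewrite [RHS]integral_mkcond; apply: eq_integral => x _.
rewrite !patchE /w; have [x0|x0] := ltP 0%R x.
  by rewrite !mem_set//= !in_itv/= andbT ?exprn_gt0.
by rewrite mule0 memNset//= in_itv/= andbT ltNge x0.
Qed.

End substitutions.

(** * Lines in terms of intercept and slope *)

Section measurability.
Context {d} {T : measurableType d} {R : realType}.
Implicit Types f g : T -> R.

Lemma measurable_funV f : measurable_fun setT f ->
  measurable_fun setT (fun x => (f x)^-1).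
Proof.
move=> mf; apply: (@measurableT_comp _ _ _ _ _ _ (@GRing.inv R) _ f) => //.
rewrite (_ : @GRing.inv R = fun x : R => if x == 0 then 0 else x^-1); last first.
  by apply/funext => x; case: eqP => [->|//]; rewrite invr0.
apply: measurable_fun_if => //.
  apply: (measurable_fun_bool true).
  rewrite setTI (_ : _ @^-1` _ = [set 0])//.
  by apply/seteqP; split => x /= /eqP.
rewrite setTI; apply: open_continuous_measurable_fun; last first.
  move=> x; rewrite inE/= => x0; apply: inv_continuous.
  by rewrite x0.
rewrite (_ : _ @^-1` _ = ~` [set 0]).
  by apply: closed_openC; exact: closed_eq.
by apply/seteqP; split => x /=; [move/negbT/eqP|move/eqP/negbTE].
Qed.

Lemma measurable_sqrtr f : measurable_fun setT f ->
  measurable_fun setT (fun x => Num.sqrt (f x)).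
Proof.
move=> mf; apply: measurableT_comp mf.
by apply: continuous_measurable_fun; exact: sqrt_continuous.
Qed.

Lemma measurable_set_of (D : T -> bool) :
  measurable_fun setT D -> measurable [set t | D t].
Proof. by move=> mD; have := mD measurableT [set true]; rewrite setTI; apply. Qed.

Lemma measurable_ltr_set f g : measurable_fun setT f -> measurable_fun setT g ->
  measurable [set x | f x < g x].
Proof.
by move=> mf mg; apply: measurable_set_of; exact: measurable_fun_ltr.
Qed.

Lemma measurable_ler_set f g : measurable_fun setT f -> measurable_fun setT g ->
  measurable [set x | f x <= g x].
Proof.
by move=> mf mg; apply: measurable_set_of; exact: measurable_fun_ler.
Qed.

End measurability.

Section line_coordinates.
Context {R : realType}.
Implicit Types (l : line R) (c m x : R).

(** Parametrization by the intercept on the y-axis and the slope, in which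
    all the geometry takes place. *)
Definition mkline c m : line R := (c - m, c + m).

Lemma slope_mkline c m : slope (mkline c m) = m.
Proof. by rewrite /slope/=; field. Qed.

Lemma height_mkline c m x : height (mkline c m) x = c + m * x.
Proof. by rewrite /height slope_mkline /=; field. Qed.

Lemma heightE l x : height l x = height l 0 + slope l * x.
Proof. by rewrite /height mulr0 addr0. Qed.

Lemma mklineK l : mkline (height l 0) (slope l) = l.
Proof.
by case: l => a b; rewrite /mkline /height /slope/=; congr pair; field.
Qed.

Lemma measurable_slope : measurable_fun setT (@slope R).
Proof.
apply: measurable_funM => //.
by apply: measurable_funB; [exact: measurable_snd|exact: measurable_fst].
Qed.

Lemma measurable_height x : measurable_fun setT (fun l => height l x).
Proof.
apply: measurable_funD; apply: measurable_funM => //.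
  by apply: measurable_funD; [exact: measurable_fst|exact: measurable_snd].
exact: measurable_slope.
Qed.

Lemma measurable_mkline d (T : measurableType d) (f g : T -> R) :
  measurable_fun setT f -> measurable_fun setT g ->
  measurable_fun setT (fun t => mkline (f t) (g t)).
Proof.
move=> mf mg; apply: measurable_fun_pair.
  exact: measurable_funB.
exact: measurable_funD.
Qed.

End line_coordinates.

Section line_intensity.
Local Open Scope ereal_scope.
Context {R : realType}.
Notation leb := (@lebesgue_measure R).

Lemma ge0_integral_reflect (c : R) (f : R -> \bar R) :
  measurable_fun setT f -> (forall x, 0 <= f x) ->
  \int[leb]_x f x = \int[leb]_x f (c - x)%R.
Proof.
move=> mf f0.
have mN : measurable_fun setT (-%R : measurableTypeR R -> measurableTypeR R).
  exact: (@oppr_measurable R setT).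
transitivity (\int[image_measure leb mN]_x f x).
  by apply: eq_measure_integral => A mA _; rewrite -[LHS]lebesgue_measureN.
rewrite ge0_integral_pushforward//=.
rewrite (@ge0_integral_affine _ 1 (- c)) ?mul1e//; last first.
  apply: measurableT_comp => //; exact: (@oppr_measurable R setT).
by apply: eq_integral => x _; rewrite /= mul1r opprD opprK addrC.
Qed.

(** The linear map sending the intercept on the y-axis and the slope to the
    intercepts on x = -1 and x = 1 has determinant 2, whence the constant
    2 / 4; it is applied as two one-dimensional translations and a scaling. *)
Lemma ge0_integral_line (f : line R -> \bar R) :
  measurable_fun setT f -> (forall x, 0 <= f x) ->
  \int[line_intensity R]_l f l =
  2^-1%:E * \int[leb]_c \int[leb]_m f (mkline c m).
Proof.
move=> mf f0.
have mF d (T : measurableType d) (g h : T -> R) : measurable_fun setT g ->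
    measurable_fun setT h -> measurable_fun setT (fun z => f (g z, h z)).
  by move=> mg mh; apply: (measurableT_comp mf); exact: measurable_fun_pair.
transitivity (4^-1%:E * \int[leb]_a \int[leb]_b f (a, b)).
  transitivity (4^-1%:E * \int[leb \x leb]_l f l).
    by apply: ge0_integral_mscale => // l _; exact: f0.
  by congr (_ * _); exact: (fubini_tonelli1 _ mf f0).
have m1 : measurable_fun setT (fun z : R * R => f (z.1, 2 * z.2 + z.1)%R).
  apply: mF; first exact: measurable_fst.
  apply: measurable_funD; last exact: measurable_fst.
  by apply: measurable_funM => //; exact: measurable_snd.
under eq_integral => a _.
  rewrite (@ge0_integral_affine _ 2 a)//; last exact: mF.
  over.
rewrite ge0_integralZl//=; last 2 first.
  exact: (measurable_fun_fubini_tonelli_F (m2 := leb) _ m1).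
  by move=> a _; exact: integral_ge0.
have /= -> := fubini_tonelli (m1 := leb) (m2 := leb) _ m1 (fun=> f0 _).
rewrite muleA -EFinM (_ : 4^-1 * 2 = 2^-1)%R; last by field.
congr (_ * _).
have m2 : measurable_fun setT (fun z : R * R => f (mkline z.1 z.2)).
  apply: (measurableT_comp mf); apply: measurable_mkline.
    exact: measurable_fst.
  exact: measurable_snd.
have /= -> := fubini_tonelli (m1 := leb) (m2 := leb) _ m2 (fun=> f0 _).
apply: eq_integral => m _.
rewrite (@ge0_integral_affine _ 1 (- m)) ?mul1e//; last first.
  by apply: mF => //; apply: measurable_funD.
apply: eq_integral => c _; rewrite /mkline; congr f; congr pair; ring.
Qed.

End line_intensity.

(** * The unexplored region as a strip *)

Section sweeping.
Context {R : realType}.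
Implicit Types (c m s e u q : R) (l : line R).
Notation leb := (@lebesgue_measure R).

(** The region left to explore when the curve follows, just before time [s],
    the line of intercept [c] and slope [m]: a line that takes over at an
    earlier time has a smaller intercept, and it was above at time [s]. *)
Definition ahead c m s l : bool :=
  [&& 0 < height l 0, height l 0 < c & c + m * s < height l s].

Definition strip e u : bool := [&& 0 < e, 0 < u & u < 1].

(** A line ahead crosses the current one at a time [t] and the y-axis at a
    height [c * (1 - v)]; here [u = v ^ 2], and [e] measures how much [1 / t]
    exceeds [1 / s]. *)
Definition step_line c m s e u : line R :=
  mkline (c * (1 - Num.sqrt u)) (m + c * Num.sqrt u * (s^-1 + 4 / c ^+ 2 * e)).

(** [2 * sqrt e] is the height at time 1, of which the slope is a fraction [u]. *)
Definition first_line e u : line R :=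
  mkline (2 * Num.sqrt e * (1 - u)) (2 * Num.sqrt e * u).

Lemma measurable_ahead c m s : measurable_fun setT (ahead c m s).
Proof.
apply: measurable_and; first exact: measurable_fun_ltr (measurable_height 0).
apply: measurable_and; first exact: measurable_fun_ltr (measurable_height 0) _.
exact: measurable_fun_ltr _ (measurable_height s).
Qed.

Lemma measurable_strip d (T : measurableType d) (f g : T -> R) :
  measurable_fun setT f -> measurable_fun setT g ->
  measurable_fun setT (fun x => strip (f x) (g x)).
Proof.
by move=> mf mg; do 2?apply: measurable_and; exact: measurable_fun_ltr.
Qed.

Lemma measurable_step_line c m s d (T : measurableType d) (f g : T -> R) :
  measurable_fun setT f -> measurable_fun setT g ->
  measurable_fun setT (fun x => step_line c m s (f x) (g x)).
Proof.
move=> mf mg; have mq := measurable_sqrtr mg.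
apply: measurable_mkline.
  by apply: measurable_funM => //; exact: measurable_funB.
apply: measurable_funD => //; apply: measurable_funM.
  exact: measurable_funM.
by apply: measurable_funD => //; exact: measurable_funM.
Qed.

Lemma measurable_first_line d (T : measurableType d) (f g : T -> R) :
  measurable_fun setT f -> measurable_fun setT g ->
  measurable_fun setT (fun x => first_line (f x) (g x)).
Proof.
move=> mf mg; have mq := measurable_sqrtr mf.
apply: measurable_mkline; apply: measurable_funM => //.
- exact: measurable_funM.
- exact: measurable_funB.
- exact: measurable_funM.
Qed.

Local Open Scope ereal_scope.

(** In the coordinates of [step_line] the intensity becomes Lebesgue measure on
    a strip: the Jacobian [2 * v] of the square and the affine dependence of
    the slope on [e], with coefficient [4 * v / c], compensate each other. This
    is where the constant 4 and the square root of the theorem come from. *)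
Lemma ge0_integral_ahead c m s (f : line R -> \bar R) :
  (0 < c)%R -> (0 < s)%R ->
  measurable_fun setT f -> (forall l, 0 <= f l) ->
  \int[line_intensity R]_l (if ahead c m s l then f l else 0) =
  \int[leb]_u \int[leb]_e (if strip e u then f (step_line c m s e u) else 0).
Proof.
move=> c0 s0 mf f0.
have mg : measurable_fun setT (fun l => if ahead c m s l then f l else 0).
  by apply: measurable_fun_ifT => //; exact: measurable_ahead.
have g0 l : 0 <= (if ahead c m s l then f l else 0) by case: ifP.
rewrite ge0_integral_line//.
set H := fun c' : R => \int[leb]_m' _.
have mg2 : measurable_fun setT (fun z : R * R =>
    if ahead c m s (mkline z.1 z.2) then f (mkline z.1 z.2) else 0).
  apply: (measurableT_comp mg); apply: measurable_mkline.
    exact: measurable_fst.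
  exact: measurable_snd.
have mH : measurable_fun setT H.
  exact: (measurable_fun_fubini_tonelli_F (m2 := leb) _ mg2 (fun=> g0 _)).
have H0 x : 0 <= H x by apply: integral_ge0 => y _; exact: g0.
(* the intercept is [c * (1 - v)] *)
rewrite (ge0_integral_reflect c)// (@ge0_integral_affine _ c 0)//; last 2 first.
- by apply: (measurableT_comp mH); exact: measurable_funB.
- by move=> x; exact: H0.
transitivity (\int[leb]_v ((2^-1 * c)%:E * H (c - (c * v + 0))%R)).
  rewrite ge0_integralZl ?EFinM ?muleA//.
  - apply: (measurableT_comp mH); apply: measurable_funB => //.
    by apply: measurable_funD => //; exact: measurable_funM.
  - by rewrite mule_ge0// lee_fin ltW.
set G := fun u : R => \int[leb]_e _.
have G0 x : 0 <= G x by apply: integral_ge0 => y _; case: ifP.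
have mG2 : measurable_fun setT (fun z : R * R =>
    if strip z.1 z.2 then f (step_line c m s z.1 z.2) else 0).
  apply: measurable_fun_ifT => //.
    by apply: measurable_strip; [exact: measurable_fst|exact: measurable_snd].
  apply: measurableT_comp => //; apply: measurable_step_line.
    exact: measurable_fst.
  exact: measurable_snd.
have mG : measurable_fun setT G.
  apply: (measurable_fun_fubini_tonelli_G (m1 := leb) _ mG2) => z.
  by case: ifP.
transitivity (\int[leb]_(u in `]0%R, +oo[) G u); last first.
  rewrite integral_mkcond; apply: eq_integral => u _; rewrite patchE.
  case: ifPn => // /negP u0; rewrite /G integral0_eq// => e _.
  case: ifPn => // /and3P[_ u0' _]; exfalso; apply: u0.
  by rewrite inE/= in_itv/= u0'.
rewrite ge0_integral_sqr// [RHS]integral_mkcond.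
apply: eq_integral => v _; rewrite patchE.
have [v0|v0] := ltP 0%R v; last first.
  rewrite memNset/=; last by rewrite in_itv/= andbT ltNge v0.
  rewrite /H integral0_eq ?mule0// => e _.
  rewrite /ahead !height_mkline; case: ifPn => // /and3P[_].
  rewrite mulr0 !addr0 => h _; exfalso; move: h.
  by rewrite gtrBl pmulr_rgt0// ltNge v0.
rewrite mem_set/=; last by rewrite in_itv/= v0.
(* for fixed [v], the slope is an affine function of [e] *)
have a0 : (0 < 4 * v / c)%R by rewrite divr_gt0// mulr_gt0.
rewrite /H (@ge0_integral_affine _ (4 * v / c) (m + c * v / s))//; last first.
  by apply: (measurable_fun_pair2 _ mg2).
rewrite muleA -EFinM muleC; congr (_ * _); last first.
  by congr EFin; field; rewrite gt_eqF.
apply: eq_integral => e _.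
rewrite /ahead !height_mkline /strip /step_line sqrtr_sqr ger0_norm ?ltW//.
have -> : (c - (c * v + 0) = c * (1 - v))%R by ring.
have -> : (4 * v / c * e + (m + c * v / s) =
   m + c * v * (s^-1 + 4 / c ^+ 2 * e))%R.
  by field; rewrite !gt_eqF.
rewrite mulr0 addr0.
have -> : (c * (1 - v) < c)%R by rewrite -[ltRHS]mulr1 ltr_pM2l// gtrBl.
have -> : (c + m * s <
    c * (1 - v) + (m + c * v * (s^-1 + 4 / c ^+ 2 * e)) * s)%R = (0 < e)%R.
  rewrite -subr_gt0.
  have -> : (c * (1 - v) + (m + c * v * (s^-1 + 4 / c ^+ 2 * e)) * s -
      (c + m * s) = (4 * v * s / c) * e)%R by field; rewrite !gt_eqF.
  by rewrite pmulr_rgt0// divr_gt0// !mulr_gt0.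
rewrite pmulr_rgt0// subr_gt0 exprn_gt0//= expr_lt1 ?ltW//.
by rewrite andbC.
Qed.

(** The analogue at the start, where all the lines of positive intercept and
    slope are left to explore: the lines below height [2 * r] at time 1 form a
    triangle of area [2 * r ^ 2], hence of intensity [r ^ 2]. *)
Lemma ge0_integral_quadrant (f : line R -> \bar R) :
  measurable_fun setT f -> (forall l, 0 <= f l) ->
  \int[line_intensity R]_l
     (if (0 < height l 0)%R && (0 < slope l)%R then f l else 0) =
  \int[leb]_u \int[leb]_e (if strip e u then f (first_line e u) else 0).
Proof.
move=> mf f0.
set b := fun l : line R => (0 < height l 0)%R && (0 < slope l)%R.
have mb : measurable_fun setT b.
  apply: measurable_and; first exact: measurable_fun_ltr (measurable_height 0).
  exact: measurable_fun_ltr measurable_slope.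
have mg : measurable_fun setT (fun l => if b l then f l else 0).
  exact: measurable_fun_ifT.
have g0 l : 0 <= (if b l then f l else 0) by case: ifP.
rewrite ge0_integral_line//.
have mg2 : measurable_fun setT (fun z : R * R =>
    if b (mkline z.1 z.2) then f (mkline z.1 z.2) else 0).
  apply: (measurableT_comp mg); apply: measurable_mkline.
    exact: measurable_fst.
  exact: measurable_snd.
have /= -> := fubini_tonelli (m1 := leb) (m2 := leb) _ mg2 (fun=> g0 _).
have mG2 : measurable_fun setT (fun z : R * R =>
    if strip z.1 z.2 then f (first_line z.1 z.2) else 0).
  apply: measurable_fun_ifT => //.
    by apply: measurable_strip; [exact: measurable_fst|exact: measurable_snd].
  apply: measurableT_comp => //; apply: measurable_first_line.
    exact: measurable_fst.
  exact: measurable_snd.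
have G20 z : 0 <= (if strip z.1 z.2 then f (first_line z.1 z.2) else 0).
  by case: ifP.
have /= <- := fubini_tonelli (m1 := leb) (m2 := leb) _ mG2 (fun=> G20 _).
pose G (e : R) := \int[leb]_u (if strip e u then f (first_line e u) else 0).
rewrite -[RHS]/(\int[leb]_e G e).
have G0 x : 0 <= G x by apply: integral_ge0 => y _; case: ifP.
have mG : measurable_fun setT G.
  exact: (measurable_fun_fubini_tonelli_F (m2 := leb) _ mG2 (fun=> G20 _)).
transitivity (\int[leb]_(e in `]0%R, +oo[) G e); last first.
  rewrite integral_mkcond; apply: eq_integral => e _; rewrite patchE.
  case: ifPn => // /negP e0; rewrite /G integral0_eq// => u _.
  case: ifPn => // /and3P[e0' _ _]; exfalso; apply: e0.
  by rewrite inE/= in_itv/= e0'.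
(* [r] is half of the height at time 1, and [m] the slope *)
rewrite ge0_integral_sqr// [RHS]integral_mkcond.
pose h (z : R * R) := if [&& 0 < z.1, 0 < z.2 & z.2 < 2 * z.1]%R
  then f (mkline (2 * z.1 - z.2) z.2) else 0.
have h0 z : 0 <= h z by rewrite /h; case: ifP.
have mh : measurable_fun setT h.
  apply: measurable_fun_ifT => //.
    apply: measurable_and; first exact: measurable_fun_ltr measurable_fst.
    apply: measurable_and; first exact: measurable_fun_ltr measurable_snd.
    apply: measurable_fun_ltr; first exact: measurable_snd.
    by apply: measurable_funM => //; exact: measurable_fst.
  apply: measurableT_comp => //; apply: measurable_mkline.
    apply: measurable_funB; last exact: measurable_snd.
    by apply: measurable_funM => //; exact: measurable_fst.
  exact: measurable_snd.
transitivity (\int[leb]_r \int[leb]_m h (r, m)); last first.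
  apply: eq_integral => r _; rewrite patchE.
  have [r0|r0] := ltP 0%R r; last first.
    rewrite memNset/=; last by rewrite in_itv/= andbT ltNge r0.
    by rewrite integral0_eq// => m _; rewrite /h/= ltNge r0.
  rewrite mem_set/=; last by rewrite in_itv/= r0.
  rewrite (@ge0_integral_affine _ (2 * r) 0)//; last 2 first.
  - by rewrite mulr_gt0.
  - exact: (measurable_fun_pair2 _ mh).
  rewrite muleC; congr (_ * _); apply: eq_integral => u _.
  rewrite /h/= /strip /first_line sqrtr_sqr ger0_norm ?ltW// addr0.
  rewrite r0 exprn_gt0//= pmulr_rgt0 ?mulr_gt0//.
  have -> : (2 * r * u < 2 * r)%R = (u < 1)%R by rewrite gtr_pMr// mulr_gt0.
  by case: ifP => // _; congr f; congr mkline; ring.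
have /= -> := fubini_tonelli (m1 := leb) (m2 := leb) _ mh (fun=> h0 _).
rewrite -ge0_integralZl//; last 2 first.
- exact: (measurable_fun_fubini_tonelli_G (m1 := leb) _ mg2 (fun=> g0 _)).
- by move=> x _; exact: integral_ge0.
apply: eq_integral => m _.
rewrite [in RHS](@ge0_integral_affine _ 2^-1 (m / 2))//; last first.
  exact: (measurable_fun_pair1 _ mh).
congr (_ * _); apply: eq_integral => c _.
rewrite /b /h height_mkline slope_mkline mulr0 addr0/=.
have -> : (2 * (2^-1 * c + m / 2) = c + m)%R by field.
rewrite ltrDr addrK.
case: (ltP 0%R m) => m0; rewrite ?andbF// andbT.
case: (ltP 0%R c) => c0.
  by rewrite ifT//; apply/andP; split => //; lra.
by rewrite /= ?andbF.
Qed.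

End sweeping.

(** * Hazard rates *)

(** Convexity of the exponential: both bounds on [i] differ from the increment
    of [expR] by at most the square of the step. *)
Lemma exp_trapezoid (R : realType) (p q i w : R) :
  0 <= p -> 0 <= q - p -> q - p <= w ->
  expR (- q) * (q - p) <= i <= expR (- p) * (q - p) ->
  `|i - (expR (- p) - expR (- q))| <= w ^+ 2.
Proof.
move=> p0; set D := q - p => D0 Dw /andP[lo hi].
have pE : expR (- p) = expR (- q) * expR D.
  by rewrite -expRD /D; congr expR; ring.
have qE : expR (- q) = expR (- p) * expR (- D).
  by rewrite -expRD /D; congr expR; ring.
have y0 := expR_ge0 (- q).
have x0 := expR_ge0 (- p).
have x1 : expR (- p) <= 1 by rewrite -expR0 ler_expR oppr_le0.
have h1 := expR_ge1Dx D.
have h2 := expR_ge1Dx (- D).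
have Dw2 : D * D <= w ^+ 2 by rewrite expr2 ler_pM.
move: (expR (- p)) (expR (- q)) (expR D) (expR (- D)) lo hi pE qE y0 x0 x1 h1 h2.
move=> X Y A B lo hi XE YE Y0 X0 X1 A1 B1.
have b1 : Y * D <= X - Y by nra.
have b2 : X - Y <= X * D by nra.
have b3 : X * D <= D by nra.
have b4 : (X - Y) * D <= D * D by nra.
by rewrite ler_norml; apply/andP; split; nra.
Qed.

Section hazard_rate.
Context {R : realType}.
Notation leb := (@lebesgue_measure R).

Let integrable_unit (f : R -> R) (x y : R) : measurable_fun setT f ->
  (forall t, 0 <= f t <= 1) -> leb.-integrable [set` `]x, y]] (EFin \o f).
Proof.
move=> mf f01; apply: measurable_bounded_integrable => //.
- rewrite [X in (X < _)%E]lebesgue_measure_itv/=; case: ifP => _; last exact: ltry.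
  by rewrite -EFinB ltry.
- exact: measurable_funTS.
- exists 1; split => // M M1 t _; have /andP[t0 t1] := f01 t.
  by rewrite /= ger0_norm// (le_trans t1)// ltW.
Qed.

Let mean_bounds (f : R -> R) (x y k K : R) : x <= y -> measurable_fun setT f ->
  (forall t, 0 <= f t <= 1) -> (forall t, x < t <= y -> k <= f t <= K) ->
  k * (y - x) <= \int[leb]_(t in [set` `]x, y]]) f t <= K * (y - x).
Proof.
move=> xy mf f01 fkK.
have intc (r : R) : leb.-integrable [set` `]x, y]] (EFin \o cst r).
  apply: measurable_bounded_integrable => //.
    rewrite [X in (X < _)%E]lebesgue_measure_itv/=; case: ifP => _; last exact: ltry.
    by rewrite -EFinB ltry.
  by exists `|r|; split => // M rM t _ /=; exact: ltW.
have cE (r : R) : \int[leb]_(t in [set` `]x, y]]) cst r t = r * (y - x).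
  rewrite Rintegral_cst//; congr *%R.
  rewrite [X in fine X](lebesgue_measure_itv `]x, y]%R)/= lte_fin.
  case: ltP => // yx; have -> : x = y by apply/le_anti; rewrite xy yx.
  by rewrite subrr.
apply/andP; split.
- rewrite -cE; apply: le_Rintegral => //; first exact: integrable_unit.
  by move=> t /=; rewrite in_itv/= => /fkK /andP[].
- rewrite -cE; apply: le_Rintegral => //; first exact: integrable_unit.
  by move=> t /=; rewrite in_itv/= => /fkK /andP[].
Qed.

Variable a : R -> R.
Hypotheses (ma : measurable_fun setT a) (a01 : forall t, 0 <= a t <= 1).

Let F (x : R) : R := \int[leb]_(t in [set` `]0, x]]) a t.

Let F0 x : x <= 0 -> F x = 0.
Proof.
move=> x0; rewrite /F set_itv_ge ?Rintegral_set0//.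
by rewrite bnd_simp -leNgt.
Qed.

Let itvB (f : R -> R) x y : measurable_fun setT f ->
  (forall t, 0 <= f t <= 1) -> 0 <= x -> x <= y ->
  \int[leb]_(t in [set` `]0, y]]) f t - \int[leb]_(t in [set` `]0, x]]) f t =
  \int[leb]_(t in [set` `]x, y]]) f t.
Proof.
by move=> mf f01 x0 xy; apply: Rintegral_itvB; rewrite ?bnd_simp//;
  exact: integrable_unit.
Qed.

Let F_lip x y : 0 <= x -> x <= y -> 0 <= F y - F x <= y - x.
Proof.
move=> x0 xy; rewrite itvB//.
have := @mean_bounds a x y 0 1 xy ma a01 (fun t _ => a01 t).
by rewrite mul0r mul1r.
Qed.

Let F_ge0 x : 0 <= F x.
Proof.
have h := @Rintegral_ge0 _ _ _ leb [set` `]0, x]] a.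
by apply: h => t _; have /andP[] := a01 t.
Qed.

Let F_nd : {homo F : x y / x <= y}.
Proof.
move=> x y xy; have [x0|x0] := leP 0 x.
  by have /andP[] := F_lip x0 xy; rewrite subr_ge0.
by rewrite (F0 (ltW x0)) F_ge0.
Qed.

Let mF : measurable_fun setT F.
Proof. exact: nondecreasing_measurable. Qed.

Let g t := a t * expR (- F t).

Let mg : measurable_fun setT g.
Proof.
apply: measurable_funM => //; apply: measurableT_comp => //.
exact: measurable_funN.
Qed.

Let g01 t : 0 <= g t <= 1.
Proof.
have /andP[t0 t1] := a01 t.
have e1 : expR (- F t) <= 1 by rewrite -expR0 ler_expR oppr_le0.
have e0 := expR_ge0 (- F t).
by rewrite /g mulr_ge0//= mulr_ile1.
Qed.

Let phi x := \int[leb]_(t in [set` `]0, x]]) g t + expR (- F x).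

Let phi_quad x y : 0 <= x -> x <= y -> `|phi y - phi x| <= (y - x) ^+ 2.
Proof.
move=> x0 xy.
have -> : phi y - phi x =
    \int[leb]_(t in [set` `]x, y]]) g t - (expR (- F x) - expR (- F y)).
  rewrite -itvB// /phi; have regroup (i j u v : R) : i + u - (j + v) = i - j - (v - u).
    by ring.
  exact: regroup.
have /andP[d0 d1] := F_lip x0 xy.
set dF := F y - F x in d0 d1.
have ey := expR_ge0 (- F y).
have ex : 0 <= expR (- F x) <= 1.
  by rewrite expR_ge0 -expR0 ler_expR oppr_le0 F_ge0.
have lo : expR (- F y) * dF <= \int[leb]_(t in [set` `]x, y]]) g t.
  rewrite /dF itvB//.
  rewrite -RintegralZl//; last exact: integrable_unit.
  apply: le_Rintegral => //; last 1 first.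
  - move=> t; rewrite /= in_itv/= => /andP[xt ty].
    have /andP[t0 _] := a01 t.
    have h : expR (- F y) <= expR (- F t) by rewrite ler_expR lerN2; apply: F_nd.
    rewrite /g (mulrC (a t)); exact: (ler_wpM2r t0 h).
  - apply: integrable_unit; first exact: measurable_funM.
    move=> t; have /andP[t0 t1] := a01 t; rewrite mulr_ge0//= mulr_ile1//.
    by rewrite -expR0 ler_expR oppr_le0.
  - exact: integrable_unit.
have hi : \int[leb]_(t in [set` `]x, y]]) g t <= expR (- F x) * dF.
  rewrite /dF itvB// -RintegralZl//; last exact: integrable_unit.
  apply: le_Rintegral => //; last 1 first.
  - move=> t; rewrite /= in_itv/= => /andP[xt ty].
    have /andP[t0 _] := a01 t.
    have h : expR (- F t) <= expR (- F x).
      by rewrite ler_expR lerN2; apply: F_nd; exact: ltW.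
    rewrite /g (mulrC (a t)); exact: (ler_wpM2r t0 h).
  - exact: integrable_unit.
  - apply: integrable_unit; first exact: measurable_funM.
    by move=> t; have /andP[t0 t1] := a01 t; have /andP[? ?] := ex;
      rewrite mulr_ge0//= mulr_ile1//.
apply: (@exp_trapezoid R (F x) (F y) _ _ (F_ge0 x) d0 d1).
by apply/andP; split; [exact: lo|exact: hi].
Qed.

(** [n] steps of length [x / n] change [phi] by at most a multiple of [1 / n]. *)
Let phi1 x : 0 <= x -> phi x = 1.
Proof.
move=> x0; have phi0 : phi 0 = 1.
  by rewrite /phi F0// oppr0 expR0 set_itv_ge ?bnd_simp ?ltxx// Rintegral_set0 add0r.
apply/eqP; rewrite -subr_eq0 -normr_le0 leNgt; apply/negP => d0.
rewrite -phi0 in d0; set dd := `|phi x - phi 0| in d0.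
have step n h : 0 <= h -> `|phi (n%:R * h) - phi 0| <= n%:R * h ^+ 2.
  move=> h0; elim: n => [|n ih]; first by rewrite !mul0r subrr normr0.
  rewrite (le_trans (ler_distD (phi (n%:R * h)) _ _))//.
  have nh : 0 <= n%:R * h by rewrite mulr_ge0.
  have nh1 : n%:R * h <= n.+1%:R * h by rewrite ler_wpM2r// ler_nat.
  have := phi_quad nh nh1.
  have -> : n.+1%:R * h - n%:R * h = h by rewrite -natr1; ring.
  have -> : n.+1%:R * h ^+ 2 = h ^+ 2 + n%:R * h ^+ 2 by rewrite -natr1; ring.
  by move=> h2; exact: lerD.
pose n := (Num.truncn (x ^+ 2 / dd)).+1.
have n0 : (0 : R) < n%:R by rewrite ltr0n.
have xn : x ^+ 2 / dd < n%:R by exact: Num.Theory.truncnS_gt.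
have := step n (x / n%:R) (divr_ge0 x0 (ltW n0)).
rewrite mulrC divfK ?gt_eqF// -/dd => h.
have : n%:R * (x / n%:R) ^+ 2 = x ^+ 2 / n%:R by field; rewrite gt_eqF.
move=> hE; move: h; rewrite hE ler_pdivlMr// leNgt => /negP; apply.
by move: xn; rewrite ltr_pdivrMr// mulrC.
Qed.

(** A positive random variable with hazard rate [a] of infinite total mass is
    almost surely finite. As [a] is merely measurable, differentiation is
    avoided: [phi], the probability of a value at most [x] plus that of a larger
    one, has increments that are quadratic in the step, hence it is constant. *)
Lemma hazard_rate_total :
  (forall M, exists n : nat, M <= \int[leb]_(t in [set` `]0, n%:R]]) a t) ->
  (\int[leb]_(e in `]0%R, +oo[)
     (a e * expR (- \int[leb]_(t in [set` `]0%R, e]]) a t))%:E = 1)%E.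
Proof.
move=> Foo.
pose D (n : nat) : set R := [set` `]0, n%:R]].
have DT : [set` `]0%R, +oo[] = \bigcup_n D n.
  apply/seteqP; split => x /=; rewrite ?in_itv/= ?andbT.
    move=> x0; exists (Num.truncn x).+1 => //=; rewrite /D/= in_itv/= x0/=.
    exact/ltW/Num.Theory.truncnS_gt.
  by move=> [n _]; rewrite /D/= in_itv/= => /andP[].
have Dnd : nondecreasing_seq D.
  move=> n k nk; rewrite subsetEset => x; rewrite /D/= !in_itv/= => /andP[-> xn].
  by rewrite (le_trans xn)// ler_nat.
have mD n : measurable (D n) by exact: measurable_itv.
have mgE n : measurable_fun (D n) (EFin \o g).
  by apply/measurable_EFinP/measurable_funTS.
have := @ge0_nondecreasing_set_cvg_integral _ (measurableTypeR R) _ D (EFin \o g) leb Dnd mD mgE.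
move=> /(_ _)/wrap[|].
  by move=> i x _; rewrite lee_fin; have /andP[] := g01 x.
rewrite -DT => cvg1.
have IE n : (\int[leb]_(x in D n) (EFin \o g) x = (1 - expR (- F n%:R))%:E)%E.
  have <- : \int[leb]_(t in D n) g t = 1 - expR (- F n%:R).
    by apply/eqP; rewrite eq_sym subr_eq; apply/eqP/esym/phi1/ler0n.
  rewrite /Rintegral fineK//.
  apply: integrable_fin_num; first exact: mD.
  exact: (@integrable_unit g 0 n%:R mg g01).
have cvg2 : (1 - expR (- F n%:R))%:E @[n --> \oo] --> 1%:E.
  apply: cvg_EFin; first by near=> n.
  apply/cvgrPdist_le => /= eps eps0.
  have [N FN] := Foo (- ln eps).
  near=> n.
  rewrite opprB addrC subrK ger0_norm ?expR_ge0// -[leRHS]lnK ?posrE//.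
  rewrite ler_expR lerNl (le_trans FN)//; apply: F_nd; rewrite ler_nat.
  by near: n; exact: nbhs_infty_ge.
rewrite (funext IE) in cvg1.
exact: (cvg_unique _ cvg1 cvg2).
Unshelve. all: by end_near. Qed.

End hazard_rate.

(** * The first point on the strip *)

Lemma measurable_fun_in d (T : measurableType d) (A : set T) :
  measurable A -> measurable_fun setT (fun x => x \in A).
Proof.
move=> mA; apply: (measurable_fun_bool true); rewrite setTI.
rewrite (_ : _ @^-1` _ = A)//.
by apply/seteqP; split => x /=; [exact: set_mem|exact: mem_set].
Qed.

Section exp_unif.
Context (R : realType).
Notation leb := (@lebesgue_measure R).

Definition exp1 : probability (measurableTypeR R) R.
Proof. refine (exponential_prob (1 : R) : probability _ R); exact: ltr01. Defined.

Definition unif01 : probability (measurableTypeR R) R :=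
  uniform_prob (@ltr01 R).

Definition exp_unif : probability (measurableTypeR R * measurableTypeR R)%type R
  := (exp1 \x unif01)%E.

Local Open Scope ereal_scope.

Lemma ge0_integral_exp_unif (f : R * R -> \bar R) :
  measurable_fun setT f -> (forall z, 0 <= f z) ->
  \int[exp_unif]_z f z = \int[leb]_e \int[leb]_u
    (if strip e u then (expR (- e))%:E * f (e, u) else 0).
Proof.
move=> mf f0; rewrite /exp_unif fubini_tonelli1//.
pose w (e : measurableTypeR R) : R := if (0 < (e : R))%R then expR (- e) else 0%R.
have mw : measurable_fun setT w.
  apply: measurable_fun_ifT => //; first exact: measurable_fun_ltr.
  by apply: measurableT_comp => //; exact: (@oppr_measurable R setT).
have w0 e : (0 <= w e)%R by rewrite /w; case: ifP => // _; exact: expR_ge0.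
have exp1E A : measurable A -> exp1 A = \int[leb]_(e in A) (w e)%:E.
  move=> mA; rewrite [LHS]/(exponential_prob 1 A) /exponential_prob.
  apply: ae_eq_integral => //.
  - by apply/measurable_EFinP/measurable_funTS; exact: measurable_exponential_pdf.
  - exact/measurable_EFinP/measurable_funTS.
  exists [set 0%R]; split; [exact: measurable_set1|exact: lebesgue_measure_set1|].
  move=> e /= /not_implyP[_]; apply: contra_notP => /eqP e0.
  rewrite /w; have [e_gt0|e_le0] := ltP 0%R e.
    by rewrite exponential_pdfE ?ltW// mul1r mulN1r.
  by rewrite lt0_exponential_pdf// lt_neqAle e0.
rewrite (@density_integral _ _ _ exp1 leb w mw w0 exp1E)//; last 2 first.
- exact: (measurable_fun_fubini_tonelli_F (m2 := unif01) _ mf).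
- by move=> x; apply: integral_ge0.
apply: eq_integral => e _.
have mfe : measurable_fun setT (fun u : R => f (e, u)) by exact: measurable_fun_pair2.
rewrite /fubini_F integral_uniform// subr0 invr1 mul1e muleC.
have -> : \int[leb]_(u in `[0%R, 1%R]) f (e, u) = \int[leb]_(u in `]0%R, 1%R[) f (e, u).
  rewrite -integral_itv_bndo_bndc; last exact: measurable_funTS.
  by rewrite -integral_itv_obnd_cbnd//; exact: measurable_funTS.
rewrite integral_mkcond -ge0_integralZl//; last 3 first.
- by apply/(measurable_restrictT _ _).1 => //; exact: measurable_funTS.
- by move=> x _; rewrite patchE; case: ifP.
- by rewrite lee_fin.
apply: eq_integral => u _; rewrite patchE /w /strip.
have -> : (u \in [set` `]0%R, 1%R[]) = (0 < u < 1)%R.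
  by apply/idP/idP; rewrite inE/= in_itv.
case: (ltP 0%R e) => e0; last by rewrite mul0e.
by case: ifP => _ //; rewrite mule0.
Qed.

End exp_unif.

(** The points of a Poisson process on the strip that fall in [V] all have to
    be absent. If the point with the smallest first coordinate [e] is known, it
    must be outside [V] and the process to the right of [e] must avoid [V].
    The two sides of [first_point_identity] are the probabilities of these two
    descriptions; they are compared without any process. *)
Section first_point.
Context (R : realType).
Notation leb := (@lebesgue_measure R).
Notation leb2 := (leb \x leb)%E.
Variable V : set (R * R).
Hypotheses (mV : measurable V) (Vstrip : forall z, V z -> strip z.1 z.2).
Hypothesis Vfin : (leb2 V < +oo)%E.
Local Open Scope ereal_scope.

Let mstrip (e : R) : measurable [set u | strip e u].
Proof.
rewrite (_ : [set u | _] = if (0 < e)%R then [set` `]0%R, 1%R[] else set0).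
  by case: ifP => _; [exact: measurable_itv|exact: measurable0].
by apply/seteqP; split => u; rewrite /strip/=; case: ifP => //= _; rewrite in_itv.
Qed.

Let sec e := leb (xsection V e).

Let sec_le1 e : sec e <= 1.
Proof.
rewrite /sec (_ : 1 = leb [set` `]0%R, 1%R[]); last first.
  by rewrite [RHS](lebesgue_measure_itv `]0%R, 1%R[%R)/= lte_fin ltr01 oppr0 adde0.
apply: le_measure; rewrite ?inE//.
- exact: measurable_xsection.
- move=> u; rewrite /xsection/= inE => /Vstrip/and3P[_ u0 u1].
  by rewrite /= in_itv/= u0 u1.
Qed.

Let sec_ge0 e : 0 <= sec e. Proof. exact: measure_ge0. Qed.

Let sec_fin e : sec e \is a fin_num.
Proof. by rewrite ge0_fin_numE// (le_lt_trans (sec_le1 e)) ?ltry. Qed.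

Let msec : measurable_fun setT sec.
Proof. exact: measurable_fun_xsection. Qed.

Let a (e : R) : R := (1 - fine (sec e))%R.

Let ma : measurable_fun setT a.
Proof. by apply: measurable_funB => //; exact: measurableT_comp. Qed.

Let a01 e : (0 <= a e <= 1)%R.
Proof.
rewrite /a subr_ge0 gerBl fine_ge0// andbT.
by rewrite -lee_fin fineK.
Qed.

Let mlow (e : R) : measurable [set z : R * R | (z.1 <= e)%R].
Proof. by apply: measurable_ler_set => //; exact: measurable_fst. Qed.

Let mhigh (e : R) : measurable [set z : R * R | (e < z.1)%R].
Proof. by apply: measurable_ltr_set => //; exact: measurable_fst. Qed.

Let low e := V `&` [set z | (z.1 <= e)%R].
Let high e := V `&` [set z | (e < z.1)%R].

Let lowE e : leb2 (low e) = \int[leb]_(t in `]0%R, e]) sec t.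
Proof.
rewrite [LHS]/= /product_measure1 [RHS]integral_mkcond.
apply: eq_integral => t _; rewrite patchE /=.
have [/andP[t0 te]|te] := boolP (0 < t <= e)%R.
  rewrite mem_set/=; last by rewrite in_itv/= t0.
  rewrite /sec; congr (leb _); apply/seteqP; split => u; rewrite /xsection/= !inE.
    by case.
  by move=> Vtu; split.
rewrite memNset/=; last by rewrite in_itv/=; exact/negP.
rewrite (_ : xsection _ _ = set0) ?measure0//.
apply/seteqP; split => // u; rewrite /xsection/= inE => -[Vtu /= te'].
by move: te; have /and3P[-> _ _] := Vstrip Vtu; rewrite te'.
Qed.

Let lowhigh e : leb2 V = leb2 (low e) + leb2 (high e).
Proof.
rewrite -measureU; first congr (leb2 _).
- apply/seteqP; split => z; last by move=> [[]|[]].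
  by move=> Vz; have [ze|ze] := leP z.1 e; [left|right].
- exact: (measurableI _ _ mV (mlow e)).
- exact: (measurableI _ _ mV (mhigh e)).
- apply/seteqP; split => // z [[_ /= ze] [_ /=]].
  by rewrite ltNge ze.
Qed.

Let low_fin e : leb2 (low e) \is a fin_num.
Proof.
rewrite ge0_fin_numE//; apply: le_lt_trans Vfin.
by rewrite (lowhigh e) leeDl.
Qed.

Let high_fin e : leb2 (high e) \is a fin_num.
Proof.
rewrite ge0_fin_numE//; apply: le_lt_trans Vfin.
by rewrite (lowhigh e) leeDr.
Qed.

Let F_E e : (0 <= e)%R -> (\int[leb]_(t in [set` `]0%R, e]]) a t)%R =
  (e - fine (leb2 (low e)))%R.
Proof.
move=> e0; rewrite /a RintegralB//.
- rewrite lowE; congr (_ - _)%R.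
  rewrite Rintegral_cst// mul1r.
  by rewrite [X in fine X](lebesgue_measure_itv `]0%R, e]%R)/= lte_fin;
    case: ltP => //= h; [rewrite subr0|apply/le_anti; rewrite h e0].
  rewrite /Rintegral; congr fine; apply: eq_integral => t _.
  by rewrite fineK.
- apply: measurable_bounded_integrable => //.
    by rewrite [X in X < _](lebesgue_measure_itv `]0%R, e]%R)/=; case: ifP; rewrite ltry.
  by exists 1%R; split => // M M1 t _ /=; rewrite normr1 ltW.
- apply: measurable_bounded_integrable => //.
  + by rewrite [X in X < _](lebesgue_measure_itv `]0%R, e]%R)/=; case: ifP; rewrite ltry.
  + by apply: measurable_funTS; exact: measurableT_comp.
  + exists 1%R; split => // M M1 t _ /=.
    rewrite ger0_norm ?fine_ge0// (le_trans _ (ltW M1))//.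
    by rewrite -lee_fin fineK.
Qed.

Let k (e : R) : R := fine (leb2 (high e)).

Let mk : measurable_fun setT k.
Proof.
apply: nonincreasing_measurable => // x y xy; rewrite /k fine_le//.
apply: le_measure; rewrite ?inE.
- exact: (measurableI _ _ mV (mhigh y)).
- exact: (measurableI _ _ mV (mhigh x)).
- by move=> z [Vz /= h]; split => //=; exact: le_lt_trans h.
Qed.

Let free e : (0 < e)%R -> leb ([set u | strip e u] `\` xsection V e) = (a e)%:E.
Proof.
move=> e0; have mX : measurable (xsection V e) by exact: measurable_xsection.
have S1 : leb [set u | strip e u] = 1.
  rewrite (_ : [set u | _] = [set` `]0%R, 1%R[]); last first.
    by apply/seteqP; split => u; rewrite /strip e0/= in_itv.
  by rewrite [LHS](lebesgue_measure_itv `]0%R, 1%R[%R)/= lte_fin ltr01 oppr0 adde0.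
transitivity (leb [set u | strip e u] - leb ([set u | strip e u] `&` xsection V e)).
  by apply: measureD; [exact: mstrip|exact: mX|rewrite [X in X < _]S1 ltry].
rewrite [X in X - _]S1 setIidr ?EFinB ?fineK//.
by move=> u; rewrite /xsection/= inE => /Vstrip.
Qed.

Let V_fin : leb2 V \is a fin_num.
Proof. by rewrite ge0_fin_numE. Qed.

(** With [a e] the length of the section of the strip at [e] outside of [V], the
    measure of [V] to the right of [e] is that of [V], minus [e], plus the
    integral of [a] up to [e]. The claim then says that a random variable with
    hazard rate [a] is finite. *)
Lemma first_point_identity :
  \int[exp_unif R]_z (if strip z.1 z.2 && (z \notin V) then
     expR (- fine (leb2 (V `&` [set z' | (z.1 < z'.1)%R]))) else 0)%:E =
  (expR (- fine (leb2 V)))%:E.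
Proof.
have Foo M : exists n : nat, (M <= \int[leb]_(t in [set` `]0%R, n%:R]]) a t)%R.
  have [n nM] : exists n : nat, (M + fine (leb2 V) <= n%:R)%R.
    by eexists; exact/ltW/Num.Theory.truncnS_gt.
  exists n; rewrite F_E// lerBrDr (le_trans _ nM)// lerD2l fine_le//.
  by rewrite (lowhigh n%:R) leeDl.
have tot := hazard_rate_total ma a01 Foo.
set L := fine (leb2 V).
have kE e : (0 <= e)%R ->
    (- e - k e = - L - \int[leb]_(t in [set` `]0%R, e]]) a t)%R.
  move=> e0; rewrite F_E// /L (lowhigh e) fineD//.
  by rewrite /k; ring.
have mf : measurable_fun setT (fun z : R * R =>
    (if strip z.1 z.2 && (z \notin V) then expR (- k z.1) else 0%R)%:E).
  apply/measurable_EFinP; apply: measurable_fun_ifT => //.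
    apply: measurable_and.
      by apply: measurable_strip; [exact: measurable_fst|exact: measurable_snd].
    by apply: measurable_neg; exact: measurable_fun_in.
  apply: measurableT_comp => //.
  by apply: measurable_funN; apply: measurableT_comp => //; exact: measurable_fst.
rewrite (ge0_integral_exp_unif mf); last first.
  by move=> z; rewrite lee_fin; case: ifP => // _; rewrite expR_ge0.
transitivity (\int[leb]_(e in `]0%R, +oo[) ((expR (- L))%:E *
  (a e * expR (- \int[leb]_(t in [set` `]0%R, e]]) a t)%R)%:E)); last first.
  rewrite ge0_integralZl//.
  - by rewrite tot mule1.
  - apply: (eq_measurable_fun (fun e => (a e * expR (L - e - k e))%:E)).
      move=> e; rewrite inE/= in_itv/= andbT => e0; congr (_ * expR _)%:E.
      rewrite -addrA kE ?ltW//; ring.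
    apply: measurable_funTS; apply/measurable_EFinP; apply: measurable_funM => //.
    apply: measurableT_comp => //; apply: measurable_funB => //.
    exact: measurable_funB.
  - move=> e _; rewrite lee_fin mulr_ge0 ?expR_ge0//.
    by have /andP[] := a01 e.
rewrite [RHS]integral_mkcond; apply: eq_integral => e _; rewrite patchE.
have [e0|e0] := ltP 0%R e; last first.
  rewrite memNset/=; last by rewrite in_itv/= andbT ltNge e0.
  by rewrite integral0_eq// => u _; rewrite /strip ltNge e0.
rewrite mem_set/=; last by rewrite in_itv/= e0.
rewrite -EFinM mulrCA -expRD -kE ?ltW// expRD mulrC EFinM -free//.
rewrite -integral_cst//; last first.
  apply: measurableD; first exact: mstrip.
  exact: measurable_xsection.
rewrite [RHS]integral_mkcond; apply: eq_integral => u _; rewrite patchE.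
have -> : (u \in [set u | strip e u] `\` xsection V e) =
    strip e u && ((e, u) \notin V).
  apply/idP/andP.
    by rewrite inE => -[/= -> h]; split => //; apply/negP.
  by case=> h1 h2; rewrite inE; split => //; apply/negP.
have [_|_] := boolP (strip e u) => //=; case: (_ \in V) => /=;
  by rewrite ?mule0 ?EFinM.
Qed.

End first_point.

(** * Lower envelopes of lines *)

Section finite_argmax.
Context {R : realType} {T : choiceType}.

Lemma finite_argmax (F : set T) (f : T -> R) : finite_set F -> F !=set0 ->
  exists2 x, F x & forall y, F y -> f y <= f x.
Proof.
move=> /finite_seqP[s ->]; elim: s => [[x]//|a s ih] _.
have [->|s0] := eqVneq s [::].
  by exists a => [|y]; rewrite /= inE ?eqxx// => /eqP ->.
have [|x xs fx] := ih.
  by case: s s0 {ih} => // b s _; exists b; rewrite /= mem_head.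
have [xa|ax] := leP (f a) (f x).
  exists x; first by rewrite /= inE xs orbT.
  by move=> y; rewrite /= inE => /orP[/eqP ->|/fx].
exists a; first by rewrite /= mem_head.
move=> y; rewrite /= inE => /orP[/eqP ->//|/fx yx].
exact: le_trans yx (ltW ax).
Qed.

End finite_argmax.

Section lower_envelope.
Context {R : realType}.
Implicit Types (A : set (line R)) (l : line R) (q s : R).

Definition envelope A q : R := inf [set height l q | l in A].

Definition upward A := forall l, A l -> 0 <= height l 0 /\ 0 <= slope l.

Definition locally_finite A :=
  forall s g, 0 < s -> finite_set [set l | A l /\ height l s <= g].

(** The tie is broken in favour of the steepest line because that is the line
    that the envelope follows just before time [s]. *)
Definition touches A l s := A l /\
  forall l', A l' -> height l s <= height l' s /\
    (height l' s = height l s -> slope l' <= slope l).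

Lemma height_affine l q s : height l s = height l q + slope l * (s - q).
Proof. by rewrite (heightE l s) (heightE l q); ring. Qed.

Section upward.
Variable A : set (line R).
Hypothesis upA : upward A.

Lemma upward_height_ge0 l q : A l -> 0 <= q -> 0 <= height l q.
Proof.
by move=> /upA[h0 m0] q0; rewrite heightE addr_ge0// mulr_ge0.
Qed.

Lemma envelope_le l q : A l -> 0 <= q -> envelope A q <= height l q.
Proof.
move=> Al q0; apply: ge_inf; last by exists l.
by exists 0 => _ [l' Al' <-]; exact: upward_height_ge0.
Qed.

Lemma le_envelope q g : A !=set0 ->
  (forall l, A l -> g <= height l q) -> g <= envelope A q.
Proof.
move=> [l Al] gA; apply: lb_le_inf; first by exists (height l q), l.
by move=> _ [l' Al' <-]; exact: gA.
Qed.

Lemma envelope_touches l s : touches A l s -> 0 <= s ->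
  envelope A s = height l s.
Proof.
move=> [Al tl] s0; apply/le_anti; rewrite envelope_le//=.
by apply: le_envelope => [|l' /tl[]]; first by exists l.
Qed.

(** A line steeper than [l] has the required increment; a flatter one is above
    [l] at time [r], while the envelope at time [q] is at most [l]. *)
Lemma envelope_secant l s q r : touches A l s -> 0 <= q -> q <= r -> r <= s ->
  slope l * (r - q) <= envelope A r - envelope A q.
Proof.
move=> [Al tl] q0 qr rs; rewrite lerBrDr; apply: le_envelope; first by exists l.
move=> l' Al'; have [h _] := tl _ Al'.
have [ml|ml] := leP (slope l) (slope l').
  rewrite (height_affine l' q r) addrC lerD ?envelope_le//.
  by rewrite ler_wpM2r// subr_ge0.
have := envelope_le Al q0; move: h.
rewrite (height_affine l' r s) (height_affine l r s) (height_affine l q r).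
by nra.
Qed.

Hypothesis finA : locally_finite A.

(** Only finitely many lines are low enough at time [s / 2] to compete with [l]
    between [s / 2] and [s], and those that are steeper than [l] cross it
    before [s]. *)
Lemma envelope_germ l s : 0 < s -> touches A l s ->
  exists2 r, 0 < r < s & forall q, r <= q <= s -> envelope A q = height l q.
Proof.
move=> s0 [Al tl].
pose F := [set l' | A l' /\ height l' (s / 2) <= height l s].
have finF : finite_set F by apply: finA; rewrite divr_gt0.
(* the time before which a line steeper than [l] lies below [l] *)
pose cross l' := if slope l < slope l' then
  s - (height l' s - height l s) / (slope l' - slope l) else 0.
have [|lm [Alm _] mx] := finite_argmax cross finF.
  exists l; split => //; rewrite (height_affine l (s / 2) s) lerDl mulr_ge0//.
    by have [] := upA Al.
  by lra.
have cross_lt : cross lm < s.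
  rewrite /cross; case: ifPn => // steep; rewrite gtrBl divr_gt0 ?subr_gt0//.
  have [h1 h2] := tl _ Alm; rewrite lt_neqAle h1 andbT; apply/eqP => e.
  by move: steep; rewrite ltNge h2.
exists (Num.max (s / 2) (cross lm)).
  by rewrite lt_max gt_max cross_lt divr_gt0//= andbT; lra.
move=> q /andP[]; rewrite ge_max => /andP[sq cq] qs.
have q0 : 0 <= q by lra.
apply/le_anti; rewrite envelope_le//=; apply: le_envelope; first by exists l.
move=> l' Al'; have [h1 h2] := tl _ Al'.
have [lF|lF] := pselect (F l'); last first.
  have h : height l s < height l' (s / 2).
    by rewrite ltNge; apply/negP => ?; apply: lF.
  have [_ m0] := upA Al; have [_ m0'] := upA Al'.
  rewrite (height_affine l' (s / 2) q).
  move: h; rewrite (height_affine l q s) => h.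
  have g1 : 0 <= slope l * (s - q) by rewrite mulr_ge0 ?subr_ge0.
  have g2 : 0 <= slope l' * (q - s / 2) by rewrite mulr_ge0 ?subr_ge0.
  lra.
have [steep|flat] := ltP (slope l) (slope l').
  have : cross l' <= q by rewrite (le_trans _ cq) ?mx.
  rewrite /cross steep lerBlDr -lerBlDl ler_pdivlMr ?subr_gt0//.
  rewrite (height_affine l' q s) (height_affine l q s); lra.
move: h1; rewrite (height_affine l' q s) (height_affine l q s).
have : slope l' * (s - q) <= slope l * (s - q) by rewrite ler_wpM2r// subr_ge0.
lra.
Qed.

(** Going down in time from [s], the next line is the one, among those with a
    smaller intercept, whose crossing with [l] is the latest. *)
Lemma next_line l s : 0 < s -> touches A l s ->
  (exists2 l', A l' & height l' 0 < height l 0) ->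
  exists l1 s1, [/\ 0 < s1 < s, touches A l1 s1,
    height l1 0 < height l 0 /\ slope l < slope l1,
    height l1 s1 = height l s1 &
    forall q, s1 <= q <= s -> envelope A q = height l q].
Proof.
move=> s0 [Al tl] [l2 Al2 low2].
pose cross l' := (height l 0 - height l' 0) / (slope l' - slope l).
have steep l' : A l' -> height l' 0 < height l 0 -> slope l < slope l'.
  move=> Al' low; have [h1 _] := tl _ Al'; rewrite ltNge; apply/negP => h.
  move: h1; rewrite (heightE l) (heightE l').
  have : slope l' * s <= slope l * s by rewrite ler_wpM2r// ltW.
  by lra.
have cross_gt0 l' : A l' -> height l' 0 < height l 0 -> 0 < cross l'.
  by move=> Al' low; rewrite divr_gt0 ?subr_gt0// steep.
have crossP l' q : A l' -> height l' 0 < height l 0 ->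
    (height l q <= height l' q) = (cross l' <= q).
  move=> Al' low; rewrite ler_pdivrMr ?subr_gt0 ?steep//.
  by rewrite (heightE l q) (heightE l' q); apply/idP/idP; lra.
have crossPs l' q : A l' -> height l' 0 < height l 0 ->
    (height l q < height l' q) = (cross l' < q).
  move=> Al' low; rewrite ltr_pdivrMr ?subr_gt0 ?steep//.
  by rewrite (heightE l q) (heightE l' q); apply/idP/idP; lra.
have crossE l' : A l' -> height l' 0 < height l 0 ->
    height l' (cross l') = height l (cross l').
  move=> Al' low; rewrite (heightE l) (heightE l') /cross.
  by field; rewrite subr_eq0 gt_eqF// steep.
pose F := [set l' | [/\ A l', height l' 0 < height l 0 & cross l2 <= cross l']].
have finF : finite_set F.
  apply: (sub_finite_set _ (finA (height l (cross l2)) (cross_gt0 _ Al2 low2))).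
  move=> l' [Al' low' c2]; split => //.
  by rewrite leNgt crossPs// -leNgt.
have [|lm [Alm lowm c2m] mx] := finite_argmax cross finF; first by exists l2.
(* among the lines with the latest crossing, the steepest one *)
pose F1 := F `&` [set l' | cross l' = cross lm].
have [||l1 [[Al1 low1 c21] /= c1m] mx1] := @finite_argmax _ _ F1 (@slope R).
- by apply: sub_finite_set finF => ? [].
- by exists lm; split => //; split.
have s1_gt0 : 0 < cross l1 by exact: cross_gt0.
have s1_lt : cross l1 < s.
  rewrite lt_neqAle; have [h1 h2] := tl _ Al1.
  rewrite -crossP// h1 andbT; apply/eqP => e.
  by have := steep _ Al1 low1; rewrite ltNge h2// -e crossE// e.
have above l' q : A l' -> cross l1 <= q -> q <= s -> height l q <= height l' q.
  move=> Al' q1 qs; have [low'|high'] := ltP (height l' 0) (height l 0).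
    rewrite crossP// (le_trans _ q1)//.
    have [c2|c2] := leP (cross l2) (cross l'); first by rewrite c1m mx.
    by rewrite (le_trans (ltW c2)).
  have [h1 _] := tl _ Al'; move: h1 high'.
  rewrite (heightE l q) (heightE l' q) (heightE l s) (heightE l' s).
  have : 0 < q by rewrite (lt_le_trans s1_gt0).
  by nra.
exists l1, (cross l1); split => //.
- by rewrite s1_gt0 s1_lt.
- split => // l' Al'; rewrite crossE//; split.
    by apply: above => //; rewrite ltW.
  move=> e; have [low'|high'] := ltP (height l' 0) (height l 0).
    have cl : cross l' = cross l1.
      by apply/le_anti; rewrite -crossP// e lexx/= leNgt -crossPs// e ltxx.
    by apply: mx1; split; [split; rewrite // cl|rewrite /= cl].
  apply: (le_trans _ (ltW (steep _ Al1 low1))).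
  move: e high'; rewrite (heightE l (cross l1)) (heightE l' (cross l1)); nra.
- by split => //; exact: steep.
- exact: crossE.
move=> q /andP[q1 qs]; have q0 : 0 <= q by rewrite (le_trans (ltW s1_gt0)).
apply/le_anti; rewrite envelope_le//=; apply: le_envelope; first by exists l.
by move=> l' Al'; exact: above.
Qed.

End upward.
End lower_envelope.

(** * Reading the sweep on a curve *)

Section reading_a_curve.
Context {R : realType}.
Implicit Types (p : R -> R) (c m s q r : R).

(** Intercept and slope of the line followed by the curve just before some
    time, and that time. *)
Definition state : Type := (R * R * R)%type.

Implicit Types x : state.

Definition intercept x : R := x.1.1.
Definition inclination x : R := x.1.2.
Definition time x : R := x.2.

(** The time at which the curve [p] leaves the line recorded in [x]. Rational
    times make this a measurable function of the curve. *)
Definition kink x p : R := sup [set y | y = 0 \/ exists r : rat,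
  [/\ 0 < (ratr r : R) <= 1, ratr r < time x,
      p (ratr r) < intercept x + inclination x * ratr r & y = ratr r]].

(** The left derivative at [s] of a concave function, as an infimum of difference
    quotients; the bound [m] keeps the set bounded below for every [p]. *)
Definition tangent m s p : R := inf [set y | exists q r : rat,
  [/\ 0 < (ratr q : R), ratr q < (ratr r : R), ratr r <= (1 : R), ratr r < s &
      y = Num.max m ((p (ratr r) - p (ratr q)) / (ratr r - ratr q))]].

Definition next x p : state :=
  let s := kink x p in let m := tangent (inclination x) s p in
  (intercept x + (inclination x - m) * s, m, s).

(** Inverse of the parametrization [step_line]: the coordinates of the line
    followed before the time [kink x p]. *)
Definition coords x p : R * R :=
  let s := kink x p in let m := tangent (inclination x) s p in
  (intercept x ^+ 2 / 4 * (s^-1 - (time x)^-1),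
   ((m - inclination x) * s / intercept x) ^+ 2).

Lemma kink_eq x p s : 0 < s -> s <= 1 -> s <= time x ->
  (forall q, 0 < q -> q < s -> p q < intercept x + inclination x * q) ->
  (forall q, s <= q -> q < time x -> intercept x + inclination x * q <= p q) ->
  kink x p = s.
Proof.
move=> s0 s1 st below above; apply/le_anti/andP; split.
  apply: ge_sup; first by exists 0; left.
  move=> y [->|[r [_ rt pr ->]]]; first exact: ltW.
  by rewrite leNgt; apply/negP => sr; move: pr; rewrite ltNge above// ltW.
apply/ler_addgt0Pl => e e0.
have : Num.max 0 (s - e) < s by rewrite gt_max s0/= gtrBl.
move=> /rat_in_itvoo[r]; rewrite in_itv/= gt_max => /andP[/andP[r0 er] rs].
rewrite -lerBlDl (le_trans (ltW er))//; apply: ub_le_sup.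
  exists 1 => y [->|[r' [/andP[_ r1] _ _ ->]]] //.
right; exists r; split => //; first by rewrite r0 (le_trans (ltW rs)).
  exact: lt_le_trans rs st.
exact: below.
Qed.

Lemma tangent_eq m p c1 m1 s1 : 0 < s1 -> s1 <= 1 -> m <= m1 ->
  (forall q r, 0 < q -> q < r -> r < s1 -> m1 * (r - q) <= p r - p q) ->
  (exists2 r, 0 < r < s1 & forall q, r <= q -> q < s1 -> p q = c1 + m1 * q) ->
  tangent m s1 p = m1.
Proof.
move=> s0 s1_le mm sec [d /andP[d0 ds] germ].
have [r /andP[dr rs]] : exists r : rat, d < ratr r < s1.
  by have [r] := rat_in_itvoo ds; rewrite in_itv/=; exists r.
have [q /andP[dq qr]] : exists q : rat, d < ratr q < (ratr r : R).
  by have [q] := rat_in_itvoo dr; rewrite in_itv/=; exists q.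
apply/le_anti/andP; split.
  apply: ge_inf.
    exists m => y [q' [r' [_ _ _ _ ->]]]; by rewrite le_max lexx.
  exists q, r; split => //.
  - exact: lt_trans dq.
  - exact/ltW/(lt_le_trans rs).
  rewrite germ ?(ltW dr)// germ ?(ltW dq) ?(lt_trans qr)//.
  have -> : c1 + m1 * ratr r - (c1 + m1 * ratr q) = m1 * (ratr r - ratr q).
    by ring.
  by rewrite mulfK ?subr_eq0 ?gt_eqF// max_r.
apply: lb_le_inf.
  exists (Num.max m ((p (ratr r) - p (ratr q)) / (ratr r - ratr q))), q, r.
  split => //; first exact: lt_trans dq.
  exact/ltW/(lt_le_trans rs).
move=> y [q' [r' [q'0 qr' r1 rs' ->]]]; rewrite le_max; apply/orP; right.
by rewrite ler_pdivlMr ?subr_gt0//; exact: sec.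
Qed.

Lemma next_eq x p c1 m1 s1 : 0 < s1 -> s1 <= 1 -> s1 <= time x ->
  inclination x < m1 ->
  c1 + m1 * s1 = intercept x + inclination x * s1 ->
  (forall q, s1 <= q -> q < time x -> intercept x + inclination x * q <= p q) ->
  (forall q, 0 < q -> q < s1 -> p q <= c1 + m1 * q) ->
  (forall q r, 0 < q -> q < r -> r < s1 -> m1 * (r - q) <= p r - p q) ->
  (exists2 r, 0 < r < s1 & forall q, r <= q -> q < s1 -> p q = c1 + m1 * q) ->
  [/\ kink x p = s1, tangent (inclination x) s1 p = m1
    & next x p = (c1, m1, s1)].
Proof.
move=> s0 s1_le st mm meet above below sec germ.
have kE : kink x p = s1.
  apply: kink_eq => // q q0 qs; apply: (le_lt_trans (below _ q0 qs)).
  by nra.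
have tE := tangent_eq s0 s1_le (ltW mm) sec germ.
split => //; rewrite /next kE tE; congr (_, _, _).
by lra.
Qed.

Lemma kink_local x p p' : (forall q, 0 < q -> q < time x -> p q = p' q) ->
  kink x p = kink x p'.
Proof.
move=> pp; rewrite /kink; congr sup; apply/seteqP; split => y /=.
  case=> [->|[r [/andP[r0 r1] rt pr ->]]]; [by left|right].
  by exists r; split; rewrite ?r0// -pp.
case=> [->|[r [/andP[r0 r1] rt pr ->]]]; [by left|right].
by exists r; split; rewrite ?r0// pp.
Qed.

Lemma tangent_local m s p p' : (forall q, 0 < q -> q < s -> p q = p' q) ->
  tangent m s p = tangent m s p'.
Proof.
move=> pp; rewrite /tangent; congr inf; apply/seteqP; split => y /= [q [r]].
  case=> q0 qr r1 rs ->; exists q, r; split => //.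
  by rewrite !pp// ?(lt_trans q0)// (lt_trans qr).
case=> q0 qr r1 rs ->; exists q, r; split => //.
by rewrite !pp// ?(lt_trans q0)// (lt_trans qr).
Qed.

Lemma kink_le x p : 0 <= time x -> kink x p <= time x.
Proof.
move=> t0; apply: ge_sup; first by exists 0; left.
by move=> y [->//|[r [_ /ltW rt _ ->]]].
Qed.

Lemma kink_ge0 x p : 0 <= kink x p.
Proof.
apply: ub_le_sup; last by left.
by exists 1 => y [->|[r' [/andP[_ r1] _ _ ->]]] //.
Qed.

Definition walk x p n : state := iter n (fun y => next y p) x.

Definition increment x p n : R * R := coords (walk x p n) p.

Lemma incrementS x p n : increment x p n.+1 = increment (next x p) p n.
Proof. by rewrite /increment /walk iterSr. Qed.

(** Only the part of the curve before the time of the state matters; this makes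
    the increments of a curve after one step those of the residual curve. *)
Lemma increment_local x p p' n : 0 <= time x ->
  (forall q, 0 < q -> q < time x -> p q = p' q) ->
  increment x p n = increment x p' n.
Proof.
elim: n x => [|n ih] x t0 pp.
  rewrite /increment/= /coords (kink_local pp).
  rewrite (@tangent_local _ _ p p')// => q q0 qs; apply: pp => //.
  exact: lt_le_trans qs (kink_le _ t0).
have pp' q : 0 < q -> q < kink x p' -> p q = p' q.
  by move=> q0 qs; apply: pp => //; exact: lt_le_trans qs (kink_le _ t0).
rewrite !incrementS; have -> : next x p = next x p'.
  by rewrite /next (kink_local pp) (tangent_local _ pp').
by apply: ih => //=; exact: kink_ge0.
Qed.

End reading_a_curve.

Arguments state R : clear implicits.

(** * The space of curves *)

Section measurable_sets.
Context {d} {T : measurableType d}.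

Lemma measurable_exists (I : countType) (A : I -> T -> Prop) :
  (forall i, measurable [set t | A i t]) -> measurable [set t | exists i, A i t].
Proof.
move=> mA.
rewrite (_ : [set t | _] =
    \bigcup_n (if @choice.unpickle I n is Some i then [set t | A i t] else set0)).
  apply: bigcup_measurable => n _; case: choice.unpickle => [i|]; first exact: mA.
  exact: measurable0.
apply/seteqP; split => t /=.
  by move=> [i Ai]; exists (choice.pickle i) => //; rewrite choice.pickleK.
by move=> [n _]; case: choice.unpickle => // i Ai; exists i.
Qed.

Lemma measurable_from_ge {R : realType} (f : T -> R) :
  (forall g, measurable [set t | g <= f t]) -> measurable_fun setT f.
Proof.
move=> H; apply: (measurability _ (RGenCInfty.measurableE R)).
move=> _ [_ [g ->] <-]; rewrite setTI.
rewrite (_ : _ @^-1` _ = [set t | g <= f t]) //.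
by apply/seteqP; split => t; rewrite /= in_itv/= andbT.
Qed.

Lemma measurable_from_gt {R : realType} (f : T -> R) :
  (forall g, measurable [set t | g < f t]) -> measurable_fun setT f.
Proof.
move=> H; apply: (measurability _ (RGenOInfty.measurableE R)).
move=> _ [_ [g ->] <-]; rewrite setTI.
rewrite (_ : _ @^-1` _ = [set t | g < f t]) //.
by apply/seteqP; split => t; rewrite /= in_itv/= andbT.
Qed.

Lemma measurable_from_lt {R : realType} (f : T -> R) :
  (forall g, measurable [set t | f t < g]) -> measurable_fun setT f.
Proof.
move=> H; apply: (measurability _ (RGenInftyO.measurableE R)).
move=> _ [_ [g ->] <-]; rewrite setTI.
by rewrite (_ : _ @^-1` _ = [set t | f t < g]).
Qed.

Lemma measurable_prop (Q : Prop) : measurable [set t : T | Q].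
Proof.
have [q|q] := pselect Q.
  by rewrite (_ : [set t | _] = setT)//; apply/seteqP; split.
by rewrite (_ : [set t | _] = set0)//; apply/seteqP; split.
Qed.

End measurable_sets.

Section path_space.
Context {R : realType}.
Implicit Types (K : seq (R * R)).

(** The entries of [K] are targets: a time and a height. *)
Definition cylinder K : set (R -> R) :=
  [set p | forall qg, qg \in K -> qg.2 <= p qg.1].

Definition in_window K := forall qg, qg \in K -> 0 < qg.1 <= 1.

Definition cylinders : set (set (R -> R)) := [set cylinder K | K in in_window].

(** Only the times of (0, 1], where the curve lives, are observed. *)
Definition paths := g_sigma_algebraType cylinders.

Lemma cylinder_cat K K' : cylinder (K ++ K') = cylinder K `&` cylinder K'.
Proof.
apply/seteqP; split => p.
  by move=> h; split => qg qgK; apply: h; rewrite mem_cat qgK ?orbT.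
by move=> [h h'] qg; rewrite mem_cat => /orP[/h|/h'].
Qed.

Lemma cylinders_setI : setI_closed cylinders.
Proof.
move=> _ _ [K wK <-] [K' wK' <-]; exists (K ++ K'); last exact: cylinder_cat.
by move=> qg; rewrite mem_cat => /orP[/wK|/wK'].
Qed.

Lemma cylinder_nil : cylinder [::] = setT.
Proof. by apply/seteqP; split. Qed.

Lemma measurable_eval q : 0 < q <= 1 ->
  measurable_fun setT (fun p : paths => p q).
Proof.
move=> q01; apply: measurable_from_ge => g; apply: sub_sigma_algebra.
exists [:: (q, g)].
  by move=> qg; rewrite inE => /eqP ->.
apply/seteqP; split => p /=.
  by move=> h; exact: (h (q, g) (mem_head _ _)).
by move=> h qg; rewrite inE => /eqP ->.
Qed.

Lemma measurable_into_paths d (T : measurableType d) (f : T -> paths) :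
  (forall q g, 0 < q <= 1 -> measurable [set t | g <= f t q]) ->
  measurable_fun setT f.
Proof.
move=> mf; apply: (@measurability _ _ T paths setT f cylinders) => //.
move=> _ [_ [K wK <-] <-]; rewrite setTI.
elim: K wK => [|[q g] K ih] wK.
  by rewrite cylinder_nil preimage_setT.
rewrite -cat1s cylinder_cat preimage_setI; apply: measurableI.
  rewrite (_ : _ @^-1` _ = [set t | g <= f t q]).
    by apply: mf; apply: (wK (q, g)); rewrite mem_head.
  apply/seteqP; split => t /=.
    by move=> h; exact: (h (q, g) (mem_head _ _)).
  by move=> h qg; rewrite inE => /eqP ->.
by apply: ih => qg qgK; apply: wK; rewrite inE qgK orbT.
Qed.

(** Cylinders form a pi-system, so the law of a random lower envelope is
    determined by the probabilities that no line passes below the targets. *)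
Lemma path_law_unique (m1 m2 : {measure set paths -> \bar R}) :
  (m1 setT < +oo)%E ->
  (forall K, in_window K -> m1 (cylinder K) = m2 (cylinder K)) ->
  forall A, measurable A -> m1 A = m2 A.
Proof.
move=> m1oo m12 A mA.
apply: (@measure_unique _ R paths cylinders (fun _ => setT)) => //.
- exact: cylinders_setI.
- by move=> _; exists [::]; rewrite ?cylinder_nil.
- by rewrite bigcup_const//; exists 0%N.
- by move=> _ [K wK <-]; exact: m12.
Qed.

End path_space.

Arguments paths R : clear implicits.

Section measurable_reading.
Context {R : realType} {d} {T : measurableType d}.
Variables (x : T -> state R) (p : T -> paths R).
Hypotheses (mx : measurable_fun setT x) (mp : measurable_fun setT p).

Let mcurve (r : R) : 0 < r <= 1 -> measurable_fun setT (fun t => p t r).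
Proof. by move=> r01; exact: (measurableT_comp (measurable_eval r01) mp). Qed.

Lemma measurable_intercept : measurable_fun setT (fun t => intercept (x t)).
Proof.
apply: (measurableT_comp measurable_fst).
by apply: (measurableT_comp measurable_fst).
Qed.

Lemma measurable_inclination : measurable_fun setT (fun t => inclination (x t)).
Proof.
apply: (measurableT_comp measurable_snd).
by apply: (measurableT_comp measurable_fst).
Qed.

Lemma measurable_time : measurable_fun setT (fun t => time (x t)).
Proof. by apply: (measurableT_comp measurable_snd). Qed.

Lemma measurable_kink : measurable_fun setT (fun t => kink (x t) (p t)).
Proof.
apply: measurable_from_gt => g.
have -> : [set t | g < kink (x t) (p t)] = [set t | g < 0] `|`
    [set t | exists r : rat, [/\ 0 < (ratr r : R) <= 1, g < ratr r,
      ratr r < time (x t) &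
      p t (ratr r) < intercept (x t) + inclination (x t) * ratr r]].
  apply/seteqP; split => t /=.
    move=> gk; have := @sup_gt _ _ g _ gk.
    case; first by exists 0; left.
    move=> y [->|[r [r01 rt pr ->]]] gy; [by left|right].
    by exists r; split.
  case=> [g0|[r [r01 gr rt pr]]].
    exact: lt_le_trans g0 (kink_ge0 _ _).
  apply: (lt_le_trans gr); apply: ub_le_sup.
    by exists 1 => y [->|[r' [/andP[_ r1] _ _ ->]]] //.
  by right; exists r; split.
apply: measurableU; first exact: measurable_prop.
apply: measurable_exists => r /=.
have [r01|r01] := boolP (0 < (ratr r : R) <= 1); last first.
  rewrite (_ : [set t | _] = set0) //; by apply/seteqP; split => // t [].
rewrite (_ : [set t | _] = [set t | g < ratr r] `&`
  ([set t | ratr r < time (x t)] `&`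
  [set t | p t (ratr r) < intercept (x t) + inclination (x t) * ratr r])).
  apply: measurableI; first exact: measurable_prop.
  apply: measurableI; first exact: measurable_ltr_set measurable_time.
  apply: measurable_ltr_set; first exact: mcurve.
  apply: measurable_funD; first exact: measurable_intercept.
  by apply: measurable_funM => //; exact: measurable_inclination.
by apply/seteqP; split => t /=; [case|case=> ? []].
Qed.

Lemma measurable_tangent (m s : T -> R) : measurable_fun setT m ->
  measurable_fun setT s -> measurable_fun setT (fun t => tangent (m t) (s t) (p t)).
Proof.
move=> mm ms; apply: measurable_from_lt => g.
have -> : [set t | tangent (m t) (s t) (p t) < g] =
   ([set t | s t <= 0] `&` [set t | 0 < g]) `|`
   [set t | exists qr : rat * rat, [/\ 0 < (ratr qr.1 : R) <= 1,
      0 < (ratr qr.2 : R) <= 1, ratr qr.1 < (ratr qr.2 : R), ratr qr.2 < s t &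
    Num.max (m t) ((p t (ratr qr.2) - p t (ratr qr.1)) /
       (ratr qr.2 - ratr qr.1)) < g]].
  have hl t : has_lbound [set y | exists q r : rat,
      [/\ 0 < (ratr q : R), ratr q < (ratr r : R), ratr r <= (1 : R), ratr r < s t &
      y = Num.max (m t) ((p t (ratr r) - p t (ratr q)) / (ratr r - ratr q))]].
    by exists (m t) => y [q' [r' [_ _ _ _ ->]]]; rewrite le_max lexx.
  apply/seteqP; split => t /=.
    have [s0|s0] := leP (s t) 0.
      rewrite /tangent (_ : mkset _ = set0) ?inf0; last first.
        apply/seteqP; split => // y [q [r [q0 qr _ rs _]]]; move: rs.
        by rewrite ltNge (le_trans s0)// ltW// (lt_trans q0).
      by left.
    move=> /inf_lt[|y [q [r [q0 qr r1 rs ->]]] yg].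
      have s10 : 0 < Num.min (s t) 1 by rewrite lt_min s0 ltr01.
      have [r] := rat_in_itvoo s10; rewrite in_itv/= lt_min => /and3P[r0 rs r1].
      have [q] := rat_in_itvoo r0; rewrite in_itv/= => /andP[q0 qr].
      by eexists; exists q, r; split => //; exact: ltW.
    right; exists (q, r); split => //=.
    + by rewrite q0 (le_trans (ltW qr)).
    + by rewrite (lt_trans q0).
  case=> [[s0 g0]|[[q r] /= [/andP[q0 q1] /andP[r0 r1] qr rs]]].
    rewrite /tangent (_ : mkset _ = set0) ?inf0//.
    apply/seteqP; split => // y [q [r [q0 qr _ rs _]]]; move: rs.
    by rewrite ltNge (le_trans s0)// ltW// (lt_trans q0).
  by apply: le_lt_trans; apply: ge_inf => //; exists q, r; split.
apply: measurableU.
  by apply: measurableI; [exact: measurable_ler_set|exact: measurable_prop].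
apply: measurable_exists => -[q r] /=.
have [q01|q01] := boolP (0 < (ratr q : R) <= 1); last first.
  rewrite (_ : [set t | _] = set0) //; by apply/seteqP; split => // t [].
have [r01|r01] := boolP (0 < (ratr r : R) <= 1); last first.
  rewrite (_ : [set t | _] = set0) //; by apply/seteqP; split => // t [].
rewrite (_ : [set t | _] = [set t | ratr q < (ratr r : R)] `&`
  ([set t | ratr r < s t] `&`
  [set t | Num.max (m t) ((p t (ratr r) - p t (ratr q)) /
       (ratr r - ratr q)) < g])).
  apply: measurableI; first exact: measurable_prop.
  apply: measurableI; first exact: measurable_ltr_set.
  apply: measurable_ltr_set => //; apply: measurable_maxr => //.
  by apply: measurable_funM => //; apply: measurable_funB; exact: mcurve.
by apply/seteqP; split => t /=; [case|case=> ? []].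
Qed.

Lemma measurable_next : measurable_fun setT (fun t => next (x t) (p t)).
Proof.
have mt := measurable_tangent measurable_inclination measurable_kink.
apply: measurable_fun_pair; last exact: measurable_kink.
apply: measurable_fun_pair => //.
apply: measurable_funD; first exact: measurable_intercept.
apply: measurable_funM; last exact: measurable_kink.
by apply: measurable_funB => //; exact: measurable_inclination.
Qed.

Lemma measurable_coords : measurable_fun setT (fun t => coords (x t) (p t)).
Proof.
have mt := measurable_tangent measurable_inclination measurable_kink.
apply: measurable_fun_pair.
  apply: measurable_funM.
    by apply: measurable_funM => //; apply: measurable_funX; exact: measurable_intercept.
  by apply: measurable_funB; apply: measurable_funV;
    [exact: measurable_kink|exact: measurable_time].
apply: measurable_funX; apply: measurable_funM; last first.
  by apply: measurable_funV; exact: measurable_intercept.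
apply: measurable_funM; last exact: measurable_kink.
by apply: measurable_funB => //; exact: measurable_inclination.
Qed.

End measurable_reading.

Section measurable_walk.
Context {R : realType} {d} {T : measurableType d}.
Variables (x : T -> state R) (p : T -> paths R).
Hypotheses (mx : measurable_fun setT x) (mp : measurable_fun setT p).

Lemma measurable_walk n : measurable_fun setT (fun t => walk (x t) (p t) n).
Proof. by elim: n => // n ih; exact: measurable_next. Qed.

Lemma measurable_increment n :
  measurable_fun setT (fun t => increment (x t) (p t) n).
Proof. by apply: measurable_coords => //; exact: measurable_walk. Qed.

End measurable_walk.

(** * Geometry of a step *)

Section states.
Context {R : realType}.
Implicit Types (x : state R) (l : line R) (L : set (line R)) (z : R * R).
Implicit Types (K : seq (R * R)) (q g : R).

Definition valid x := [&& 0 < intercept x, 0 <= inclination x, 0 < time x & time x <= 1].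

Definition pivot x : line R := mkline (intercept x) (inclination x).

Definition beyond x l := ahead (intercept x) (inclination x) (time x) l.

Definition below K l := has (fun qg => height l qg.1 < qg.2) K.

(** Its [pivot] is [step_line] applied to [z], and its time is the one at which
    that line crosses the pivot of [x]. *)
Definition step_state x z : state R :=
  (intercept x * (1 - Num.sqrt z.2),
   inclination x + intercept x * Num.sqrt z.2 *
     ((time x)^-1 + 4 / intercept x ^+ 2 * z.1),
   ((time x)^-1 + 4 / intercept x ^+ 2 * z.1)^-1).

Definition first_state z : state R :=
  (2 * Num.sqrt z.1 * (1 - z.2), 2 * Num.sqrt z.1 * z.2, 1).

Lemma height_pivot x q : height (pivot x) q = intercept x + inclination x * q.
Proof. exact: height_mkline. Qed.

Lemma slope_pivot x : slope (pivot x) = inclination x.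
Proof. exact: slope_mkline. Qed.

Lemma beyond_steeper x l : valid x -> beyond x l -> inclination x < slope l.
Proof.
move=> /and4P[c0 m0 s0 _] /and3P[h0 hc hs].
rewrite ltNge; apply/negP => sm; move: hs; rewrite (heightE l) ltNge => /negP; apply.
by rewrite lerD ?(ltW hc)// ler_wpM2r// ltW.
Qed.

Lemma sqrt_strip (u : R) : 0 < u < 1 -> 0 < Num.sqrt u < 1.
Proof.
move=> /andP[u0 u1]; rewrite sqrtr_gt0 u0/= -[ltRHS]sqrtr1.
by rewrite ltr_sqrt.
Qed.

Section step.
Variables (x : state R) (vx : valid x).
Let c0 : 0 < intercept x. Proof. by have /and4P[] := vx. Qed.
Let m0 : 0 <= inclination x. Proof. by have /and4P[] := vx. Qed.
Let s0 : 0 < time x. Proof. by have /and4P[] := vx. Qed.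
Let s1 : time x <= 1. Proof. by have /and4P[] := vx. Qed.

Lemma step_time_gt0 z : strip z.1 z.2 -> (time x)^-1 < (time x)^-1 + 4 / intercept x ^+ 2 * z.1.
Proof.
by move=> /and3P[e0 _ _]; rewrite ltrDl mulr_gt0// divr_gt0// exprn_gt0.
Qed.

Lemma step_time z : strip z.1 z.2 -> 0 < time (step_state x z) < time x.
Proof.
move=> /step_time_gt0 h.
have i0 : 0 < (time x)^-1 by rewrite invr_gt0.
rewrite /step_state /time/= -/(time x) invr_gt0 (lt_trans i0 h)/=.
by rewrite -[ltRHS]invrK ltf_pV2// posrE// (lt_trans i0).
Qed.

Lemma step_steeper z : strip z.1 z.2 -> inclination x < inclination (step_state x z).
Proof.
move=> sz; have /and3P[e0 u0 u1] := sz.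
have /andP[v0 v1] : 0 < Num.sqrt z.2 < 1 by rewrite sqrt_strip// u0.
rewrite {2}/inclination/= ltrDl mulr_gt0// ?mulr_gt0//.
by rewrite (lt_trans _ (step_time_gt0 sz))// invr_gt0.
Qed.

Lemma step_lower z : strip z.1 z.2 -> 0 < intercept (step_state x z) < intercept x.
Proof.
move=> sz; have /and3P[e0 u0 u1] := sz.
have /andP[v0 v1] : 0 < Num.sqrt z.2 < 1 by rewrite sqrt_strip// u0.
by rewrite {1 2}/intercept/= -/(intercept x) pmulr_rgt0 ?subr_gt0// v1/= gtr_pMr// gtrBl.
Qed.

Lemma valid_step z : strip z.1 z.2 -> valid (step_state x z).
Proof.
move=> sz; have /andP[t0 ts] := step_time sz; have /andP[ci _] := step_lower sz.
by rewrite /valid ci t0 (le_trans m0 (ltW (step_steeper sz))) (le_trans (ltW ts)).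
Qed.

Lemma step_meet z : strip z.1 z.2 ->
  height (pivot (step_state x z)) (time (step_state x z)) =
  height (pivot x) (time (step_state x z)).
Proof.
move=> sz; have /andP[t0 _] := step_time sz.
rewrite !height_pivot; move: t0; rewrite /step_state /time/= /intercept/= /inclination/=.
set t := (_ + _); rewrite invr_gt0 => t0.
by field; rewrite gt_eqF.
Qed.

(** The region left after a step is a quadrant of the strip: [e] orders the
    crossing times and [u] the intercepts. *)
Lemma step_beyond z z' : strip z.1 z.2 -> strip z'.1 z'.2 ->
  beyond (step_state x z) (pivot (step_state x z')) = (z.1 < z'.1) && (z.2 < z'.2).
Proof.
move=> sz sz'; have /and3P[e0 u0 u1] := sz; have /and3P[e0' u0' u1'] := sz'.
have /andP[v0 v1] : 0 < Num.sqrt z.2 < 1 by rewrite sqrt_strip// u0.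
have /andP[v0' v1'] : 0 < Num.sqrt z'.2 < 1 by rewrite sqrt_strip// u0'.
rewrite /beyond /ahead !height_pivot mulr0 addr0.
have /andP[-> _] := step_lower sz'; rewrite andTb andbC.
congr andb; last first.
  rewrite /intercept/= -/(intercept x) ltr_pM2l// ltrD2l ltrN2.
  by rewrite ltr_sqrt.
have := step_meet sz; rewrite !height_pivot => ->.
have := step_time_gt0 sz; have := step_time_gt0 sz'.
have i0 : 0 < (time x)^-1 by rewrite invr_gt0.
rewrite /step_state /time/= /intercept/= /inclination/=.
rewrite -/(intercept x) -/(inclination x) -/(time x).
set t := (_ + _ * z.1); set t' := (_ + _ * z'.1) => ht' ht.
have t0 : 0 < t by exact: lt_trans ht.
rewrite -subr_gt0.
have -> : intercept x * (1 - Num.sqrt z'.2) +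
   (inclination x + intercept x * Num.sqrt z'.2 * t') * t^-1 -
   (intercept x + inclination x * t^-1) =
   intercept x * Num.sqrt z'.2 / t * (t' - t) by field; rewrite gt_eqF.
rewrite pmulr_rgt0; last by rewrite divr_gt0// mulr_gt0.
by rewrite subr_gt0 /t /t' ltrD2l ltr_pM2l// divr_gt0// exprn_gt0.
Qed.

(** By [step_beyond] it remains to compare intercepts. A line that crosses the
    pivot of [x] earlier than the line of [z] and has a higher intercept is above
    the minimum of these two lines at all times, hence cannot be below a target
    that they both avoid. *)
Lemma step_later K z z' : in_window K -> ~~ below K (pivot x) ->
  strip z.1 z.2 -> strip z'.1 z'.2 -> ~~ below K (pivot (step_state x z)) ->
  below K (pivot (step_state x z')) ->
  beyond (step_state x z) (pivot (step_state x z')) = (z.1 < z'.1).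
Proof.
move=> wK nK sz sz' nz /hasP[[q g] qgK /= hq].
rewrite step_beyond//; case: ltP => //= e; rewrite ltNge; apply/negP => uu.
have /andP[q0 q1] := wK _ qgK; rewrite /= in q0 q1.
have gx : g <= height (pivot x) q by rewrite leNgt; apply: (hasPn nK (q, g)).
have gz : g <= height (pivot (step_state x z)) q.
  by rewrite leNgt; apply: (hasPn nz (q, g)).
have m1 := step_meet sz; have m2 := step_meet sz'.
have /andP[t0 _] := step_time sz; have /andP[t0' _] := step_time sz'.
have st' := step_steeper sz'.
have tt : time (step_state x z') < time (step_state x z).
  rewrite /step_state /time/= -/(time x) ltf_pV2 ?posrE//.
  - by rewrite ltrD2l ltr_pM2l// divr_gt0// exprn_gt0.
  - by rewrite (lt_trans _ (step_time_gt0 sz'))// invr_gt0.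
  - by rewrite (lt_trans _ (step_time_gt0 sz))// invr_gt0.
have cc : intercept (step_state x z) <= intercept (step_state x z').
  rewrite /intercept/= -/(intercept x) ler_pM2l// lerD2l lerN2.
  by rewrite ler_wsqrtr.
move: hq gx gz m1 m2; rewrite !height_pivot.
move: (step_state x z) (step_state x z') st' tt cc t0 t0' => y y' st' tt cc t0 t0'.
have [qt|qt] := leP (time y) q.
  nra.
have : 0 < q * (time y - q).
  by rewrite mulr_gt0// subr_gt0.
move=> *.
have : intercept y + inclination y * time y <= intercept y' + inclination y' * time y.
  nra.
move=> ?.
have : (time y - q) * intercept y + q * (intercept y + inclination y * time y)
   <= (time y - q) * intercept y' + q * (intercept y' + inclination y' * time y).
  apply: lerD; apply: ler_wpM2l => //; lra.
nra.
Qed.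

End step.
End states.

(** * Geometry of the start, and void probabilities *)

Section first_states.
Context {R : realType}.
Implicit Types (x : state R) (l : line R) (z : R * R).
Implicit Types (K : seq (R * R)) (q g : R).

Definition positive l := (0 < height l 0) && (0 < slope l).

Lemma beyond_positive x l : valid x -> beyond x l -> positive l.
Proof.
move=> vx bl; have := beyond_steeper vx bl; case/and4P: vx => _ m0 _ _ ml.
by case/and3P: bl => h0 _ _; rewrite /positive h0 (le_lt_trans m0).
Qed.

Lemma valid_first z : strip z.1 z.2 -> valid (first_state z).
Proof.
move=> /and3P[e0 u0 u1].
have g0 : 0 < Num.sqrt z.1 by rewrite sqrtr_gt0.
rewrite /valid /intercept /inclination /time/= ltr01 lexx !andbT.
by rewrite !mulr_ge0 ?mulr_gt0 ?subr_gt0 ?ltW.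
Qed.

Lemma first_beyond z z' : strip z.1 z.2 -> strip z'.1 z'.2 ->
  beyond (first_state z) (pivot (first_state z')) =
  (z.1 < z'.1) && (height (pivot (first_state z')) 0 < height (pivot (first_state z)) 0).
Proof.
move=> /and3P[e0 u0 u1] /and3P[e0' u0' u1'].
rewrite /beyond /ahead !height_pivot /intercept /inclination /time/= !mulr0 !addr0 !mulr1.
have -> : 0 < 2 * Num.sqrt z'.1 * (1 - z'.2).
  by rewrite !mulr_gt0 ?subr_gt0 ?sqrtr_gt0.
rewrite andTb andbC; congr andb.
have -> : 2 * Num.sqrt z.1 * (1 - z.2) + 2 * Num.sqrt z.1 * z.2 = 2 * Num.sqrt z.1.
  by ring.
have -> : 2 * Num.sqrt z'.1 * (1 - z'.2) + 2 * Num.sqrt z'.1 * z'.2 =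
    2 * Num.sqrt z'.1 by ring.
by rewrite ltr_pM2l// ltr_sqrt.
Qed.

(** As for [step_later], with heights at time 1 instead of crossing times: a line
    that is higher at both ends of [0, 1] is higher in between. *)
Lemma first_later K z z' : in_window K ->
  strip z.1 z.2 -> strip z'.1 z'.2 -> ~~ below K (pivot (first_state z)) ->
  below K (pivot (first_state z')) ->
  beyond (first_state z) (pivot (first_state z')) = (z.1 < z'.1).
Proof.
move=> wK sz sz' nz /hasP[[q g] qgK /= hq].
rewrite first_beyond//; case: ltP => //= e; rewrite ltNge; apply/negP => uu.
have /andP[q0 q1] := wK _ qgK; rewrite /= in q0 q1.
have gz : g <= height (pivot (first_state z)) q.
  by rewrite leNgt; apply: (hasPn nz (q, g)).
have g1 : height (pivot (first_state z)) 1 < height (pivot (first_state z')) 1.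
  rewrite !height_pivot /intercept /inclination/= !mulr1.
  have /and3P[e0' _ _] := sz'.
  have : Num.sqrt z.1 < Num.sqrt z'.1 by rewrite ltr_sqrt.
  lra.
move: hq gz uu g1; rewrite !(heightE _ q) !(heightE _ 1).
move: (height _ 0) (height _ 0) (slope _) (slope _) => a b m n hq gz uu g1.
have : (1 - q) * a + q * (a + m * 1) <= (1 - q) * b + q * (b + n * 1).
  by apply: lerD; apply: ler_wpM2l; lra.
lra.
Qed.

(** A line below a target [(q, g)] that the pivot avoids crosses the pivot after
    time [q], and the first coordinate of the strip is essentially the inverse
    of the crossing time. Together with [first_bounded], this shows that the
    lines passing below some target have finite intensity. *)
Lemma step_bounded x K z : valid x -> in_window K -> ~~ below K (pivot x) ->
  strip z.1 z.2 -> below K (pivot (step_state x z)) ->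
  z.1 <= intercept x ^+ 2 / 4 * \sum_(qg <- K) qg.1^-1.
Proof.
move=> vx wK nK sz /hasP[[q g] qgK /= hq].
have /andP[q0 q1] := wK _ qgK; rewrite /= in q0 q1.
have gx : g <= height (pivot x) q by rewrite leNgt; apply: (hasPn nK (q, g)).
have qt : q < time (step_state x z).
  rewrite ltNge; apply/negP => tq; move: hq; rewrite ltNge => /negP; apply.
  apply: (le_trans gx).
  have := step_meet vx sz; have := step_steeper vx sz.
  by rewrite !height_pivot; move: (step_state x z) tq => y *; nra.
have /and4P[c0 m0 s0 s1] := vx.
have tP : (time x)^-1 + 4 / intercept x ^+ 2 * z.1 < q^-1.
  rewrite -[ltLHS]invrK ltf_pV2 ?posrE//.
  rewrite invr_gt0 (lt_trans _ (step_time_gt0 vx sz))// invr_gt0//.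
have s' : 0 < (time x)^-1 by rewrite invr_gt0.
have sumK : q^-1 <= \sum_(qg <- K) qg.1^-1.
  rewrite (big_rem _ qgK)/= lerDl big_seq sumr_ge0// => qg /mem_rem/wK/andP[? _].
  by rewrite invr_ge0 ltW.
have c2 : 0 < intercept x ^+ 2 / 4 by rewrite divr_gt0// exprn_gt0.
rewrite -ler_pdivrMl//; apply: le_trans sumK.
rewrite invf_div; lra.
Qed.

Lemma first_bounded K z : in_window K -> strip z.1 z.2 ->
  below K (pivot (first_state z)) ->
  z.1 <= \sum_(qg <- K) (qg.2 / qg.1) ^+ 2.
Proof.
move=> wK sz /hasP[[q g] qgK /=].
have /andP[q0 q1] := wK _ qgK; rewrite /= in q0 q1.
rewrite height_pivot /intercept /inclination/= => hq.
have /and3P[e0 u0 u1] := sz.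
have r0 : 0 < Num.sqrt z.1 by rewrite sqrtr_gt0.
have sumK : (g / q) ^+ 2 <= \sum_(qg <- K) (qg.2 / qg.1) ^+ 2.
  by rewrite (big_rem _ qgK)/= lerDl sumr_ge0// => qg _; rewrite sqr_ge0.
apply: le_trans sumK; rewrite -{1}(sqr_sqrtr (ltW e0)).
have h : Num.sqrt z.1 <= g / q.
  rewrite ler_pdivlMr//; move: hq; move: (Num.sqrt z.1) r0 => r r0 hq.
  have : r * q <= 2 * r * (1 - z.2) + 2 * r * z.2 * q.
    have -> : 2 * r * (1 - z.2) + 2 * r * z.2 * q =
      r * (2 * (1 - z.2) * (1 - q) + 2 * q) by ring.
    by rewrite ler_pM2l//; nra.
  lra.
by rewrite ler_pXn2r// ?nnegrE ?(ltW r0)// (le_trans (ltW r0)).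
Qed.

End first_states.

Section targets.
Context {R : realType}.
Notation leb := (@lebesgue_measure R).
Notation leb2 := (leb \x leb)%E.

Lemma measurable_below (K : seq (R * R)) : measurable_fun setT (below K).
Proof.
elim: K => [|qg K ih]; first exact: measurable_cst.
apply: measurable_or => //; apply: measurable_fun_ltr => //.
exact: measurable_height.
Qed.

Lemma strip_fin (V : set (R * R)) (M : R) : measurable V ->
  (forall z, V z -> strip z.1 z.2 /\ z.1 <= M) -> (leb2 V < +oo)%E.
Proof.
move=> mV VM.
apply: (@le_lt_trans _ _ (leb2 ([set` `]0, M]] `*` [set` `]0, 1[]))).
  apply: le_measure; rewrite ?inE//.
    by apply: measurableX; exact: measurable_itv.
  move=> z /VM[/and3P[e0 u0 u1] eM]; split; rewrite /= in_itv/=.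
    by rewrite e0 eM.
  by rewrite u0 u1.
rewrite product_measure1E; [|exact: measurable_itv|exact: measurable_itv].
apply: lte_mul_pinfty; first exact: measure_ge0.
  rewrite ge0_fin_numE; last exact: measure_ge0.
  by rewrite [X in (X < _)%E](lebesgue_measure_itv `]0, M]%R)/=; case: ifP;
    rewrite ?oppr0 ?adde0 ?ltry.
by rewrite [X in (X < _)%E](lebesgue_measure_itv `]0, 1[%R)/= lte_fin ltr01 oppr0 adde0 ltry.
Qed.

End targets.

(** The sweep, abstractly: [chi] is a chart of the region [O] on the strip,
    carrying the product of the Lebesgue measures to the intensity; when the
    line [chi z] is the first one found, the region left to explore is that of
    the lines beyond the state [y z]. *)
Section first_point_void.
Context {R : realType}.
Notation leb := (@lebesgue_measure R).
Notation leb2 := (leb \x leb)%E.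
Variables (chi : R * R -> line R) (O : line R -> bool).
Variables (y : R * R -> state R) (K : seq (R * R)).
Hypotheses (mchi : measurable_fun setT chi) (mO : measurable_fun setT O).
Hypothesis push : forall f : line R -> \bar R, measurable_fun setT f ->
  (forall l, 0 <= f l)%E ->
  (\int[line_intensity R]_l (if O l then f l else 0) =
   \int[leb]_u \int[leb]_e (if strip e u then f (chi (e, u)) else 0))%E.
Hypothesis yO : forall z l, strip z.1 z.2 -> beyond (y z) l -> O l.
Hypothesis later : forall z z', strip z.1 z.2 -> strip z'.1 z'.2 ->
  ~~ below K (chi z) -> below K (chi z') -> beyond (y z) (chi z') = (z.1 < z'.1).
Variable M : R.
Hypothesis bounded_below : forall z, strip z.1 z.2 -> below K (chi z) -> z.1 <= M.

Let measurable_strip2 : measurable_fun setT (fun z : R * R => strip z.1 z.2).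
Proof.
by apply: measurable_strip; [exact: measurable_fst|exact: measurable_snd].
Qed.

Let pushE (D : line R -> bool) : measurable_fun setT D ->
  line_intensity R [set l | O l && D l] =
  leb2 [set z | strip z.1 z.2 && D (chi z)].
Proof.
move=> mD.
have mOD : measurable [set l | O l && D l].
  by apply: measurable_set_of; exact: measurable_and.
have mSD : measurable [set z | strip z.1 z.2 && D (chi z)].
  apply: measurable_set_of; apply: measurable_and => //.
  exact: (measurableT_comp mD mchi).
have mf : measurable_fun setT (fun l : line R => if D l then 1%E else 0%E : \bar R).
  exact: measurable_fun_ifT.
have := push mf (fun l => _); move=> /(_ _)/wrap[|h]; first by move=> l; case: ifP.
transitivity (\int[line_intensity R]_l (if O l then if D l then 1 else 0 else 0))%E.
  transitivity (\int[line_intensity R]_l (\1_[set l | O l && D l] l)%:E)%E.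
    by rewrite integral_indicT.
  apply: eq_integral => l _.
  rewrite indicE (_ : (l \in _) = O l && D l); last by apply/idP/idP; rewrite inE.
  by case: (O l) => //=; case: (D l).
rewrite h; pose F (z : R * R) : \bar R :=
  (if strip z.1 z.2 then if D (chi z) then 1 else 0 else 0)%E.
have F0 z : (0 <= F z)%E by rewrite /F; case: ifP => // _; case: ifP.
have mF : measurable_fun setT F.
  apply: measurable_fun_ifT => //; apply: measurable_fun_ifT => //.
  exact: (measurableT_comp mD mchi).
have /= <- := fubini_tonelli2 (m1 := leb) (m2 := leb) _ mF F0.
transitivity (\int[leb2]_z (\1_[set z | strip z.1 z.2 && D (chi z)] z)%:E)%E;
  last by rewrite integral_indicT.
apply: eq_integral => z _.
rewrite indicE (_ : (z \in _) = strip z.1 z.2 && D (chi z)); last first.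
  by apply/idP/idP; rewrite inE.
by rewrite /F; case: (strip _ _) => //=; case: (D _).
Qed.

(** [first_point_identity], for the set [V] of the points of the strip whose line
    passes below some target. *)
Lemma first_point_void :
  (line_intensity R [set l | O l && below K l] < +oo)%E /\
  (expR (- fine (line_intensity R [set l | O l && below K l])))%:E =
  (\int[exp_unif R]_z (if strip z.1 z.2 && ~~ below K (chi z) then
     expR (- fine (line_intensity R [set l | beyond (y z) l && below K l]))
   else 0)%:E)%E.
Proof.
pose V := [set z | strip z.1 z.2 && below K (chi z)].
have mbc : measurable_fun setT (fun z => below K (chi z)).
  exact: (measurableT_comp (measurable_below K) mchi).
have mV : measurable V by apply: measurable_set_of; exact: measurable_and.
have Vstrip z : V z -> strip z.1 z.2 by move=> /andP[].
have VM : forall z, V z -> strip z.1 z.2 /\ z.1 <= M.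
  by move=> z /andP[sz bz]; split => //; exact: bounded_below.
have Vfin : (leb2 V < +oo)%E := strip_fin mV VM.
have OE := pushE (measurable_below K).
rewrite OE; split => //.
rewrite -/V -(first_point_identity mV Vstrip Vfin).
apply: eq_integral => z _.
rewrite (_ : (z \in V) = strip z.1 z.2 && below K (chi z)); last first.
  by apply/idP/idP; rewrite inE.
have [sz|] //= := boolP (strip z.1 z.2).
case: ifP => // nz; congr (expR (- fine _))%:E.
have mb : measurable_fun setT (fun l => beyond (y z) l && below K l).
  by apply: measurable_and; [exact: measurable_ahead|exact: measurable_below].
transitivity (line_intensity R [set l | O l && (beyond (y z) l && below K l)]).
  rewrite (pushE mb); congr (leb2 _); apply/seteqP; split => z' /=.
    by move=> [/andP[sz' bz'] zz']; rewrite sz' bz' (later sz sz' nz bz') zz'.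
  by move=> /and3P[sz' bz' bb]; rewrite /V/= sz' bb -(later sz sz' nz bb).
congr (line_intensity R _); apply/seteqP; split => l /=; first by case/andP.
by move=> /andP[bl kl]; rewrite bl kl (yO sz).
Qed.

End first_point_void.

(** * Residual curves and the Poisson process *)

Section residual.
Context {R : realType}.
Implicit Types (x : state R) (l : line R) (L : set (line R)).

Definition hits L (D : line R -> bool) := exists2 l, L l & D l.

Definition family x L : set (line R) :=
  [set l | l = pivot x \/ (L l /\ beyond x l)].

(** The curve before time [time x], given that it follows the pivot of [x] just
    before; the value at invalid states makes it a function of all states. *)
Definition residual x L (q : R) : R :=
  if valid x then envelope (family x L) q else 0.

Lemma positive_linesE L : positive_lines L = [set l | L l /\ positive l].
Proof.
apply/seteqP; split => l /=.
  move=> [Ll m0 [y y0]]; rewrite heightE => hy; split => //.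
  rewrite /positive m0 andbT -(addrK (slope l * y) (height l 0)) hy sub0r.
  by rewrite oppr_gt0 pmulr_rlt0.
move=> [Ll /andP[h0 m0]]; split => //; exists (- (height l 0 / slope l)).
  by rewrite oppr_lt0 divr_gt0.
by rewrite heightE; field; rewrite gt_eqF.
Qed.

Lemma upward_positive L : upward (positive_lines L).
Proof. by rewrite positive_linesE => l [_ /andP[h0 m0]]; split; exact: ltW. Qed.

Lemma upward_family x L : valid x -> upward (family x L).
Proof.
move=> vx l [->|[_ /(beyond_positive vx)/andP[h0 m0]]]; last by split; exact: ltW.
have /and4P[c0 m0 _ _] := vx.
by rewrite height_pivot slope_pivot mulr0 addr0; split => //; exact: ltW.
Qed.

Lemma family_touches x L : touches (family x L) (pivot x) (time x).
Proof.
split; first by left.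
move=> l [->|[_ /and3P[_ _ h]]]; first by split.
rewrite height_pivot; split; first exact: ltW.
by move=> e; move: h; rewrite e ltxx.
Qed.

Lemma family_locally_finite x L : valid x ->
  locally_finite (positive_lines L) -> locally_finite (family x L).
Proof.
move=> vx finL s g s0; apply: (@sub_finite_set _ _ ([set pivot x] `|`
    [set l | positive_lines L l /\ height l s <= g])); last first.
  by rewrite finite_setU; split; [exact: finite_set1|exact: finL].
move=> l [[->|[Ll bl]] lg]; [by left|right; split => //].
by rewrite positive_linesE; split => //; exact: beyond_positive bl.
Qed.

Lemma ge_residual x L q g : valid x -> 0 <= q -> g <= residual x L q <->
  g <= height (pivot x) q /\ forall l, L l -> beyond x l -> g <= height l q.
Proof.
move=> vx q0; have up := @upward_family x L vx; rewrite /residual vx; split.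
  move=> h; split; first by apply: (le_trans h); apply: envelope_le => //; left.
  by move=> l Ll bl; apply: (le_trans h); apply: envelope_le => //; right.
move=> [h1 h2]; apply: le_envelope; first by exists (pivot x); left.
by move=> l [->//|[Ll bl]]; exact: h2.
Qed.

Lemma residual_cylinder x L K : valid x -> in_window K ->
  cylinder K (residual x L) <->
  ~~ below K (pivot x) /\ ~ hits L (fun l => beyond x l && below K l).
Proof.
move=> vx wK; split.
  move=> h; split.
    apply/hasPn => qg qgK; rewrite -leNgt.
    have /andP[q0 _] := wK _ qgK.
    by have /(ge_residual L _ vx (ltW q0))[] := h _ qgK.
  move=> [l Ll /andP[bl /hasP[qg qgK]]]; rewrite ltNge => /negP; apply.
  have /andP[q0 _] := wK _ qgK.
  by have /(ge_residual L _ vx (ltW q0))[_] := h _ qgK; apply.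
move=> [/hasPn h1 h2] qg qgK; have /andP[q0 _] := wK _ qgK.
apply/(ge_residual L _ vx (ltW q0)); split; first by rewrite leNgt h1.
move=> l Ll bl; rewrite leNgt; apply/negP => hl; apply: h2.
by exists l => //; rewrite bl; apply/hasP; exists qg.
Qed.

Lemma seminal_cylinder L K : positive_lines L !=set0 -> in_window K ->
  cylinder K (seminal_curve L) <->
  ~ hits L (fun l => positive l && below K l).
Proof.
have up := @upward_positive L.
move=> [l0 Ll0] wK; split.
  move=> h [l Ll /andP[pl /hasP[qg qgK]]]; rewrite ltNge => /negP; apply.
  have /andP[q0 _] := wK _ qgK.
  apply: (le_trans (h _ qgK)); apply: envelope_le => //; last exact: ltW.
  by rewrite positive_linesE.
move=> h qg qgK; have /andP[q0 _] := wK _ qgK.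
apply: le_envelope; first by exists l0.
move=> l; rewrite positive_linesE => -[Ll pl].
rewrite leNgt; apply/negP => hl; apply: h.
by exists l => //; rewrite pl; apply/hasP; exists qg.
Qed.

End residual.

Section poisson.
Context {R : realType} {d} {Omega : measurableType d}.
Variables (P : probability Omega R) (Pi : Omega -> set (line R)).
Hypothesis hPi : is_poisson_process P (line_intensity R) Pi.
Notation nu := (line_intensity R).

Let count0 (A : set (line R)) w :
  (number_in R Pi A w = 0%E) <-> ~ exists2 l, Pi w l & A l.
Proof.
rewrite /number_in /counting; split.
  case: ifPn => [/asboolP fin [] /eqP|//].
  rewrite pnatr_eq0 cardfs_eq0 => /eqP/fset_set_set0 e [l Pl Al].
  by have : (Pi w `&` A) l by []; rewrite e.
move=> h; have -> : Pi w `&` A = set0.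
  by apply/seteqP; split => // l [Pl Al]; apply: h; exists l.
by rewrite asboolT// fset_set0.
Qed.

Lemma measurable_hits (D : line R -> bool) : measurable_fun setT D ->
  measurable [set w | hits (Pi w) D].
Proof.
move=> /measurable_set_of mD; have [mN _ _ _] := hPi.
have := mN _ mD measurableT (~` [set 0%E]).
rewrite setTI (_ : _ @^-1` _ = [set w | hits (Pi w) D]).
  by apply; apply: measurableC; exact: emeasurable_set1.
apply/seteqP; split => w /=.
  by move=> h; apply: contrapT => h'; apply: h; apply/count0.
by move=> h /count0; apply.
Qed.

(** The counts have Poisson laws, whose mass at 0 is [exp (- rate)]. *)
Lemma void_probability (D : line R -> bool) : measurable_fun setT D ->
  (nu [set l | D l] < +oo)%E ->
  P [set w | ~ hits (Pi w) D] = (expR (- fine (nu [set l | D l])))%:E.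
Proof.
move=> /measurable_set_of mD fD; have [_ hk _ _] := hPi.
have := hk _ mD fD 0%N.
rewrite (_ : [set w | _] = [set w | ~ hits (Pi w) D]); last first.
  by apply/seteqP; split => w /= /count0.
move=> ->; rewrite /poisson_prob; case: ifPn => r0.
  by rewrite esum_set1 ?lee_fin ?poisson_pmf_ge0// /poisson_pmf r0 expr0 fact0 invr1 !mul1r.
have -> : fine (nu [set l | D l]) = 0.
  by apply/le_anti; rewrite leNgt r0/= fine_ge0.
by rewrite oppr0 expR0 diracE mem_set.
Qed.

(** The masses of a Poisson law of finite rate add up to 1. *)
Lemma finite_hits_ae (D : line R -> bool) : measurable_fun setT D ->
  (nu [set l | D l] < +oo)%E ->
  measurable [set w | finite_set (Pi w `&` [set l | D l])] /\
  P (~` [set w | finite_set (Pi w `&` [set l | D l])]) = 0%E.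
Proof.
move=> /measurable_set_of mD fD; have [mN hk _ _] := hPi.
have NE : [set w | finite_set (Pi w `&` [set l | D l])] =
    \bigcup_k [set w | number_in R Pi [set l | D l] w = k%:R%:E].
  apply/seteqP; split => w /=.
    move=> h; exists #|` fset_set (Pi w `&` [set l | D l])|%fset => //=.
    by rewrite /number_in /counting asboolT.
  by move=> [k _ /=]; rewrite /number_in /counting; case: ifPn => // /asboolP.
have mk k : measurable [set w | number_in R Pi [set l | D l] w = k%:R%:E].
  have := mN _ mD measurableT [set k%:R%:E]; rewrite setTI; apply.
  exact: emeasurable_set1.
have mF : measurable [set w | finite_set (Pi w `&` [set l | D l])].
  by rewrite NE; exact: bigcup_measurable.
split => //; rewrite probability_setC//.
suff -> : P [set w | finite_set (Pi w `&` [set l | D l])] = 1%E.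
  by rewrite subee.
rewrite NE measure_bigcup//; last first.
  apply/trivIsetP => i j _ _ ij; apply/seteqP; split => // w [/= -> []].
  by move/eqP; rewrite eqr_nat (negbTE ij).
rewrite (eq_eseriesr (g := fun k => poisson_prob (fine (nu [set l | D l])) 0 [set k])).
  rewrite -(probability_setT (poisson_prob (fine (nu [set l | D l])) 0)).
  rewrite -[in RHS](_ : \bigcup_k [set k] = setT); last first.
    by apply/seteqP; split => // k _; exists k.
  rewrite measure_bigcup//; apply/trivIsetP => i j _ _ ij.
  by apply/seteqP; split => // w [/= -> /eqP]; rewrite (negbTE ij).
by move=> k _; exact: (hk _ mD fD k).
Qed.

Lemma hits_ae (D : line R -> bool) : measurable_fun setT D ->
  (nu [set l | D l] = +oo)%E -> P (~` [set w | hits (Pi w) D]) = 0%E.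
Proof.
move=> mD fD; have [mN _ hoo _] := hPi; have mh := measurable_hits mD.
rewrite probability_setC//.
suff -> : P [set w | hits (Pi w) D] = 1%E by rewrite subee.
apply/le_anti; rewrite probability_le1//= -(hoo _ (measurable_set_of mD) fD).
apply: le_measure; rewrite ?inE//.
  have := mN _ (measurable_set_of mD) measurableT [set +oo%E]; rewrite setTI; apply.
  exact: emeasurable_set1.
move=> w /= h; apply: contrapT => h'.
by have /count0 := h'; rewrite h.
Qed.

End poisson.

(** * Residual curves of random states *)

Section laws.
Context {R : realType} {d} {Omega : measurableType d}.
Variables (P : probability Omega R) (Pi : Omega -> set (line R)).
Hypothesis hPi : is_poisson_process P (line_intensity R) Pi.
Notation nu := (line_intensity R).

Lemma measurable_positive : measurable_fun setT (@positive R).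
Proof.
apply: measurable_and; apply: measurable_fun_ltr => //.
  exact: measurable_height.
exact: measurable_slope.
Qed.

Lemma measurable_valid dT (T : measurableType dT) (x : T -> state R) :
  measurable_fun setT x -> measurable_fun setT (fun t => valid (x t)).
Proof.
move=> mx; have mc := measurable_intercept mx.
have mi := measurable_inclination mx; have mt := measurable_time mx.
do 3?apply: measurable_and; try exact: measurable_fun_ltr; exact: measurable_fun_ler.
Qed.

(** The region beyond a state as a countable union of rectangles of lines, each
    of which is contained in it under a condition on the state alone; [r] bounds
    the intercept of the line from above, [a] and [b] bound its intercept and
    its slope from below. This makes the residual curve of a random state
    measurable. *)
Lemma beyond_rational (x : state R) l : 0 < time x ->
  beyond x l <-> 0 < height l 0 /\ exists rab : rat * rat * rat,
    [/\ ratr rab.1.1 <= intercept x,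
        intercept x + inclination x * time x <=
          ratr rab.1.2 + ratr rab.2 * time x &
      [&& height l 0 < ratr rab.1.1, ratr rab.1.2 < height l 0 & ratr rab.2 < slope l]].
Proof.
move=> t0; split.
  move=> /and3P[h0 hc hs]; split => //.
  have [r] := rat_in_itvoo hc; rewrite in_itv/= => /andP[lr rc].
  pose eta := height l (time x) - (intercept x + inclination x * time x).
  have eta0 : 0 < eta by rewrite subr_gt0.
  have : height l 0 - eta / 2 < height l 0 by rewrite gtrBl divr_gt0.
  move=> /rat_in_itvoo[a]; rewrite in_itv/= => /andP[al la].
  have : slope l - eta / (2 * time x) < slope l by rewrite gtrBl divr_gt0// mulr_gt0.
  move=> /rat_in_itvoo[b]; rewrite in_itv/= => /andP[bl lb].
  exists (r, a, b); split => //=; [exact: ltW| |by rewrite lr la lb].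
  have : (slope l - eta / (2 * time x)) * time x <= ratr b * time x.
    by rewrite ler_wpM2r// ltW.
  rewrite mulrBl (_ : eta / (2 * time x) * time x = eta / 2); last first.
    by field; rewrite gt_eqF.
  have := heightE l (time x); rewrite /eta in al *; lra.
move=> [h0 [[[r a] b] /= [rc ab /and3P[hr ah bs]]]].
apply/and3P; split => //; first exact: lt_le_trans hr rc.
apply: (le_lt_trans ab); rewrite (heightE l (time x)).
by rewrite ltr_leD// ltW// ltr_pM2r.
Qed.

Lemma measurable_residual dT (T : measurableType dT)
    (x : T -> state R) (w : T -> Omega) :
  measurable_fun setT x -> measurable_fun setT w ->
  measurable_fun setT (fun t => residual (x t) (Pi (w t)) : paths R).
Proof.
move=> mx mw; have mc := measurable_intercept mx.
have mi := measurable_inclination mx; have mt := measurable_time mx.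
apply: measurable_into_paths => q g /andP[q0 q1].
pose B (rab : rat * rat * rat) l := [&& 0 < height l 0, height l 0 < ratr rab.1.1,
  ratr rab.1.2 < height l 0, ratr rab.2 < slope l & height l q < g].
have mB rab : measurable_fun setT (B rab).
  by do 4?apply: measurable_and; apply: measurable_fun_ltr => //;
    solve [exact: measurable_height|exact: measurable_slope].
pose hit := [set t | exists rab : rat * rat * rat,
  [/\ ratr rab.1.1 <= intercept (x t),
     intercept (x t) + inclination (x t) * time (x t) <=
          ratr rab.1.2 + ratr rab.2 * time (x t) & hits (Pi (w t)) (B rab)]].
have mhit : measurable hit.
  apply: measurable_exists => rab.
  rewrite (_ : [set t | _] = [set t | ratr rab.1.1 <= intercept (x t)] `&`
     ([set t | intercept (x t) + inclination (x t) * time (x t) <=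
          ratr rab.1.2 + ratr rab.2 * time (x t)] `&`
     w @^-1` [set w' | hits (Pi w') (B rab)])).
    apply: measurableI; first exact: measurable_ler_set.
    apply: measurableI.
      apply: measurable_ler_set; apply: measurable_funD => //;
        exact: measurable_funM.
    rewrite -[X in measurable X]setTI; apply: mw => //.
    exact: (measurable_hits hPi (mB rab)).
  by apply/seteqP; split => t /=; [case|case=> ? []].
rewrite (_ : [set t | _] = ([set t | ~~ valid (x t)] `&` [set t | g <= 0]) `|`
   ([set t | valid (x t)] `&` ([set t | g <= intercept (x t) + inclination (x t) * q]
     `&` ~` hit))).
  apply: measurableU.
    apply: measurableI; last exact: measurable_prop.
    by apply: measurable_set_of; apply: measurable_neg; exact: measurable_valid.
  apply: measurableI; first by apply: measurable_set_of; exact: measurable_valid.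
  apply: measurableI; last exact: measurableC.
  apply: measurable_ler_set => //; apply: measurable_funD => //.
  exact: measurable_funM.
apply/seteqP; split => t /=.
  have [vx|nvx] := boolP (valid (x t)); last by rewrite /residual (negbTE nvx); left.
  move=> /(ge_residual (Pi (w t)) _ vx (ltW q0))[h1 h2]; right; split => //.
  rewrite -height_pivot; split => //.
  move=> [rab [rc ab [l Pl /and5P[l0 lr al bl lg]]]].
  have /and4P[_ _ t0 _] := vx.
  have bt : beyond (x t) l.
    apply/(beyond_rational _ t0); split => //; exists rab; split => //.
    by rewrite lr al bl.
  by move: lg; rewrite ltNge h2.
case=> [[nvx g0]|[vx [h1 h2]]]; first by rewrite /residual (negbTE nvx).
apply/(ge_residual (Pi (w t)) _ vx (ltW q0)); rewrite height_pivot; split => //.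
move=> l Pl bl; rewrite leNgt; apply/negP => lg; apply: h2.
have /and4P[_ _ t0 _] := vx.
have /(beyond_rational _ t0)[l0 [rab [rc ab /and3P[lr al sl]]]] := bl.
by exists rab; split => //; exists l => //; rewrite /B l0 lr al sl lg.
Qed.

Definition good (w : Omega) : Prop :=
  locally_finite (positive_lines (Pi w)) /\
  forall e : R, 0 < e -> exists2 l, positive_lines (Pi w) l & height l 0 < e.

Lemma measurable_first_chart :
  measurable_fun setT (fun z : R * R => pivot (first_state z)).
Proof.
by apply: measurable_first_line; [exact: measurable_fst|exact: measurable_snd].
Qed.

Lemma first_void (K : seq (R * R)) : in_window K ->
  (nu [set l | positive l && below K l] < +oo)%E /\
  (expR (- fine (nu [set l | positive l && below K l])))%:E =
  (\int[exp_unif R]_z (if strip z.1 z.2 && ~~ below K (pivot (first_state z)) then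
     expR (- fine (nu [set l | beyond (first_state z) l && below K l]))
   else 0)%:E)%E.
Proof.
move=> wK; apply: (first_point_void measurable_first_chart measurable_positive).
- by move=> f mf f0; rewrite ge0_integral_quadrant.
- by move=> z l sz; apply: beyond_positive; exact: valid_first.
- by move=> z z'; exact: first_later.
- by move=> z; exact: first_bounded.
Qed.

Lemma measurable_step_chart (x : state R) :
  measurable_fun setT (fun z : R * R => pivot (step_state x z)).
Proof.
apply: (@measurable_step_line _ (intercept x) (inclination x) (time x));
  [exact: measurable_fst|exact: measurable_snd].
Qed.

Lemma beyond_trans (x : state R) z l : valid x -> strip z.1 z.2 ->
  beyond (step_state x z) l -> beyond x l.
Proof.
move=> vx sz bl; have := beyond_steeper (valid_step vx sz) bl.
have /and3P[h0 hc hs] := bl.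
have /andP[i0 i1] := step_lower vx sz; have /andP[t0 ts] := step_time vx sz.
have st := step_steeper vx sz; have := step_meet vx sz; rewrite !height_pivot.
move=> meet sl; apply/and3P; split => //; first exact: lt_trans i1.
move: hs; rewrite meet !(heightE l (time _)).
by move: (step_state x z) st t0 ts sl {meet} => y; nra.
Qed.

Lemma step_void (x : state R) (K : seq (R * R)) : valid x -> in_window K ->
  ~~ below K (pivot x) ->
  (nu [set l | beyond x l && below K l] < +oo)%E /\
  (expR (- fine (nu [set l | beyond x l && below K l])))%:E =
  (\int[exp_unif R]_z (if strip z.1 z.2 && ~~ below K (pivot (step_state x z)) then
     expR (- fine (nu [set l | beyond (step_state x z) l && below K l]))
   else 0)%:E)%E.
Proof.
move=> vx wK nK; have /and4P[c0 m0 s0 s1] := vx.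
apply: (first_point_void (measurable_step_chart x) (measurable_ahead _ _ _)).
- by move=> f mf f0; rewrite ge0_integral_ahead.
- by move=> z l sz; exact: beyond_trans.
- by move=> z z'; exact: step_later.
- by move=> z; exact: step_bounded.
Qed.

End laws.

(** * Almost sure properties of the lines *)

Section good_event.
Context {R : realType} {d} {Omega : measurableType d}.
Variables (P : probability Omega R) (Pi : Omega -> set (line R)).
Hypothesis hPi : is_poisson_process P (line_intensity R) Pi.
Notation nu := (line_intensity R).
Notation leb := (@lebesgue_measure R).

Let box (j : nat) (l : line R) := positive l && below [:: (j.+1%:R^-1, j.+1%:R)] l.
Let thin (j : nat) (l : line R) := positive l && (height l 0 < j.+1%:R^-1).

Let mbox j : measurable_fun setT (box j).
Proof.
by apply: measurable_and; [exact: measurable_positive|exact: measurable_below].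
Qed.

Let mthin j : measurable_fun setT (thin j).
Proof.
apply: measurable_and; first exact: measurable_positive.
by apply: measurable_fun_ltr => //; exact: measurable_height.
Qed.

Let box_fin j : (nu [set l | box j l] < +oo)%E.
Proof.
have w : in_window [:: ((j.+1%:R : R)^-1, j.+1%:R : R)].
  move=> qg; rewrite inE => /eqP ->/=.
  by rewrite invr_gt0 ltr0n/= invf_le1 ?ltr0n// ler1n.
by have [] := first_void w.
Qed.

Let thin_inf j : nu [set l | thin j l] = +oo%E.
Proof.
have mt : measurable [set l | thin j l] := measurable_set_of (mthin j).
have j0 : 0 < (j.+1%:R : R)^-1 by rewrite invr_gt0.
pose f (l : line R) : \bar R := if thin j l then 1%E else 0%E.
have mf : measurable_fun setT f by exact: measurable_fun_ifT.
have f0 l : (0 <= f l)%E by rewrite /f; case: ifP.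
transitivity (\int[nu]_l f l)%E.
  transitivity (\int[nu]_l (\1_[set l | thin j l] l)%:E)%E.
    by rewrite integral_indicT.
  apply: eq_integral => l _; rewrite indicE /f.
  by rewrite (_ : (l \in _) = thin j l); [case: thin|apply/idP/idP; rewrite inE].
rewrite ge0_integral_line//.
have inner c : (\int[leb]_m f (mkline c m) =
    (if (0 < c < j.+1%:R^-1)%R then +oo else 0))%E.
  case: ifP => hc; last first.
    rewrite integral0_eq// => m _; rewrite /f /thin /positive.
    rewrite height_mkline mulr0 addr0 slope_mkline.
    by case: (0 < c) hc => //= ->; rewrite andbF.
  transitivity (\int[leb]_(m in [set` `]0%R, +oo[%R]) (cst 1%E m))%E.
    rewrite [RHS]integral_mkcond; apply: eq_integral => m _; rewrite patchE /f /thin /positive.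
    rewrite height_mkline mulr0 addr0 slope_mkline.
    case/andP: hc => -> ->; rewrite andbT/=.
    by rewrite (_ : (m \in _) = (0 < m)) //; apply/idP/idP; rewrite inE/= in_itv/= andbT.
  rewrite integral_cst//.
  by rewrite mul1e [LHS](lebesgue_measure_itv `]0, +oo[%R)/= ltry.
under eq_integral do rewrite inner.
rewrite (_ : (\int[leb]_x _)%E = +oo%E); first by rewrite gt0_muley// lte_fin.
transitivity (\int[leb]_(c in [set` `]0%R, ((j.+1%:R : R)^-1)%R[%R]) (cst +oo%E c))%E.
  rewrite [RHS]integral_mkcond; apply: eq_integral => c _; rewrite patchE.
  rewrite (_ : (c \in _) = (0 < c < j.+1%:R^-1)) //.
  by apply/idP/idP; rewrite inE/= in_itv.
rewrite integral_cst//.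
rewrite [X in (_ * X)%E](lebesgue_measure_itv `]0, (j.+1%:R : R)^-1[%R)/= lte_fin j0.
by rewrite oppr0 adde0 gt0_mulye// lte_fin.
Qed.

(** The lines passing below a target have finite intensity by [first_void],
    whereas those whose intercept lies in an interval (0, epsilon) have infinite
    intensity, their slopes being arbitrary; countably many targets and
    intervals suffice. *)
Lemma good_event : exists G : set Omega,
  [/\ measurable G, P (~` G) = 0%E & forall w, G w -> good Pi w].
Proof.
pose A j := [set w | finite_set (Pi w `&` [set l | box j l])].
pose B j := [set w | hits (Pi w) (thin j)].
have hA j := finite_hits_ae hPi (mbox j) (box_fin j).
have mA j : measurable (A j) := (hA j).1.
have mB j : measurable (B j) := measurable_hits hPi (mthin j).
exists (\bigcap_j (A j `&` B j)); split.
- by apply: bigcap_measurableType => j _; exact: measurableI.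
- rewrite setC_bigcap.
  apply/eqP; rewrite eq_le measure_ge0 andbT.
  apply: (le_trans (@measure_sigma_subadditive _ _ _ P _ (fun j => ~` (A j `&` B j)) _ _ _)) => //.
  + by move=> j; apply: measurableC; exact: measurableI.
  + by apply: bigcup_measurable => j _; apply: measurableC; exact: measurableI.
  rewrite eseries0// => j _ _; rewrite setCI.
  apply/eqP; rewrite eq_le measure_ge0 andbT.
  apply: (le_trans (measureU2 _ _ _)); try exact: measurableC.
  have hA2 : P (~` A j) = 0%E := (hA j).2.
  have hB2 : P (~` B j) = 0%E := hits_ae hPi (mthin j) (thin_inf j).
  by rewrite [X in (_ <= X)%E](_ : _ = (P (~` A j) + P (~` B j))%E)// hA2 hB2 adde0.
move=> w Gw; split.
  move=> s g s0.
  have [n [sn gn]] : exists n : nat, (n.+1%:R : R)^-1 <= s /\ g < n.+1%:R.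
    pose n := maxn (Num.truncn s^-1) (Num.truncn g).
    have h1 : s^-1 < n.+1%:R.
      apply: (lt_le_trans (Num.Theory.truncnS_gt _)).
      by rewrite ler_nat ltnS leq_maxl.
    have h2 : g < n.+1%:R.
      apply: (lt_le_trans (Num.Theory.truncnS_gt _)).
      by rewrite ler_nat ltnS leq_maxr.
    exists n; split => //; rewrite -[leRHS]invrK lef_pV2 ?posrE ?invr_gt0//.
    exact: ltW.
  have [fin _] := Gw n I.
  apply: sub_finite_set fin => l []; rewrite positive_linesE => -[Pl pl] lg.
  split => //=; rewrite /box pl/= orbF; apply: le_lt_trans gn.
  apply: le_trans lg; rewrite heightE (heightE l s) lerD2l.
  by case/andP: pl => _ m0; rewrite ler_wpM2l// ltW.
move=> e e0; pose n := Num.truncn e^-1.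
have [_ [l Pl /andP[pl ln]]] := Gw n I.
exists l; first by rewrite positive_linesE.
apply: (lt_le_trans ln); rewrite -[leRHS]invrK lef_pV2 ?posrE ?invr_gt0//.
exact/ltW/Num.Theory.truncnS_gt.
Qed.

End good_event.

(** * The law of a step *)

Lemma same_probability {R : realType} {d} {T : measurableType d}
    (P : probability T R) (A B G : set T) : measurable A -> measurable B ->
  measurable G -> P (~` G) = 0%E -> (forall w, G w -> A w <-> B w) -> P A = P B.
Proof.
move=> mA mB mG G0 AB.
have red C : measurable C -> P C = P (C `&` G).
  move=> mC; rewrite -[in LHS](setIT C) -(setUv G) setIUr measureU.
  - rewrite [X in (_ + X)%E](_ : _ = 0%E) ?adde0//.
    apply/eqP; rewrite eq_le measure_ge0 andbT -G0 le_measure ?inE//.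
      by apply: measurableI => //; exact: measurableC.
    exact: measurableC.
  - exact: measurableI.
  - by apply: measurableI => //; exact: measurableC.
  - by apply/seteqP; split => // t [[_ h] [_ h']].
rewrite (red A)// (red B)//; congr (P _).
by apply/seteqP; split => w [h Gw]; split => //; apply/AB.
Qed.

Section resampling.
Context {R : realType} {d} {Omega : measurableType d}.
Variables (P : probability Omega R) (Pi : Omega -> set (line R)).
Hypothesis hPi : is_poisson_process P (line_intensity R) Pi.
Notation nu := (line_intensity R).

Definition in_strip : set (measurableTypeR R * measurableTypeR R) :=
  [set z | strip z.1 z.2].

Lemma measurable_in_strip : measurable in_strip.
Proof.
by apply: measurable_set_of; apply: measurable_strip; [exact: measurable_fst|exact: measurable_snd].
Qed.

Lemma exp_unif_strip : exp_unif R (~` in_strip) = 0%E.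
Proof.
have mC : measurable (~` in_strip) by apply: measurableC; exact: measurable_in_strip.
rewrite -(integral_indicT (exp_unif R) mC).
rewrite ge0_integral_exp_unif//; last by apply/measurable_EFinP; exact: measurable_indic.
rewrite integral0_eq// => e _; rewrite integral0_eq// => u _.
by case: ifP => // seu; rewrite indicE memNset ?mule0.
Qed.

Let PT0 : P (~` setT) = 0%E.
Proof. by rewrite setCT measure0. Qed.

Notation Q := (exp_unif R \x P)%E.

Lemma resample_ae (A B : set ((measurableTypeR R * measurableTypeR R) * Omega))
    (G : set Omega) :
  measurable A -> measurable B -> measurable G -> P (~` G) = 0%E ->
  (forall z w, in_strip z -> G w -> A (z, w) <-> B (z, w)) -> Q A = Q B.
Proof.
move=> mA mB mG G0 AB.
have mS := measurable_in_strip.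
apply: (@same_probability _ _ _ (exp_unif R \x P)%E A B (in_strip `*` G)) => //.
- exact: measurableX.
- have one dT (T : measurableType dT) (m : probability T R) (C : set T) :
      measurable C -> m (~` C) = 0%E -> m C = 1%E.
    move=> mC C0; rewrite -(setCK C) probability_setC ?C0 ?sube0//.
    exact: measurableC.
  rewrite probability_setC; last exact: measurableX.
  rewrite [X in (_ - X)%E](_ : _ = (exp_unif R in_strip * P G)%E); last first.
    exact: product_measure1E.
  rewrite [X in (X * _)%E](_ : _ = 1%E); last first.
    by apply: one => //; exact: exp_unif_strip.
  by rewrite [X in (_ * X)%E](_ : _ = 1%E) ?mule1 ?subee//; exact: one.
- by move=> [z w] [/= sz Gw]; exact: AB.
Qed.

Lemma resampleE (A : set ((measurableTypeR R * measurableTypeR R) * Omega)) :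
  Q A = (\int[exp_unif R]_z P (xsection A z))%E.
Proof. by []. Qed.

(** The curve when the next state is drawn from [z] and completed with the lines
    of [w]; both factors are independent under [Q]. *)
Definition step_curve (x : state R)
    (zw : (measurableTypeR R * measurableTypeR R) * Omega) : R -> R :=
  fun q => if strip zw.1.1 zw.1.2 then
     Num.min (height (pivot x) q) (residual (step_state x zw.1) (Pi zw.2) q)
   else 0.

Definition first_curve (zw : (measurableTypeR R * measurableTypeR R) * Omega) :
  R -> R := residual (first_state zw.1) (Pi zw.2).

Lemma measurable_step_state (x : state R) :
  measurable_fun setT (step_state x).
Proof.
have m2 : measurable_fun setT (fun z : R * R => Num.sqrt z.2).
  by apply: measurable_sqrtr; exact: measurable_snd.
have mt : measurable_fun setT
   (fun z : R * R => (time x)^-1 + 4 / intercept x ^+ 2 * z.1).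
  by apply: measurable_funD => //; apply: measurable_funM => //; exact: measurable_fst.
apply: measurable_fun_pair; last exact: measurable_funV.
apply: measurable_fun_pair.
  by apply: measurable_funM => //; exact: measurable_funB.
apply: measurable_funD => //; apply: measurable_funM => //.
exact: measurable_funM.
Qed.

Lemma measurable_first_state : measurable_fun setT (@first_state R).
Proof.
have m1 : measurable_fun setT (fun z : R * R => Num.sqrt z.1).
  by apply: measurable_sqrtr; exact: measurable_fst.
have m2 : measurable_fun setT (fun z : R * R => z.2) by exact: measurable_snd.
apply: measurable_fun_pair => //; apply: measurable_fun_pair.
  by apply: measurable_funM; [exact: measurable_funM|exact: measurable_funB].
by apply: measurable_funM => //; exact: measurable_funM.
Qed.

Lemma measurable_first_curve :
  measurable_fun setT (first_curve : _ -> paths R).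
Proof.
apply: (measurable_residual hPi); last exact: measurable_snd.
exact: (measurableT_comp measurable_first_state measurable_fst).
Qed.

Lemma measurable_step_residual (x : state R) :
  measurable_fun setT (fun zw : (measurableTypeR R * measurableTypeR R) * Omega =>
    residual (step_state x zw.1) (Pi zw.2) : paths R).
Proof.
apply: (measurable_residual hPi); last exact: measurable_snd.
exact: (measurableT_comp (measurable_step_state x) measurable_fst).
Qed.

Lemma measurable_step_curve (x : state R) :
  measurable_fun setT (step_curve x : _ -> paths R).
Proof.
apply: measurable_into_paths => q g q01; apply: measurable_ler_set => //.
apply: measurable_fun_ifT => //.
  apply: (@measurable_strip R _ _ (fst \o fst) (snd \o fst)).
    exact: (measurableT_comp measurable_fst measurable_fst).
  exact: (measurableT_comp measurable_snd measurable_fst).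
apply: measurable_minr => //.
exact: (measurableT_comp (measurable_eval q01) (measurable_step_residual x)).
Qed.

Let strip_law (W : (measurableTypeR R * measurableTypeR R) * Omega -> paths R)
    (A : set (paths R)) : measurable_fun setT W -> measurable A ->
  Q [set zw | A (W zw)] =
  (\int[exp_unif R]_z (if strip z.1 z.2 then P [set w | A (W (z, w))] else 0))%E.
Proof.
move=> mW mA; have mWA : measurable [set zw | A (W zw)].
  by rewrite -[X in measurable X]setTI; exact: mW.
pose B := (in_strip `*` setT) `&` [set zw | A (W zw)].
rewrite (resample_ae (B := B) mWA _ measurableT PT0); last 2 first.
- by apply: measurableI => //; apply: measurableX => //; exact: measurable_in_strip.
- by move=> z w sz _; split => [AW|[]]; [split|].
rewrite resampleE; apply: eq_integral => z _; case: ifPn => sz.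
  congr (P _); apply/seteqP; split => w; rewrite /xsection/= inE; first by case.
  by move=> h; split.
rewrite (_ : xsection _ _ = set0) ?measure0//.
apply/seteqP; split => // w; rewrite /xsection/= inE => -[[sz' _] _].
by move: sz; rewrite sz'.
Qed.

Let mbeyond (x : state R) K : measurable_fun setT
  (fun l => beyond x l && below K l).
Proof.
by apply: measurable_and; [exact: measurable_ahead|exact: measurable_below].
Qed.

Lemma residual_void (x : state R) K : valid x -> in_window K ->
  P [set w | cylinder K (residual x (Pi w))] =
  (if ~~ below K (pivot x) then
     expR (- fine (nu [set l | beyond x l && below K l])) else 0)%:E.
Proof.
move=> vx wK; case: ifPn => [nK|/negPn bK]; last first.
  rewrite (_ : [set w | _] = set0) ?measure0//; apply/seteqP; split => // w /=.
  by move=> /(residual_cylinder _ vx wK)[]; rewrite bK.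
have [fin _] := step_void vx wK nK.
rewrite -(void_probability hPi (mbeyond x K) fin); congr (P _).
apply/seteqP; split => w /=; first by move=> /(residual_cylinder _ vx wK)[].
by move=> h; apply/(residual_cylinder _ vx wK).
Qed.

(** One step of the sweep. By [path_law_unique] only cylinders need to be
    compared: on the left their probability is a void probability, on the right
    it is an integral of void probabilities beyond the new state, and
    [step_void] says that the two agree. *)
Lemma step_law (x : state R) : valid x ->
  forall A : set (paths R), measurable A ->
  P [set w | A (residual x (Pi w))] = Q [set zw | A (step_curve x zw)].
Proof.
move=> vx A mA.
have mr : measurable_fun setT (fun w => residual x (Pi w) : paths R).
  exact: (measurable_residual hPi).
have mW := measurable_step_curve x.
rewrite -[LHS]/(image_measure P mr A) -[RHS]/(image_measure Q mW A).
apply: path_law_unique => //.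
  by rewrite /image_measure/= /pushforward preimage_setT probability_setT ltry.
move=> K wK; rewrite /image_measure/= /pushforward [LHS](residual_void vx wK).
have mcK : measurable (cylinder K : set (paths R)).
  by apply: sub_sigma_algebra; exists K.
transitivity (\int[exp_unif R]_z (if strip z.1 z.2 then
    P [set w | cylinder K (step_curve x (z, w))] else 0))%E; last first.
  by rewrite -(strip_law mW mcK).
have [nK|/negPn bK] := ifPn; last first.
  rewrite integral0_eq// => z _; case: ifPn => // sz.
  rewrite (_ : [set w | _] = set0) ?measure0//.
  apply/seteqP; split => // w h.
  move: bK => /hasP[qg qgK]; rewrite ltNge => /negP; apply.
  by have := h _ qgK; rewrite /step_curve sz/= le_min => /andP[].
have [_ ->] := step_void vx wK nK.
apply: eq_integral => z _; have [sz|//] := boolP (strip z.1 z.2).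
rewrite -(residual_void (valid_step vx sz) wK); congr (P _).
apply/seteqP; split => w h qg qgK.
  rewrite /step_curve/= sz le_min; apply/andP; split; last exact: h.
  by rewrite leNgt; exact: (hasPn nK).
by have := h _ qgK; rewrite /step_curve/= sz le_min => /andP[].
Qed.

Lemma measurable_seminal :
  measurable_fun setT (fun w => seminal_curve (Pi w) : paths R).
Proof.
apply: measurable_into_paths => q g /andP[q0 q1].
pose D l := positive l && below [:: (q, g)] l.
have mD : measurable_fun setT D.
  by apply: measurable_and; [exact: measurable_positive|exact: measurable_below].
have mh1 := measurable_hits hPi (@measurable_positive R).
have mh2 := measurable_hits hPi mD.
rewrite (_ : [set w | _] =
   (~` [set w | hits (Pi w) positive] `&` [set w | g <= 0]) `|`
   ([set w | hits (Pi w) positive] `&` ~` [set w | hits (Pi w) D])).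
  apply: measurableU; apply: measurableI => //; first exact: measurableC.
    exact: measurable_prop.
  exact: measurableC.
have wK : in_window [:: (q, g)] by move=> qg; rewrite inE => /eqP ->; rewrite q0.
have cE p : cylinder [:: (q, g)] p <-> g <= p q.
  split; first by move=> h; exact: (h (q, g) (mem_head _ _)).
  by move=> h qg; rewrite inE => /eqP ->.
apply/seteqP; split => w /=.
  have [h|h] := pselect (hits (Pi w) positive); last first.
    rewrite /seminal_curve (_ : positive_lines (Pi w) = set0).
      by rewrite image_set0 inf0; left.
    apply/seteqP; split => // l; rewrite positive_linesE => -[Pl pl].
    by apply: h; exists l.
  have ne : positive_lines (Pi w) !=set0.
    by case: h => l Pl pl; exists l; rewrite positive_linesE.
  by move=> /cE/(seminal_cylinder ne wK) h2; right.
case=> [[h g0]|[[l Pl pl] h2]].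
  rewrite /seminal_curve (_ : positive_lines (Pi w) = set0).
    by rewrite image_set0 inf0.
  apply/seteqP; split => // l; rewrite positive_linesE => -[Pl pl].
  by apply: h; exists l.
apply/cE/(seminal_cylinder _ wK) => //.
by exists l; rewrite positive_linesE.
Qed.

(** The same comparison with [first_void]. The seminal curve of an empty set of
    lines is 0 and not infinite, so the good event is needed here. *)
Lemma first_law (A : set (paths R)) : measurable A ->
  P [set w | A (seminal_curve (Pi w))] = Q [set zw | A (first_curve zw)].
Proof.
move=> mA; have mW := measurable_first_curve.
rewrite -[LHS]/(image_measure P measurable_seminal A) -[RHS]/(image_measure Q mW A).
apply: path_law_unique => //.
  by rewrite /image_measure/= /pushforward preimage_setT probability_setT ltry.
move=> K wK; rewrite /image_measure/= /pushforward.
have mcK : measurable (cylinder K : set (paths R)).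
  by apply: sub_sigma_algebra; exists K.
have mD : measurable_fun setT (fun l : line R => positive l && below K l).
  by apply: measurable_and; [exact: measurable_positive|exact: measurable_below].
have [fin voidE] := first_void wK.
transitivity (P [set w | ~ hits (Pi w) (fun l => positive l && below K l)]).
  have [G [mG G0 Gw]] := good_event hPi.
  apply: (same_probability _ _ mG G0).
  - by rewrite -[X in measurable X]setTI; exact: measurable_seminal.
  - by apply: measurableC; exact: (measurable_hits hPi mD).
  - move=> w /Gw[_ small]; have [l Ll _] := small 1 ltr01.
    by apply: seminal_cylinder => //; exists l.
rewrite (void_probability hPi mD fin) voidE.
transitivity (\int[exp_unif R]_z (if strip z.1 z.2 then
    P [set w | cylinder K (first_curve (z, w))] else 0))%E; last first.
  by rewrite -(strip_law mW mcK).
apply: eq_integral => z _; have [sz|//] := boolP (strip z.1 z.2).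
by rewrite -(residual_void (valid_first sz) wK).
Qed.

End resampling.

(** * Independence of the increments *)

Section recovery.
Context {R : realType}.
Implicit Types (x : state R) (L : set (line R)) (z : R * R).

Lemma residual_le x L q : valid x -> 0 <= q -> residual x L q <= height (pivot x) q.
Proof.
move=> vx q0; rewrite /residual vx; apply: envelope_le => //.
  exact: upward_family.
by left.
Qed.

Lemma residual_secant x L q r : valid x -> 0 <= q -> q <= r -> r <= time x ->
  inclination x * (r - q) <= residual x L r - residual x L q.
Proof.
move=> vx q0 qr rt; rewrite /residual vx -slope_pivot.
apply: (@envelope_secant _ (family x L) (upward_family vx) _ (time x)) => //.
exact: family_touches.
Qed.

Lemma residual_germ x L : valid x -> locally_finite (positive_lines L) ->
  exists2 r, 0 < r < time x &
    forall q, r <= q <= time x -> residual x L q = height (pivot x) q.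
Proof.
move=> vx fL; rewrite /residual vx.
have /and4P[_ _ t0 _] := vx.
apply: envelope_germ => //; [exact: upward_family|exact: family_locally_finite|].
exact: family_touches.
Qed.

(** [next_eq] applies because the new residual curve lies below its pivot and
    coincides with it just before the new time, at which the two pivots cross. *)
Lemma recover_step x z L p : valid x -> strip z.1 z.2 ->
  locally_finite (positive_lines L) ->
  (forall q, p q = Num.min (height (pivot x) q) (residual (step_state x z) L q)) ->
  [/\ next x p = step_state x z, coords x p = z &
    forall q, 0 < q -> q < time (step_state x z) -> p q = residual (step_state x z) L q].
Proof.
move=> vx sz fL pE; set y := step_state x z.
have vy : valid y by exact: valid_step.
have /andP[t0 ts] := step_time vx sz; have st := step_steeper vx sz.
have meet := step_meet vx sz; rewrite !height_pivot -/y in meet t0 ts st.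
have /and4P[c0 m0 s0 s1] := vx.
have pr q : 0 < q -> q < time y -> p q = residual y L q.
  move=> q0 qt; rewrite pE min_r//; apply: (le_trans (residual_le _ vy (ltW q0))).
  by rewrite !height_pivot; move: y {vy pE} t0 ts st meet qt => y *; nra.
have [] := @next_eq _ x p (intercept y) (inclination y) (time y).
- exact: t0.
- exact: ltW (lt_le_trans ts s1).
- exact: ltW.
- exact: st.
- by rewrite meet.
- move=> q tq qs; rewrite pE height_pivot le_min lexx/=.
  have q0 : 0 <= q by apply: le_trans tq; exact: ltW.
  apply/(ge_residual L _ vy q0); rewrite height_pivot; split.
    by move: y {vy pE pr} t0 ts st meet tq => y *; nra.
  move=> l _ bl; have sl := beyond_steeper vy bl.
  have /and3P[_ _] := bl; rewrite meet (heightE l (time y)) (heightE l q).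
  by move: y {vy pE pr bl} t0 ts st meet tq sl => y *; nra.
- move=> q q0 qt; rewrite pr// -height_pivot.
  exact: (residual_le _ vy (ltW q0)).
- move=> q r q0 qr rt; rewrite (pr _ q0 (lt_trans qr rt)) (pr _ (lt_trans q0 qr) rt).
  exact: (residual_secant _ vy (ltW q0) (ltW qr) (ltW rt)).
- have [e /andP[e0 et] germ] := residual_germ vy fL.
  exists e; first by rewrite e0.
  move=> q eq qt; rewrite (pr _ (lt_le_trans e0 eq) qt) germ ?eq ?(ltW qt)//.
  exact: height_pivot.
move=> kE tE nE; split => //.
rewrite /coords kE tE; have /and3P[e0 u0 u1] := sz.
have -> : z = (z.1, z.2) by case: (z).
rewrite /y; set t := (time x)^-1 + 4 / intercept x ^+ 2 * z.1.
have -> : time (step_state x z) = t^-1 by [].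
have -> : inclination (step_state x z) = inclination x + intercept x * Num.sqrt z.2 * t.
  by [].
have tpos : 0 < t.
  by rewrite (lt_trans _ (step_time_gt0 vx sz))// invr_gt0.
congr pair.
  by rewrite invrK /t; field; rewrite !gt_eqF.
rewrite (_ : _ / _ = Num.sqrt z.2); first by rewrite sqr_sqrtr// ltW.
by field; rewrite !gt_eqF.
Qed.

Definition start (p : R -> R) : state R :=
  (p 1 - tangent 0 1 p, tangent 0 1 p, 1).

(** Inverse of the parametrization [first_line], read on the curve. *)
Definition start_coords (p : R -> R) : R * R :=
  (p 1 ^+ 2 / 4, tangent 0 1 p / p 1).

Lemma recover_start z L : strip z.1 z.2 -> locally_finite (positive_lines L) ->
  start (residual (first_state z) L) = first_state z /\
  start_coords (residual (first_state z) L) = z.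
Proof.
move=> sz fL; set y := first_state z; set p := residual y L.
have vy : valid y by exact: valid_first.
have /and4P[c0 m0 _ _] := vy.
have ty : time y = 1 by [].
have [r /andP[r0 rt] rE] := residual_germ vy fL; rewrite ty in rt rE.
have p1 : p 1 = intercept y + inclination y.
  rewrite /p rE; first by rewrite height_pivot mulr1.
  by apply/andP; split; [exact: ltW|].
have tE : tangent 0 1 p = inclination y.
  apply: (@tangent_eq _ _ _ (intercept y)) => //.
    by move=> q s q0 qs s1; apply: residual_secant => //; exact: ltW.
  exists r; first by rewrite r0.
  move=> q rq q1; rewrite /p rE; first by rewrite height_pivot.
  by rewrite rq ltW.
rewrite /start /start_coords tE p1; split.
  by rewrite addrK.
have /and3P[e0 u0 u1] := sz.
have g0 : 0 < Num.sqrt z.1 by rewrite sqrtr_gt0.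
rewrite /y /first_state /intercept /inclination/=.
rewrite (_ : _ + _ = 2 * Num.sqrt z.1); last by ring.
rewrite (_ : (2 * Num.sqrt z.1) ^+ 2 / 4 = Num.sqrt z.1 ^+ 2); last by field.
rewrite sqr_sqrtr ?ltW// (_ : _ / _ = z.2); first by case: (z).
by field; rewrite gt_eqF.
Qed.

Lemma measurable_start d (T : measurableType d) (p : T -> paths R) :
  measurable_fun setT p -> measurable_fun setT (fun t => start (p t)).
Proof.
move=> mp; have mt : measurable_fun setT (fun t => tangent 0 1 (p t)).
  exact: (measurable_tangent mp).
have m1 : measurable_fun setT (fun t => p t 1).
  have h1 : 0 < (1 : R) <= 1 by rewrite ltr01 lexx.
  exact: (measurableT_comp (measurable_eval h1) mp).
apply: measurable_fun_pair => //; apply: measurable_fun_pair => //.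
exact: measurable_funB.
Qed.

Lemma measurable_start_coords d (T : measurableType d) (p : T -> paths R) :
  measurable_fun setT p -> measurable_fun setT (fun t => start_coords (p t)).
Proof.
move=> mp; have mt : measurable_fun setT (fun t => tangent 0 1 (p t)).
  exact: (measurable_tangent mp).
have m1 : measurable_fun setT (fun t => p t 1).
  have h1 : 0 < (1 : R) <= 1 by rewrite ltr01 lexx.
  exact: (measurableT_comp (measurable_eval h1) mp).
apply: measurable_fun_pair.
  by apply: measurable_funM => //; exact: measurable_funX.
by apply: measurable_funM => //; exact: measurable_funV.
Qed.

End recovery.

Section independence_of_increments.
Context {R : realType} {d} {Omega : measurableType d}.
Variables (P : probability Omega R) (Pi : Omega -> set (line R)).
Hypothesis hPi : is_poisson_process P (line_intensity R) Pi.
Notation Q := (exp_unif R \x P)%E.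
Notation pairT := (measurableTypeR R * measurableTypeR R)%type.

Let measurable_cap dT (T : measurableType dT) (f : nat -> T -> pairT)
    (B : nat -> set pairT) n : (forall i, measurable_fun setT (f i)) ->
  (forall i, measurable (B i)) ->
  measurable [set t | forall i, (i < n)%N -> B i (f i t)].
Proof.
move=> mf mB; rewrite (_ : [set t | _] = \bigcap_(i in `I_n) (f i @^-1` B i)).
  apply: bigcap_measurableType => i _.
  by rewrite -[X in measurable X]setTI; exact: mf.
by apply/seteqP; split => t /=.
Qed.

(** Fubini: for each drawn [z], the law of what the residual curve says about
    later steps is the same product, so it factors out of the integral. *)
Let resample_product (y : pairT -> state R) (B0 : set pairT)
    (B : nat -> set pairT) (n : nat) (W : pairT * Omega -> paths R)
    (A : set (paths R)) (G : set Omega) :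
  measurable_fun setT y -> measurable_fun setT W -> measurable A ->
  measurable B0 -> (forall i, measurable (B i)) ->
  measurable G -> P (~` G) = 0%E ->
  (forall z w, in_strip z -> G w -> A (W (z, w)) <->
    (B0 z /\ forall i, (i < n)%N ->
       B i (increment (y z) (residual (y z) (Pi w)) i))) ->
  (forall z, in_strip z ->
    P [set w | forall i, (i < n)%N ->
       B i (increment (y z) (residual (y z) (Pi w)) i)] =
    (\prod_(i < n) exp_unif R (B i))%E) ->
  Q [set zw | A (W zw)] = (exp_unif R B0 * \prod_(i < n) exp_unif R (B i))%E.
Proof.
move=> my mW mA mB0 mB mG G0 AB ih.
have mr : measurable_fun setT
    (fun zw : pairT * Omega => residual (y zw.1) (Pi zw.2) : paths R).
  apply: (measurable_residual hPi); last exact: measurable_snd.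
  exact: (measurableT_comp my measurable_fst).
have my1 : measurable_fun setT (fun zw : pairT * Omega => y zw.1).
  exact: (measurableT_comp my measurable_fst).
pose C := (B0 `&` in_strip) `*` setT `&` [set zw : pairT * Omega |
  forall i, (i < n)%N -> B i (increment (y zw.1) (residual (y zw.1) (Pi zw.2)) i)].
have mS := @measurable_in_strip R.
have mC : measurable C.
  apply: measurableI; first by apply: measurableX => //; exact: measurableI.
  by apply: measurable_cap => // i; exact: measurable_increment.
rewrite (@resample_ae _ _ _ P _ C G)//; last 2 first.
- by rewrite -[X in measurable X]setTI; exact: mW.
- move=> z w sz Gw; split.
    by move=> /(AB z w sz Gw)[b0 b]; split.
  by move=> [[[b0 _] _] b]; apply/(AB z w sz Gw).
rewrite resampleE.
set c := (\prod_(i < n) _)%E.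
have c0 : (0 <= c)%E by apply: prode_ge0 => i _; exact: measure_ge0.
transitivity (\int[exp_unif R]_z (c * (\1_(B0 `&` in_strip) z)%:E))%E.
  apply: eq_integral => z _; rewrite indicE.
  have [/set_mem[b0 sz]|nz] := boolP (z \in B0 `&` in_strip).
    rewrite mule1 /c -(ih z sz); congr (P _).
    apply/seteqP; split => w; rewrite /xsection/= inE; first by case.
    by move=> h; split.
  rewrite mule0 (_ : xsection _ _ = set0) ?measure0//.
  apply/seteqP; split => // w; rewrite /xsection/= inE => -[[h _] _].
  by move: nz; rewrite mem_set.
rewrite ge0_integralZl//; last first.
  by apply/measurable_EFinP; apply: measurable_indic; exact: measurableI.
rewrite [X in (_ * X)%E](integral_indicT (exp_unif R)); last exact: measurableI.
rewrite [LHS]muleC; congr (_ * c)%E.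
apply: (@same_probability _ _ _ (exp_unif R) _ _ in_strip) => //.
- exact: measurableI.
- exact: exp_unif_strip.
- by move=> z sz; split => [[]|].
Qed.

(** Induction on the number of steps, for all states at once: the product law
    of the later increments does not depend on the new state. *)
Lemma increments_law n (x : state R) (B : nat -> set pairT) :
  valid x -> (forall i, measurable (B i)) ->
  P [set w | forall i, (i < n)%N -> B i (increment x (residual x (Pi w)) i)] =
  (\prod_(i < n) exp_unif R (B i))%E.
Proof.
elim: n x B => [|n ih] x B vx mB.
  rewrite big_ord0 (_ : [set w | _] = setT) ?probability_setT//.
  by apply/seteqP; split.
pose A : set (paths R) :=
  [set p | forall i, (i < n.+1)%N -> B i (increment x p i)].
have mA : measurable A.
  apply: measurable_cap => // i.
  exact: (@measurable_increment _ _ (paths R) (cst x) id).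
have [G [mG G0 Gw]] := good_event hPi.
rewrite [LHS](step_law hPi vx mA) big_ord_recl.
apply: (resample_product (measurable_step_state x) (measurable_step_curve hPi x) mA
   (mB 0%N) (fun i => mB i.+1) mG G0).
  move=> z w sz /Gw[fL _].
  have [|nE cE pE] := @recover_step _ x z (Pi w) (step_curve Pi x (z, w)) vx sz fL.
    by move=> q; rewrite /step_curve/= (sz : is_true (strip _ _)).
  have incE i : increment x (step_curve Pi x (z, w)) i.+1 =
      increment (step_state x z) (residual (step_state x z) (Pi w)) i.
    rewrite incrementS nE; apply: increment_local => //.
    by have /andP[/ltW] := step_time vx sz.
  have inc0 : increment x (step_curve Pi x (z, w)) 0 = z by exact: cE.
  split.
    move=> h; split; first by have := h 0%N (ltn0Sn n); rewrite inc0.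
    by move=> i ilt; rewrite -incE; exact: h.
  move=> [h0 h] [|i] ilt; first by rewrite inc0.
  by rewrite incE; exact: h.
by move=> z sz; rewrite (ih (step_state x z) (fun i => B i.+1))//; exact: valid_step.
Qed.

Lemma start_law n (B0 : set pairT) (B : nat -> set pairT) :
  measurable B0 -> (forall i, measurable (B i)) ->
  P [set w | let p := seminal_curve (Pi w) in B0 (start_coords p) /\
       forall i, (i < n)%N -> B i (increment (start p) p i)] =
  (exp_unif R B0 * \prod_(i < n) exp_unif R (B i))%E.
Proof.
move=> mB0 mB.
pose A : set (paths R) := [set p | B0 (start_coords p) /\
   forall i, (i < n)%N -> B i (increment (start p) p i)].
have mid : measurable_fun setT (id : paths R -> paths R) by [].
have mA : measurable A.
  apply: measurableI.
    by rewrite -[X in measurable X]setTI; exact: (measurable_start_coords mid).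
  apply: measurable_cap => // i.
  exact: (measurable_increment (measurable_start mid) mid).
have [G [mG G0 Gw]] := good_event hPi.
rewrite [LHS](first_law hPi mA).
apply: (resample_product (@measurable_first_state R) (measurable_first_curve hPi) mA
   mB0 mB mG G0).
  move=> z w sz /Gw[fL _]; have [sE cE] := recover_start sz fL.
  by rewrite /A/= /first_curve/= sE cE.
by move=> z sz; apply: increments_law => //; exact: valid_first.
Qed.

End independence_of_increments.

(** * Slopes of concave curves *)

Section slopes.
Context {R : realType}.
Implicit Types (p : R -> R) (L : set (line R)).

Lemma left_slope_affine p (r s c m : R) : r < s ->
  (forall q, r <= q <= s -> p q = c + m * q) -> left_slope p s = m.
Proof.
move=> rs pE; apply: cvg_lim => //.
apply: cvg_near_cst; near=> t.
have ts : t < s by near: t; exact: nbhs_left_lt.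
have rt : r < t by near: t; exact: nbhs_left_gt.
rewrite !pE ?(ltW rs) ?lexx ?(ltW rt) ?(ltW ts)//.
by field; rewrite subr_eq0 lt_eqF.
Unshelve. all: by end_near. Qed.

Definition concave_nondecreasing p :=
  (forall q r, 0 < q -> q <= r -> 0 <= p q <= p r) /\
  (forall q r s, 0 < q -> q < r -> r < s ->
     (s - r) * (p r - p q) >= (r - q) * (p s - p r)).

Lemma concave_secants p (q r s t : R) : concave_nondecreasing p ->
  0 < q -> q < r -> r <= s -> s < t ->
  (p t - p s) / (t - s) <= (p r - p q) / (r - q).
Proof.
move=> [_ cp] q0 qr rs st.
have adj x y z : 0 < x -> x < y -> y < z -> (p z - p y) / (z - y) <= (p y - p x) / (y - x).
  move=> x0 xy yz; rewrite ler_pdivrMr ?subr_gt0// mulrAC ler_pdivlMr ?subr_gt0//.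
  by have := cp _ _ _ x0 xy yz; rewrite mulrC (mulrC (z - y)).
move: rs st; rewrite le_eqVlt => /predU1P[<- st|rs st]; first exact: adj.
by apply: (le_trans (adj r s t (lt_trans q0 qr) rs st)); exact: adj.
Qed.

(** [tangent] only uses rational times below 1; the bound extends to time 1
    because the curve is nondecreasing. *)
Lemma tangent_bounds p : concave_nondecreasing p ->
  0 <= tangent 0 1 p /\
  forall t, 0 < t -> t < 1 -> tangent 0 1 p * (1 - t) <= p 1 - p t.
Proof.
move=> cp; have [mono _] := cp.
have inh (a : R) : 0 < a -> a < 1 -> exists q r : rat,
    [/\ a < ratr q, (ratr q : R) < ratr r & ratr r < (1 : R)].
  move=> a0 a1; have [r] := rat_in_itvoo a1; rewrite in_itv/= => /andP[ar r1].
  by have [q] := rat_in_itvoo ar; rewrite in_itv/= => /andP[aq qr]; exists q, r.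
have T0 : 0 <= tangent 0 1 p.
  have [||q [r [q0 qr r1]]] := inh 2^-1; [lra..|].
  apply: lb_le_inf.
    exists (Num.max 0 ((p (ratr r) - p (ratr q)) / (ratr r - ratr q))), q, r.
    by split => //; [apply: lt_trans q0; lra|exact: ltW].
  by move=> y [q' [r' [_ _ _ _ ->]]]; rewrite le_max lexx.
have Tle q r : 0 < q -> q < r -> r < 1 -> tangent 0 1 p * (r - q) <= p r - p q.
  move=> q0 qr r1; rewrite -ler_pdivlMr ?subr_gt0//.
  have [||a [b [ra ab b1]]] := inh r => //; first exact: lt_trans qr.
  have a0 : 0 < (ratr a : R) by rewrite (lt_trans q0)// (lt_trans qr).
  apply: (@le_trans _ _ (Num.max 0 ((p (ratr b) - p (ratr a)) / (ratr b - ratr a)))).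
    apply: ge_inf; first by exists 0 => y [q' [r' [_ _ _ _ ->]]]; rewrite le_max lexx.
    by exists a, b; split => //; exact: ltW.
  rewrite ge_max; apply/andP; split.
    rewrite divr_ge0 ?subr_ge0// ?(ltW qr)//.
    by have /andP[] := mono _ _ q0 (ltW qr).
  by apply: concave_secants => //; exact: ltW.
split => // t t0 t1; apply/ler_addgt0Pl => e e0.
set T := tangent 0 1 p.
have d0 : 0 < e / (T + 1) by rewrite divr_gt0// ltr_wpDl.
pose r := Num.max ((t + 1) / 2) (1 - e / (T + 1)).
have r1 : r < 1 by rewrite gt_max gtrBl d0 andbT; lra.
have tr : t < r by rewrite lt_max; apply/orP; left; lra.
have re : 1 - r <= e / (T + 1).
  have : 1 - e / (T + 1) <= r by rewrite /r le_max lexx orbT.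
  by lra.
have h := Tle _ _ t0 tr r1.
have /andP[_ m] := mono _ _ (lt_trans t0 tr) (ltW r1).
have h2 : T * (1 - r) <= e.
  apply: (@le_trans _ _ (T * (e / (T + 1)))); first by rewrite ler_wpM2l.
  rewrite mulrA ler_pdivrMr ?ltr_wpDl// mulrC ler_wpM2l ?(ltW e0)//.
  by rewrite lerDl.
rewrite -/T in h; have -> : T * (1 - t) = T * (1 - r) + T * (r - t) by ring.
lra.
Qed.

(** By concavity this holds for the seminal curve of every set of lines, whence
    the measurability of the slope at 1 on the whole sample space. *)
Lemma left_slope_tangent p : concave_nondecreasing p ->
  left_slope p 1 = tangent 0 1 p.
Proof.
move=> cp; have [T0 Tle] := tangent_bounds cp; have [mono _] := cp.
apply: cvg_lim => //; apply/cvgrPdist_le => /= e e0.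
have [y [q [r [q0 qr r1 rs yE]]] yT] :
    exists2 y, (exists q r : rat, [/\ 0 < (ratr q : R), ratr q < (ratr r : R),
      ratr r <= (1 : R), ratr r < (1 : R) &
      y = Num.max 0 ((p (ratr r) - p (ratr q)) / (ratr r - ratr q))]) &
      y < tangent 0 1 p + e.
  apply: inf_adherent => //; split; last first.
    by exists 0 => y [q' [r' [_ _ _ _ ->]]]; rewrite le_max lexx.
  have h : (2^-1 : R) < 1 by lra.
  have [r] := rat_in_itvoo h; rewrite in_itv/= => /andP[hr r1].
  have [q] := rat_in_itvoo hr; rewrite in_itv/= => /andP[hq qr].
  eexists; exists q, r; split => //; last exact: ltW.
  by apply: lt_trans hq; lra.
near=> t.
have t1 : t < 1 by near: t; exact: nbhs_left_lt.
have rt : ratr r < t by near: t; exact: nbhs_left_gt.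
have t0 : 0 < t by rewrite (lt_trans q0)// (lt_trans qr).
have low : tangent 0 1 p <= (p t - p 1) / (t - 1).
  rewrite -mulrNN -invrN !opprB ler_pdivlMr ?subr_gt0//.
  exact: Tle.
have up : (p t - p 1) / (t - 1) <= tangent 0 1 p + e.
  rewrite -mulrNN -invrN !opprB.
  apply: (le_trans (concave_secants cp q0 qr (ltW rt) t1)).
  by apply: le_trans (ltW yT); rewrite yE le_max lexx orbT.
rewrite ler_norml; apply/andP; split; lra.
Unshelve. all: by end_near. Qed.

Lemma concave_seminal L : concave_nondecreasing (seminal_curve L).
Proof.
rewrite -[seminal_curve L]/(envelope (positive_lines L)).
have up := @upward_positive _ L.
have [ne|e] := pselect (positive_lines L !=set0); last first.
  have -> : positive_lines L = set0.
    by apply/seteqP; split => // l Ll; apply: e; exists l.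
  rewrite /concave_nondecreasing /envelope; split => *; rewrite !image_set0 inf0 ?lexx//.
  by rewrite subrr !mulr0.
split => [q r q0 qr|q r s q0 qr rs].
  apply/andP; split.
    by apply: le_envelope => // l Ll; apply: (upward_height_ge0 up) => //; exact: ltW.
  apply: le_envelope => // l Ll; have [_ m0] := up _ Ll.
  apply: (le_trans (envelope_le up Ll (ltW q0))).
  by rewrite (height_affine l q r) lerDl mulr_ge0// subr_ge0.
have sq : 0 < s - q by rewrite subr_gt0 (lt_trans qr).
set E := envelope (positive_lines L).
have : ((s - r) * E q + (r - q) * E s) / (s - q) <= E r.
  apply: le_envelope => // l Ll; rewrite ler_pdivrMr//.
  have h1 := envelope_le up Ll (ltW q0).
  have h2 : E s <= height l s.
    by apply: envelope_le => //; rewrite ltW// (lt_trans q0)// (lt_trans qr).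
  apply: (@le_trans _ _ ((s - r) * height l q + (r - q) * height l s)).
    by apply: lerD; rewrite ler_wpM2l// subr_ge0 ltW.
  rewrite (height_affine l q s) (height_affine l q r).
  by rewrite le_eqVlt; apply/orP; left; apply/eqP; ring.
by rewrite ler_pdivrMr//; lra.
Qed.

End slopes.

(** * The components of the curve *)

Section components.
Context {R : realType}.
Variable L : set (line R).
Notation A := (positive_lines L).
Notation Gam := (seminal_curve L).
Hypothesis finA : locally_finite A.
Hypothesis smallA : forall e : R, 0 < e -> exists2 l, A l & height l 0 < e.

Let upA : upward A := @upward_positive R L.

Let A_pos l : A l -> 0 < height l 0 /\ 0 < slope l.
Proof. by rewrite positive_linesE => -[_ /andP[]]. Qed.

Lemma first_touch : exists l, touches A l 1.
Proof.
have [l0 Al0 _] := smallA ltr01.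
pose F := [set l | A l /\ height l 1 <= height l0 1].
have finF : finite_set F by exact: finA.
have [|l1 [Al1 l1F] mn] := @finite_argmax R _ F (fun l => - height l 1) finF.
  by exists l0.
have mn1 l : A l -> height l1 1 <= height l 1.
  move=> Al; have [h|h] := leP (height l 1) (height l0 1).
    by rewrite -lerN2; exact: mn.
  exact: (le_trans l1F (ltW h)).
pose F1 := F `&` [set l | height l 1 = height l1 1].
have [||l2 [[Al2 l2F] /= e2] mx] := @finite_argmax R _ F1 (@slope R).
- by apply: sub_finite_set finF => ? [].
- by exists l1; split.
exists l2; split => // l Al; rewrite e2; split; first exact: mn1.
by move=> e; apply: mx; split => //; split => //; rewrite e.
Qed.

(** Iterate [next_line], starting from the line that touches the curve at time 1;
    the lines of small intercept guarantee that there is always a next one. *)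
Lemma components_chain : exists (ell : nat -> line R) (S : nat -> R),
  [/\ S 0%N = 1, forall n, 0 < S n.+1 < S n, forall n, touches A (ell n) (S n) &
    forall n, [/\ height (ell n.+1) 0 < height (ell n) 0,
       slope (ell n) < slope (ell n.+1),
       height (ell n.+1) (S n.+1) = height (ell n) (S n.+1) &
       forall q, S n.+1 <= q <= S n -> Gam q = height (ell n) q]].
Proof.
pose T := {ls : line R * R | 0 < ls.2 /\ touches A ls.1 ls.2}.
have step (t : T) : exists t' : T,
    [/\ (sval t').2 < (sval t).2, height (sval t').1 0 < height (sval t).1 0,
     slope (sval t).1 < slope (sval t').1,
     height (sval t').1 (sval t').2 = height (sval t).1 (sval t').2 &
     forall q, (sval t').2 <= q <= (sval t).2 -> Gam q = height (sval t).1 q].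
  case: t => [[l s] /= [s0 tl]].
  have [h0 _] := A_pos tl.1.
  have [l1 [s1 [/andP[s10 s1s] tl1 [h m] meet env]]] :=
    next_line upA finA s0 tl (smallA h0).
  by exists (exist _ (l1, s1) (conj s10 tl1)); split.
have [f fP] := choice step.
have [l tl] := first_touch.
pose t0 : T := exist _ (l, 1) (conj ltr01 tl).
pose t n := iter n f t0.
exists (fun n => (sval (t n)).1), (fun n => (sval (t n)).2); split => //.
- by move=> n; have [lt _ _ _ _] := fP (t n); have [-> _] := svalP (t n.+1).
- by move=> n; have [] := svalP (t n).
- by move=> n; have [] := fP (t n).
Qed.

Section chain.
Variables (ell : nat -> line R) (S : nat -> R).
Hypotheses (S0 : S 0%N = 1) (SS : forall n, 0 < S n.+1 < S n).
Hypothesis tch : forall n, touches A (ell n) (S n).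
Hypothesis nxt : forall n, [/\ height (ell n.+1) 0 < height (ell n) 0,
       slope (ell n) < slope (ell n.+1),
       height (ell n.+1) (S n.+1) = height (ell n) (S n.+1) &
       forall q, S n.+1 <= q <= S n -> Gam q = height (ell n) q].

Let S_gt0 n : 0 < S n.
Proof. by case: n => [|n]; [rewrite S0|have /andP[] := SS n]. Qed.

Let S_lt n : S n.+1 < S n. Proof. by have /andP[] := SS n. Qed.

Let S_le m n : (m <= n)%N -> S n <= S m.
Proof.
elim: n => [|n ih]; first by rewrite leqn0 => /eqP ->.
rewrite leq_eqVlt => /orP[/eqP ->//|/ih]; apply: le_trans.
exact: ltW.
Qed.

Let S_le1 n : S n <= 1. Proof. by rewrite -S0 S_le. Qed.

Let GamE n q : S n.+1 <= q <= S n -> Gam q = height (ell n) q.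
Proof. by have [_ _ _] := nxt n; apply. Qed.

Lemma chain_slope_lt m n : (m < n)%N -> slope (ell m) < slope (ell n).
Proof.
elim: n => // n ih; rewrite ltnS leq_eqVlt => /orP[/eqP ->|/ih h].
  by have [] := nxt n.
by apply: (lt_trans h); have [] := nxt n.
Qed.

Lemma chain_left_slope n s : S n.+1 < s -> s <= S n ->
  left_slope Gam s = slope (ell n).
Proof.
move=> ns sn; apply: (@left_slope_affine _ _ (S n.+1) _ (height (ell n) 0)) => //.
move=> q /andP[nq qs]; rewrite -heightE; apply: GamE.
by rewrite nq (le_trans qs).
Qed.

(** Otherwise infinitely many lines would pass below a fixed height at a fixed
    positive time. *)
Lemma chain_vanishes e : 0 < e -> exists n, S n.+1 < e.
Proof.
move=> e0; apply: contrapT => /forallNP h.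
have eS n : e <= S n.+1 by rewrite leNgt; apply/negP; exact: h.
have : finite_set (range ell).
  apply: sub_finite_set (finA (Gam 1) e0) => _ [n _ <-].
  have [An tn] := tch n; split => //.
  have m0 : 0 <= slope (ell n) by have [] := upA An.
  apply: (@le_trans _ _ (height (ell n) (S n))).
    rewrite (height_affine _ e (S n)) lerDl mulr_ge0// subr_ge0.
    by apply: (le_trans (eS n)); exact: ltW.
  rewrite -(envelope_touches upA (tch n) (ltW (S_gt0 n))).
  have [cn _] := concave_seminal L.
  by have /andP[] := cn _ _ (S_gt0 n) (S_le1 n).
move=> fin; have [|l [n _ <-] mx] := finite_argmax (@slope R) fin.
  by exists (ell 0%N), 0%N.
by have := mx _ (ex_intro2 _ _ n.+1 I erefl); rewrite leNgt chain_slope_lt.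
Qed.

Lemma chain_index s : 0 < s -> s <= 1 -> exists n, S n.+1 < s <= S n.
Proof.
move=> s0 s1; have [n] := chain_vanishes s0.
elim: n => [|n ih] sn; first by exists 0%N; rewrite sn S0.
have [h|h] := ltP (S n.+1) s; first exact: ih.
by exists n.+1; rewrite sn h.
Qed.

Lemma chain_slope_change : slope_change_times Gam S.
Proof.
split => //; apply/seteqP; split => s.
  move=> [n _ <-]; split; first by rewrite S_gt0/= (lt_le_trans (S_lt n) (S_le1 n)).
  rewrite (@chain_left_slope n.+1) ?S_lt// => cvg1.
  have cvg2 : left_slope Gam t @[t --> (S n.+1)^'+] --> slope (ell n).
    apply: cvg_near_cst; near=> t.
    have h1 : S n.+1 < t by near: t; exact: nbhs_right_gt.
    have h2 : t < S n by near: t; apply: nbhs_right_lt; exact: S_lt.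
    by rewrite (@chain_left_slope n)// ltW.
  have e : slope (ell n.+1) = slope (ell n).
    by apply: (cvg_unique _ cvg1 cvg2); exact: norm_hausdorff.
  by have := chain_slope_lt (ltnSn n); rewrite e => /lt_eqF; rewrite eqxx.
move=> [/andP[s0 s1] nc]; have [n /andP[ns sn]] := chain_index s0 (ltW s1).
case: n ns sn => [|n] ns sn.
  exfalso; apply: nc; rewrite (@chain_left_slope 0)//.
  apply: cvg_near_cst; near=> t.
  have h1 : s < t by near: t; exact: nbhs_right_gt.
  have h2 : t < 1 by near: t; exact: nbhs_right_lt.
  by rewrite (@chain_left_slope 0)//; [exact: lt_trans h1|rewrite S0 ltW].
have [e|ne] := eqVneq s (S n.+1); first by exists n.
exfalso; apply: nc; rewrite (@chain_left_slope n.+1)//.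
have lts : s < S n.+1 by rewrite lt_neqAle ne.
apply: cvg_near_cst; near=> t.
have h1 : s < t by near: t; exact: nbhs_right_gt.
have h2 : t < S n.+1 by near: t; exact: nbhs_right_lt.
by rewrite (@chain_left_slope n.+1)//; [exact: lt_trans h1|rewrite ltW].
Unshelve. all: by end_near. Qed.

Lemma line_eq2 (l l' : line R) (q r : R) : q < r ->
  height l q = height l' q -> height l r = height l' r -> l = l'.
Proof.
move=> qr; rewrite (height_affine l q r) (height_affine l' q r) => e1.
rewrite e1 => /addrI/(mulIf _) e2.
have e3 : slope l = slope l' by apply: e2; rewrite subr_eq0 gt_eqF.
rewrite -(mklineK l) -(mklineK l') e3; congr mkline.
by move: e1; rewrite (heightE l q) (heightE l' q) e3 => /addIr.
Qed.

(** Two distinct lines cannot agree on an interval, and every interval meets one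
    of the pieces of the chain in an interval. *)
Lemma chain_components : component_lines L ell.
Proof.
split.
  move=> n; have [_ m meet _] := nxt n.
  rewrite (height_affine (ell n.+1) (S n.+1) 1) (height_affine (ell n) (S n.+1) 1) meet.
  by rewrite ltrD2l ltr_pM2r// subr_gt0 (lt_le_trans (S_lt n) (S_le1 n)).
apply/seteqP; split => l.
  move=> [n _ <-]; split; first exact: (tch n).1.
  by exists (S n.+1), (S n); split => // q; exact: GamE.
move=> [Al [a [b [a0 ab b1 GE]]]].
have [n /andP[nb bn]] := chain_index (lt_trans a0 ab) b1.
exists n => //; pose q := Num.max a (S n.+1).
have qb : q < b by rewrite gt_max ab nb.
apply: (@line_eq2 _ _ q b) => //.
  rewrite -GamE; last by rewrite le_max lexx orbT (le_trans (ltW qb)).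
  by rewrite GE// le_max lexx (ltW qb).
rewrite -GamE; last by rewrite (ltW nb) bn.
by rewrite GE// (ltW ab) lexx.
Qed.

(** The states read on the curve by [next] are the lines and times of the chain.
    This links the increments, whose law is known, to the geometric objects. *)
Lemma chain_walk n : walk (start Gam) Gam n = (height (ell n) 0, slope (ell n), S n).
Proof.
have secant k q r : 0 < q -> q < r -> r < S k ->
    slope (ell k) * (r - q) <= Gam r - Gam q.
  move=> q0 qr rs.
  by apply: (envelope_secant upA (tch k) (ltW q0) (ltW qr) (ltW rs)).
have germ k : exists2 r, 0 < r < S k & forall q, r <= q -> q < S k ->
    Gam q = height (ell k) 0 + slope (ell k) * q.
  exists (S k.+1) => // q rq qk; rewrite -heightE; apply: GamE.
  by rewrite rq ltW.
elim: n => [|n ih].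
  have tE : tangent 0 1 Gam = slope (ell 0%N).
    have [r] := germ 0%N; rewrite S0 => r01 gE.
    apply: (@tangent_eq _ 0 Gam (height (ell 0%N) 0)) => //.
    - by have [_ /ltW] := A_pos (tch 0%N).1.
    - by move=> q r' q0 qr r1; apply: secant => //; rewrite S0.
    - by exists r.
  rewrite /walk/= /start tE S0 (@GamE 0%N) ?S0 ?lexx ?andbT; last first.
    by rewrite -S0 ltW.
  by rewrite (heightE (ell 0%N) 1) mulr1 addrK.
rewrite /walk iterS -/(walk _ _ n) ih.
have [_ m meet _] := nxt n.
have [] := @next_eq _ (height (ell n) 0, slope (ell n), S n) Gam
  (height (ell n.+1) 0) (slope (ell n.+1)) (S n.+1) => //.
- exact: ltW.
- by rewrite -!heightE.
- move=> q nq qn; rewrite [leLHS]/= -[X in X <= _](heightE (ell n) q) (@GamE n)//.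
  by rewrite nq ltW.
- move=> q q0 qn; rewrite -heightE.
  by apply: (envelope_le upA (tch n.+1).1 (ltW q0)).
- by move=> q r; exact: secant.
Qed.

Lemma chain_increment n : increment (start Gam) Gam n =
  (height (ell n) 0 ^+ 2 / 4 * ((S n.+1)^-1 - (S n)^-1),
   ((slope (ell n.+1) - slope (ell n)) * S n.+1 / height (ell n) 0) ^+ 2).
Proof.
have := chain_walk n.+1; rewrite /walk iterS -/(walk _ _ n) chain_walk.
by rewrite /increment chain_walk /next /coords => -[_ -> ->].
Qed.

Lemma chain_recursion n :
  let Y := y_intercept Gam (S n) in
  [/\ forall s, S n.+1 < s <= S n -> slope (ell n) = left_slope Gam s,
      height (ell n) 0 = Y,
      (S n.+1)^-1 = (S n)^-1 + 4 / Y ^+ 2 * (increment (start Gam) Gam n).1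
    & left_slope Gam (S n.+1) = left_slope Gam (S n) +
        Y / S n.+1 * Num.sqrt (increment (start Gam) Gam n).2].
Proof.
have sE k : left_slope Gam (S k) = slope (ell k) by apply: chain_left_slope.
have yE : y_intercept Gam (S n) = height (ell n) 0.
  rewrite /y_intercept sE (@GamE n) ?lexx ?andbT ?(ltW (S_lt n))//.
  by rewrite (heightE _ (S n)); ring.
have [h0 _] := A_pos (tch n).1.
have [_ m _ _] := nxt n.
split.
- by move=> s /andP[ns sn]; rewrite (@chain_left_slope n).
- by [].
- by rewrite yE chain_increment/=; field; rewrite !gt_eqF.
- rewrite yE chain_increment !sE/= sqrtr_sqr ger0_norm; last first.
    by rewrite divr_ge0 ?mulr_ge0 ?subr_ge0// ltW.
  by field; rewrite !gt_eqF.
Qed.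

End chain.

Lemma curve_structure : exists (S : nat -> R) (ell : nat -> line R),
  [/\ slope_change_times Gam S, component_lines L ell &
    let Y := fun n => y_intercept Gam (S n) in
    forall n, [/\ forall s, S n.+1 < s <= S n -> slope (ell n) = left_slope Gam s,
      height (ell n) 0 = Y n,
      (S n.+1)^-1 = (S n)^-1 + 4 / Y n ^+ 2 * (increment (start Gam) Gam n).1
    & left_slope Gam (S n.+1) = left_slope Gam (S n) +
        Y n / S n.+1 * Num.sqrt (increment (start Gam) Gam n).2]].
Proof.
have [ell [S [S0 SS tch nxt]]] := components_chain.
exists S, ell; split.
- exact: (chain_slope_change S0 SS tch nxt).
- exact: (chain_components S0 SS tch nxt).
- by move=> Y n; exact: (chain_recursion S0 SS tch nxt).
Qed.

End components.

(** * The joint law of the variables *)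

Section final.
Context {R : realType} {d} {Omega : measurableType d}.
Variables (P : probability Omega R) (Pi : Omega -> set (line R)).
Hypothesis hPi : is_poisson_process P (line_intensity R) Pi.
Notation pairT := (measurableTypeR R * measurableTypeR R)%type.
Notation leb := (@lebesgue_measure R).

Let curve w : paths R := seminal_curve (Pi w).

Let mcurve : measurable_fun setT curve := measurable_seminal hPi.

Let incr n w : R * R := increment (start (curve w)) (curve w) n.

Let mincr n : measurable_fun setT (incr n).
Proof. by apply: measurable_increment => //; exact: measurable_start. Qed.

Let orig w : R * R := start_coords (curve w).

Let morig : measurable_fun setT orig.
Proof. exact: measurable_start_coords. Qed.

Let Evar n w : R := (incr n w).1.
Let Uvar n w : R := (incr n w).2.

Let mEvar n : measurable_fun setT (Evar n).
Proof. exact: (measurableT_comp measurable_fst (mincr n)). Qed.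

Let mUvar n : measurable_fun setT (Uvar n).
Proof. exact: (measurableT_comp measurable_snd (mincr n)). Qed.

Definition exp_var n : {RV P >-> R} :=
  HB.pack (Evar n) (isMeasurableFun.Build _ _ _ _ _ (mEvar n)).
Definition unif_var n : {RV P >-> R} :=
  HB.pack (Uvar n) (isMeasurableFun.Build _ _ _ _ _ (mUvar n)).

Let Gam1 w : R := seminal_curve (Pi w) 1.
Let Gam1' w : R := left_slope (seminal_curve (Pi w)) 1.

Let Gam1'E w : Gam1' w = tangent 0 1 (curve w).
Proof. exact: left_slope_tangent (concave_seminal _). Qed.

Lemma measurable_curve_value : measurable_fun setT Gam1.
Proof.
have h1 : 0 < (1 : R) <= 1 by rewrite ltr01 lexx.
exact: (measurableT_comp (measurable_eval h1) mcurve).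
Qed.

Lemma measurable_curve_slope : measurable_fun setT Gam1'.
Proof.
rewrite (_ : Gam1' = fun w => tangent 0 1 (curve w)).
  exact: (measurable_tangent mcurve).
by apply/funext => w; exact: Gam1'E.
Qed.

Let Gam1_ge0 w : 0 <= Gam1 w.
Proof. by have [h _] := concave_seminal (Pi w); have /andP[] := h 1 1 ltr01 (lexx _). Qed.

(* Inverse of [start_coords], so that the pair formed by the value and the slope
   at time 1 is a function of an exponential and a uniform variable. *)
Let read (z : pairT) : R * R := (2 * Num.sqrt z.1, 2 * Num.sqrt z.1 * z.2).

Let mread : measurable_fun setT read.
Proof.
have m1 : measurable_fun setT (fun z : pairT => 2 * Num.sqrt (z.1 : R)).
  by apply: measurable_funM => //; apply: measurable_sqrtr; exact: measurable_fst.
apply: measurable_fun_pair => //; apply: measurable_funM => //.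
Qed.

Let read_orig w : read (orig w) = (Gam1 w, Gam1' w).
Proof.
have h : 2 * Num.sqrt (Gam1 w ^+ 2 / 4) = Gam1 w.
  have -> : Gam1 w ^+ 2 / 4 = (Gam1 w / 2) ^+ 2 by field.
  by rewrite sqrtr_sqr ger0_norm ?divr_ge0//; field.
rewrite /read /orig/= -/(Gam1 w) h; congr pair.
rewrite Gam1'E; have [g0|g0] := eqVneq (Gam1 w) 0; last by field.
rewrite g0 mul0r; have [T0 Tle] := tangent_bounds (concave_seminal (Pi w)).
have [mono _] := concave_seminal (Pi w).
have h2 : (0 : R) < 2^-1 by lra.
have h3 : (2^-1 : R) < 1 by lra.
have := Tle _ h2 h3; rewrite -/(Gam1 w) g0 -/(curve w) => h4.
have /andP[h5 _] := mono _ 1 h2 (ltW h3).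
apply/le_anti/andP; split => //.
by move: h4 h5; rewrite -/(curve w); lra.
Qed.

Let orig_law (B : set pairT) : measurable B -> P (orig @^-1` B) = exp_unif R B.
Proof.
move=> mB; have := start_law hPi 0 mB (fun _ => measurableT).
rewrite big_ord0 mule1 => <-; congr (P _).
by apply/seteqP; split => w /=; [move=> h; split|case].
Qed.

Let incr_law n (B : set pairT) : measurable B -> P (incr n @^-1` B) = exp_unif R B.
Proof.
move=> mB; pose C i : set pairT := if i == n then B else setT.
have mC i : measurable (C i) by rewrite /C; case: ifP.
have := start_law hPi n.+1 measurableT mC.
rewrite big_ord_recr/= big1 ?mul1e; last first.
  by move=> i _; rewrite /C ltn_eqF// probability_setT.
rewrite /C eqxx => h.
transitivity (exp_unif R setT * exp_unif R B)%E; last by rewrite probability_setT mul1e.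
rewrite -h; congr (P _); apply/seteqP; split => w /=.
  by move=> hB; split => // i _; case: eqP => // ->.
by move=> [_ /(_ n (ltnSn n))]; rewrite eqxx.
Qed.

Let exp_unifX (B C : set R) : measurable B -> measurable C ->
  exp_unif R (B `*` C) = (exponential_prob 1 B * uniform_prob (@ltr01 R) C)%E.
Proof. by move=> mB mC; exact: product_measure1E. Qed.

Lemma exp_var_law n (B : set R) : measurable B ->
  distribution P (exp_var n) B = exponential_prob 1 B.
Proof.
move=> mB; have mBT : measurable (B `*` setT : set pairT) by exact: measurableX.
have := incr_law n mBT; rewrite exp_unifX// (_ : uniform_prob _ setT = 1%E); last first.
  exact: probability_setT.
rewrite mule1 => <-; rewrite /distribution /pushforward; congr (P _).
by apply/seteqP; split => w /=; [split|case].
Qed.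

Lemma unif_var_law n (B : set R) : measurable B ->
  distribution P (unif_var n) B = uniform_prob (@ltr01 R) B.
Proof.
move=> mB; have mBT : measurable (setT `*` B : set pairT) by exact: measurableX.
have := incr_law n mBT; rewrite exp_unifX// (_ : exponential_prob 1 setT = 1%E); last first.
  exact: (probability_setT (exp1 R)).
rewrite mul1e => <-; rewrite /distribution /pushforward; congr (P _).
by apply/seteqP; split => w /=; [split|case].
Qed.

Lemma curve_value_law (gamma : R) : 0 < gamma ->
  P [set w | gamma < Gam1 w] = (expR (- (gamma ^+ 2 / 4)))%:E.
Proof.
move=> g0; set a := gamma ^+ 2 / 4.
have a0 : 0 < a by rewrite divr_gt0// exprn_gt0.
have mI : measurable ([set` `]a, +oo[] : set R) by exact: measurable_itv.
have mIT : measurable ([set` `]a, +oo[] `*` setT : set pairT) by exact: measurableX.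
transitivity (P (orig @^-1` ([set` `]a, +oo[] `*` setT))).
  have sq w : (a < (orig w).1) = (gamma < Gam1 w).
    rewrite /a /orig/= -/(curve w) -/(Gam1 w) ltr_pM2r ?invr_gt0//.
    by rewrite ltr_pXn2r// nnegrE ?(ltW g0) ?Gam1_ge0.
  congr (P _); apply/seteqP; split => w /=.
    by move=> h; split => //=; rewrite in_itv/= andbT sq.
  by rewrite in_itv/= andbT sq => -[].
rewrite orig_law// exp_unifX// (_ : uniform_prob _ setT = 1%E) ?mule1; last first.
  exact: probability_setT.
have -> : [set` `]a, +oo[] = ~` [set` `]-oo, a]] :> set R.
  by rewrite setCitvl.
rewrite [LHS](probability_setC (exp1 R)); last exact: measurable_itv.
have -> : exp1 R [set` `]-oo, a]] = exponential_prob 1 `[0, a].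
  rewrite -[LHS]/(exponential_prob 1 [set` `]-oo, a]]) /exponential_prob.
  rewrite [LHS]integral_mkcond [RHS]integral_mkcond.
  apply: eq_integral => e _; rewrite !patchE.
  have [e0|e0] := ltP e 0.
    rewrite lt0_exponential_pdf//; case: ifP => _; by case: ifP.
  congr (if _ then _ else _); apply/idP/idP; rewrite !inE/= !in_itv/= ?e0//.
transitivity ((1 - (1 - expR (- 1 * a)))%:E)%E.
  by rewrite EFinB; congr (_ - _)%E; exact: exponential_prob_itv0c.
by congr EFin; rewrite mulN1r; ring.
Qed.

Let joint_law N (B0 : set pairT) (C D : nat -> set R) :
  measurable B0 -> (forall k, measurable (C k)) -> (forall k, measurable (D k)) ->
  P [set w | B0 (orig w) /\ forall k, (k < N)%N -> C k (Evar k w) /\ D k (Uvar k w)] =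
  (exp_unif R B0 * (\prod_(0 <= k < N) exponential_prob 1 (C k) *
                    \prod_(0 <= k < N) uniform_prob (@ltr01 R) (D k)))%E.
Proof.
move=> mB0 mC mD.
have mCD k : measurable (C k `*` D k : set pairT) by exact: (measurableX (mC k) (mD k)).
rewrite -big_split/= big_mkord.
transitivity (exp_unif R B0 * \prod_(k < N) exp_unif R (C k `*` D k))%E; last first.
  by congr (_ * _)%E; apply: eq_bigr => k _; exact: exp_unifX.
by rewrite -(start_law hPi N mB0 mCD).
Qed.

(** A finite set of indices involves finitely many steps; the sets that it
    does not prescribe are taken to be the whole space. *)
Lemma independent_variables : mutually_independent P
  (joint_family (fun w => (Gam1 w, Gam1' w))
     (fun n => exp_var n : Omega -> R) (fun n => unif_var n : Omega -> R)).
Proof.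
move=> J A JA.
have [B0 [mB0 B0T B0A]] : exists B : set pairT, [/\ measurable B,
    None \notin J -> B = setT & None \in J -> A None = orig @^-1` B].
  have [nJ|nJ] := boolP (None \in J); last by exists setT.
  have [B mB AB] := JA _ nJ; exists (read @^-1` B); split => //.
    by rewrite -[X in measurable X]setTI; exact: mread.
  move=> _; rewrite -AB setTI; apply/seteqP.
  by split => w /=; rewrite read_orig.
have pick (i : nat -> option (nat + nat)) (X : nat -> Omega -> R) :
    (forall k, i k \in J -> generated_by (X k : Omega -> measurableTypeR R) (A (i k))) ->
    exists B : nat -> set R, [/\ forall k, measurable (B k),
      forall k, i k \notin J -> B k = setT &
      forall k, i k \in J -> A (i k) = X k @^-1` B k].
  move=> iJ.
  have /choice[B hB] : forall k, exists B : set R, [/\ measurable B,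
      i k \notin J -> B = setT & i k \in J -> A (i k) = X k @^-1` B].
    move=> k; have [ik|ik] := boolP (i k \in J); last by exists setT.
    by have [B mB AB] := iJ _ ik; exists B; split => // _; rewrite -AB setTI.
  by exists B; split => k; have [] := hB k.
have [C [mC CT CA]] := pick (fun k => Some (inl k)) Evar (fun k => JA (Some (inl k))).
have [D [mD DT DA]] := pick (fun k => Some (inr k)) Uvar (fun k => JA (Some (inr k))).
pose step (i : option (nat + nat)) : nat :=
  match i with None => 0 | Some (inl k) => k.+1 | Some (inr k) => k.+1 end.
pose N := (\max_(i <- J) step i)%N.
have stepN i : i \in J -> (step i <= N)%N.
  by move=> iJ; apply: leq_bigmax_seq.
pose a i : \bar R := match i with None => exp_unif R B0
  | Some (inl k) => exponential_prob 1 (C k)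
  | Some (inr k) => uniform_prob (@ltr01 R) (D k) end.
have aT i : i \notin J -> a i = 1%E.
  case: i => [[k|k]|] iJ /=.
  - by rewrite CT//; exact: (probability_setT (exp1 R)).
  - by rewrite DT//; exact: probability_setT.
  - by rewrite B0T//; exact: probability_setT.
have aA i : i \in J -> P (A i) = a i.
  case: i => [[k|k]|] iJ /=.
  - by rewrite CA// -(exp_var_law k (mC k)).
  - by rewrite DA// -(unif_var_law k (mD k)).
  - by rewrite B0A// orig_law.
rewrite (eq_big_seq a)//.
pose s : seq (option (nat + nat)) := None ::
  ([seq Some (inl k) | k <- iota 0 N] ++ [seq Some (inr k) | k <- iota 0 N]).
have us : uniq s.
  rewrite /s/= mem_cat cat_uniq !map_inj_uniq ?iota_uniq; [|by move=> ? ? []..].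
  rewrite negb_or andbT/= -andbA; apply/and3P; split.
  - by apply/negP => /mapP[].
  - by apply/negP => /mapP[].
  - by apply/hasPn => _ /mapP[k _ ->]; apply/negP => /mapP[].
have Js i : i \in J -> i \in s.
  rewrite /s inE mem_cat; case: i => [[k|k]|]//= /stepN/= kN; apply/orP;
    [left|right]; apply/mapP; exists k => //; by rewrite mem_iota.
have -> : (\prod_(i <- J) a i = \prod_(i <- s) a i)%E.
  rewrite -(perm_big _ (_ : perm_eq [seq i <- s | i \in J] J)).
    rewrite big_filter big_mkcond; apply: eq_bigr => i _.
    by case: ifPn => // /aT.
  apply: uniq_perm; rewrite ?filter_uniq ?fset_uniq// => i.
  by rewrite mem_filter; have [/Js|] := boolP (i \in J).
rewrite big_cons big_cat !big_map/=.
transitivity (exp_unif R B0 * (\prod_(0 <= k < N) exponential_prob 1 (C k) *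
                    \prod_(0 <= k < N) uniform_prob (@ltr01 R) (D k)))%E; last first.
  by rewrite /index_iota subn0.
rewrite -(joint_law N mB0 mC mD); congr (P _); apply/seteqP; split => w.
  move=> h; split.
    have [nJ|nJ] := boolP (None \in J); last by rewrite B0T.
    by have := h None nJ; rewrite B0A.
  move=> k _; split.
    have [nJ|nJ] := boolP (Some (inl k) \in J); last by rewrite CT.
    by have := h _ nJ; rewrite CA.
  have [nJ|nJ] := boolP (Some (inr k) \in J); last by rewrite DT.
  by have := h _ nJ; rewrite DA.
move=> [h0 h] [[k|k]|] iJ /=.
- by rewrite CA//; have [] := h k (stepN _ iJ).
- by rewrite DA//; have [] := h k (stepN _ iJ).
- by rewrite B0A.
Qed.

(** Conditionally on the value [g] at time 1, the slope is [g] times an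
    independent uniform variable: the substitution [x = g u] turns the uniform density on
    [0, g] into the one on [0, 1]. *)
Lemma conditionally_uniform_slope : conditionally_uniform P Gam1 Gam1'.
Proof.
move=> B C mB mC.
have mBC (T : measurableType _) (f g : T -> measurableTypeR R) :
    measurable_fun setT f -> measurable_fun setT g ->
    measurable_fun setT (fun t => (f t \in B) && (g t \in C)).
  move=> mf mg; apply: measurable_and.
    exact: (measurableT_comp (measurable_fun_in mB) mf).
  exact: (measurableT_comp (measurable_fun_in mC) mg).
pose phi (q : pairT) : R :=
  if ((q.1 \in B) && (q.2 \in C)) && (0 <= (q.2 : R) <= q.1) then (q.1 : R)^-1 else 0.
have mphi : measurable_fun setT phi.
  apply: measurable_fun_ifT => //; last first.
    by apply: measurable_funV; exact: measurable_fst.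
  apply: measurable_and; first by apply: mBC; [exact: measurable_fst|exact: measurable_snd].
  apply: measurable_and; apply: measurable_fun_ler => //;
    do ?[exact: measurable_fst|exact: measurable_snd].
have phi0 q : 0 <= phi q.
  rewrite /phi; case: ifP => // /andP[_ /andP[h1 h2]].
  by rewrite invr_ge0 (le_trans h1).
have mphiE : measurable_fun setT (EFin \o phi) by exact/measurable_EFinP.
pose F (g : measurableTypeR R) : \bar R := (\int[leb]_x (phi (g, x))%:E)%E.
have mF : measurable_fun setT F.
  by apply: (measurable_fun_fubini_tonelli_F (m2 := leb) _ mphiE).
have F0 g : (0 <= F g)%E by apply: integral_ge0 => x _; rewrite lee_fin.
pose psi (g u : R) : bool := (g \in B) && (g * u \in C).
have mpsi g : measurable_fun setT (fun u : measurableTypeR R => ((psi g u)%:R : R)%:E).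
  apply/measurable_EFinP.
  apply: (eq_measurable_fun (fun u => if psi g u then 1 else 0 : R)).
    by move=> u _; case: (psi g u).
  apply: measurable_fun_ifT => //; apply: mBC => //.
have FE g : 0 < g -> F g = (\int[leb]_(u in `]0%R, 1%R[) ((psi g u)%:R)%:E)%E.
  move=> g0.
  rewrite integral_itv_obnd_cbnd; last exact: (measurable_funTS (mpsi g)).
  rewrite integral_itv_bndo_bndc; last exact: (measurable_funTS (mpsi g)).
  have mphig : measurable_fun setT (fun x : measurableTypeR R => (phi (g, x))%:E).
    exact: (measurable_fun_pair2 (f := EFin \o phi) g mphiE).
  rewrite /F (@ge0_integral_affine _ g 0)//; last first.
  - by move=> x; rewrite lee_fin.
  rewrite -ge0_integralZl//; last 3 first.
  - apply: (measurableT_comp mphig).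
    by apply: measurable_funD.
  - by move=> x; rewrite lee_fin.
  - by rewrite lee_fin ltW.
  rewrite [RHS]integral_mkcond; apply: eq_integral => u _.
  rewrite patchE /phi/= addr0 -/(psi g u).
  have -> : (u \in [set` `[0%R, 1%R]]) = (0 <= u <= 1).
    by apply/idP/idP; rewrite inE/= in_itv.
  have -> : (0 <= g * u <= g) = (0 <= u <= 1).
    by rewrite pmulr_rge0// -{2}(mulr1 g) ler_pM2l.
  case: (psi g u); case: (0 <= u <= 1) => //=; rewrite ?mule0//.
  by rewrite -EFinM divff ?gt_eqF.
pose D : set pairT := [set z | ((read z).1 \in B) && ((read z).2 \in C)].
have mD : measurable D.
  have m1 := measurableT_comp measurable_fst mread.
  have m2 := measurableT_comp measurable_snd mread.
  have := mBC _ _ _ _ m1 m2 measurableT [set true] I.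
  by rewrite setTI.
transitivity (P (orig @^-1` D)).
  have DE w : D (orig w) <-> (Gam1 w \in B) && (Gam1' w \in C).
    by rewrite -[D _]/(is_true (((read (orig w)).1 \in B) && _)) read_orig.
  congr (P _); apply/seteqP; split => w.
    by move=> [? ?]; apply/DE; rewrite !mem_set.
  by move=> /DE/andP[/set_mem ? /set_mem ?].
rewrite orig_law//.
have mFr : measurable_fun setT (fun z => F (read z).1).
  by apply: (measurableT_comp mF); exact: (measurableT_comp measurable_fst mread).
transitivity (\int[exp_unif R]_z F (read z).1)%E; last first.
  transitivity (\int[image_measure P (T2 := pairT) morig]_z F (read z).1)%E.
    by apply: (eq_measure_integral (image_measure P (T2 := pairT) morig)) => X mX _; rewrite -[LHS]orig_law.
  transitivity (\int[P]_(w in orig @^-1` setT) F (read (orig w)).1)%E.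
    by apply: (@ge0_integral_pushforward _ _ Omega pairT R orig morig P setT
      (fun z => F (read z).1)).
  rewrite preimage_setT [RHS]integral_mkcond; apply: eq_integral => w _.
  rewrite -[LHS]/(F (read (orig w)).1) read_orig patchE /F.
  have [wB|wB] := boolP (w \in Gam1 @^-1` B); last first.
    rewrite integral0_eq// => x _; rewrite /phi/=.
    case: ifP => // /andP[/andP[/set_mem h _] _].
    by move: wB; rewrite mem_set.
  rewrite [RHS]integral_mkcond; apply: eq_integral => x _.
  rewrite patchE /phi/= (mem_set (set_mem wB : B (Gam1 w)))/= /uniform_pdf subr0.
  by case: (x \in C).
rewrite -[LHS](integral_indicT (exp_unif R) mD).
rewrite [LHS]ge0_integral_exp_unif//; last first.
  by apply/measurable_EFinP; exact: measurable_indic.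
rewrite [RHS](ge0_integral_exp_unif mFr (fun=> F0 _)).
apply: eq_integral => e _.
have [e0|e0] := ltP 0 e; last first.
  by apply: eq_integral => u _; rewrite /strip ltNge e0.
pose g : R := 2 * Num.sqrt e.
have g0 : 0 < g by rewrite mulr_gt0// sqrtr_gt0.
have onI (h : R -> \bar R) :
    (\int[leb]_u (if strip e u then (expR (- e))%:E * h u else 0) =
     \int[leb]_(u in `]0%R, 1%R[) ((expR (- e))%:E * h u))%E.
  rewrite [RHS]integral_mkcond; apply: eq_integral => u _.
  rewrite patchE /strip e0/=; congr (if _ then _ else _).
  by apply/idP/idP; rewrite inE/= in_itv.
have len1 : leb [set` `]0%R, 1%R[] = 1%E.
  by rewrite [LHS](lebesgue_measure_itv `]0%R, 1%R[%R)/= lte_fin ltr01 oppr0 adde0.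
transitivity ((expR (- e))%:E * F g)%E; last first.
  by rewrite -[LHS]mule1 -len1 (onI (fun=> F g)) integral_cst.
rewrite FE// -ge0_integralZl//; last exact: (measurable_funTS (mpsi g)).
rewrite (onI (fun u => (\1_D (e, u))%:E)); apply: eq_integral => u _.
rewrite indicE (_ : ((e, u) \in D) = psi g u)//.
by apply/idP/idP; rewrite inE.
Qed.

Lemma structure_ae : {ae P, forall w, exists (S : nat -> R) (ell : nat -> line R),
  [/\ slope_change_times (curve w) S, component_lines (Pi w) ell &
    let Y := fun n => y_intercept (curve w) (S n) in
    forall n, [/\ forall s, S n.+1 < s <= S n -> slope (ell n) = left_slope (curve w) s,
      height (ell n) 0 = Y n,
      (S n.+1)^-1 = (S n)^-1 + 4 / Y n ^+ 2 * exp_var n w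
    & left_slope (curve w) (S n.+1) = left_slope (curve w) (S n) +
        Y n / S n.+1 * Num.sqrt (unif_var n w)]]}.
Proof.
have [G [mG G0 Gw]] := good_event hPi.
exists (~` G); split; [exact: measurableC|exact: G0|].
move=> w; apply: contra_not => /Gw[fin small].
exact: (curve_structure fin small).
Qed.

End final.

(* [E n] and [U n] stand for E_{n+1} and U_{n+1} *)
Theorem theorem4p1 (R : realType) (d : measure_display)
    (Omega : measurableType d) (P : probability Omega R)
    (Pi : Omega -> set (line R))
    (hPi : is_poisson_process P (line_intensity R) Pi) :
  let Gam := fun w => seminal_curve (Pi w) in
  let Gam1 := fun w => Gam w 1 in
  let Gam1' := fun w => left_slope (Gam w) 1 in
  exists E U : nat -> {RV P >-> R},
    [/\ {ae P, forall w, exists (S : nat -> R) (ell : nat -> line R),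
          [/\ slope_change_times (Gam w) S,
              component_lines (Pi w) ell
            & let Y := fun n => y_intercept (Gam w) (S n) in
              forall n : nat,
              [/\ forall s, S n.+1 < s <= S n ->
                    slope (ell n) = left_slope (Gam w) s,
                  height (ell n) 0 = Y n,
                  (S n.+1)^-1 = (S n)^-1 + 4 / Y n ^+ 2 * E n w
                & left_slope (Gam w) (S n.+1) =
                  left_slope (Gam w) (S n)
                    + Y n / S n.+1 * Num.sqrt (U n w)]]},
        (forall n, forall B, measurable B ->
            distribution P (E n) B = exponential_prob 1 B)
        /\ (forall n, forall B, measurable B ->
            distribution P (U n) B = uniform_prob (@ltr01 R) B),
        measurable_fun setT Gam1 /\ measurable_fun setT Gam1',
        mutually_independent P
          (joint_family (fun w => (Gam1 w, Gam1' w))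
             (fun n => E n : Omega -> R) (fun n => U n : Omega -> R))
      & (forall gamma : R, 0 < gamma ->
            P [set w | gamma < Gam1 w] = (expR (- (gamma ^+ 2 / 4)))%:E)
        /\ conditionally_uniform P Gam1 Gam1'].
Proof.
move=> Gam Gam1 Gam1'; exists (exp_var hPi), (unif_var hPi); split.
- exact: (structure_ae hPi).
- by split=> n B; [exact: (exp_var_law hPi)|exact: (unif_var_law hPi)].
- by split; [exact: (measurable_curve_value hPi)|exact: (measurable_curve_slope hPi)].
- exact: (@independent_variables _ _ _ P Pi hPi).
- by split; [exact: (curve_value_law hPi)|exact: (conditionally_uniform_slope hPi)].
Qed.
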